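(* Let $k$ be a commutative ring and let $(\mathcal{A},\otimes,I)$ be a $k$-linear monoidal category which is at the same time abelian. Assume that $\mathcal{A}$ has enough projectives and that the functor $P\otimes -$ is exact for every projective object $P$ of $\mathcal{A}$. Let $\mathbf{A}=\mathrm{REnd}_{\mathcal{A}}(I)$ be the derived endomorphism dg-algebra of the tensor unit. Then there exists a $B_\infty$-algebra $\mathbf{B}$ together with an $A_\infty$-quasi-isomorphism $\mathbf{B}\to\mathbf{A}$.
   Context: **Suspension.** For a graded object or complex $X$, $(\Sigma X)_i=X_{i+1}$ with differential $-d$; $\eta:X\to\Sigma X$ is the identity viewed as a map of degree $-1$, and $sx:=\eta(x)$. The Koszul sign rule is used; differentials have degree $+1$. **Derived endomorphisms.** For an object $M$ of $\mathcal{A}$ with projective resolution $P^\bullet\to M$, $\mathrm{REnd}_{\mathcal{A}}(M)$ is the endomorphism dg-algebra $\mathrm{End}_{\mathcal{A}}(P^\bullet)$; it is independent of $P^\bullet$ in the homotopy category of dg-algebras. **$A_\infty$-algebras and morphisms.** An $A_\infty$-algebra structure on a graded $k$-module $W$ consists of degree $1$ maps $b_n:(\Sigma W)^{\otimes n}\to\Sigma W$, $n\ge 1$, with $\sum_{a+c+b=n} b_{a+1+b}\circ(\mathrm{id}^{\otimes a}\otimes b_c\otimes \mathrm{id}^{\otimes b})=0$ for all $n$. A dg-algebra $(W,d,m)$ is an $A_\infty$-algebra with $b_1$ the differential of $\Sigma W$, $b_2=-\eta\circ m\circ(\eta^{-1}\otimes\eta^{-1})$ and $b_n=0$ for $n\ge3$.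 An $A_\infty$-morphism $f:W\to W'$ is a sequence of degree $0$ maps $f_n:(\Sigma W)^{\otimes n}\to\Sigma W'$, $n\ge1$, with $\sum_{u_1+\cdots+u_r=n} b_r\circ(f_{u_1}\otimes\cdots\otimes f_{u_r})=\sum_{a+c+b=n} f_{a+1+b}\circ(\mathrm{id}^{\otimes a}\otimes b_c\otimes\mathrm{id}^{\otimes b})$; it is an $A_\infty$-quasi-isomorphism if $f_1$ is a quasi-isomorphism. **$B_\infty$-algebras.** For a graded $k$-module $V$ let $T^c(V)=\bigoplus_{n\ge0}V^{\otimes n}$ be the cotensor coalgebra with deconcatenation coproduct $\Delta$, counit $\epsilon$ and coaugmentation $1$. A $\Xi B_\infty$-structure on $V$ is a dg-bialgebra structure $(T^c(V),\Delta,\epsilon,m,1,Q)$ (so $m$ is an associative product with unit $1$ which is a degree $0$ coalgebra map, and $Q$ is a degree $1$ derivation and coderivation with $Q^2=0$). It is determined by the maps $m^{s,t}:V^{\otimes s}\otimes V^{\otimes t}\to V$ and $Q^r:V^{\otimes r}\to V$ obtained by projecting $m$ and $Q$ to $V$, where $Q^0=0$, $m^{0,1}=m^{1,0}=\mathrm{Id}$ and $m^{0,r}=m^{r,0}=0$ for $r\neq1$. A $B_\infty$-algebra is a graded $k$-module $W$ together with a $\Xi B_\infty$-structure on $\Sigma W$; the maps $b_r=Q^r$ then make $W$ into an $A_\infty$-algebra, and this is how $\mathbf{B}$ is regarded as an $A_\infty$-algebra. *)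

(* Defs.v *)
From HB Require Import structures.
From mathcomp Require Import all_boot all_order all_algebra.
From mathcomp Require Import boolp zify.

Set Implicit Arguments.
Unset Strict Implicit.
Unset Printing Implicit Defensive.
Import GRing.Theory.
Local Open Scope ring_scope.
Local Open Scope quotient_scope.

(* The k-module generated by Om, subject to the relations that hold for every
   function phi : Om -> L (L any k-module) in the class C; by construction,
   linear maps out of it correspond to the functions in C (lift, lift_gen).
   With C the bilinear (resp. multilinear) functions this is the tensor
   product (resp. the tensor algebra), which the library does not provide for
   modules over a ring. *)
Section Presented.
Variables (k : comPzRingType) (Om : choiceType).
Variable C : forall L : lmodType k, (Om -> L) -> Prop.

Definition fsum := seq (k * Om).
HB.instance Definition _ := Choice.on fsum.

Definition fsum_eval (L : lmodType k) (phi : Om -> L) (s : fsum) : L :=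
  \sum_(p <- s) p.1 *: phi p.2.

Definition fsum_equiv (s t : fsum) : bool :=
  `[< forall (L : lmodType k) (phi : Om -> L), C phi ->
        fsum_eval phi s = fsum_eval phi t >].

Lemma fsum_equiv_is_equiv : equiv_class_of fsum_equiv.
Proof.
split=> [s|s t|t s u].
- exact/asboolP.
- by apply/asboolP/asboolP => h L phi hp; rewrite h.
- move=> /asboolP h1 /asboolP h2; apply/asboolP => L phi hp.
  by rewrite h1 ?h2.
Qed.
Canonical fsum_equiv_rel := EquivRelPack fsum_equiv_is_equiv.

Definition presented := {eq_quot fsum_equiv_rel}.
HB.instance Definition _ := Choice.on presented.

Let pi (s : fsum) : presented := \pi_{eq_quot fsum_equiv_rel} s.

Definition lift (L : lmodType k) (phi : Om -> L) (x : presented) : L :=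
  fsum_eval phi (repr x).

Lemma lift_pi (L : lmodType k) (phi : Om -> L) s :
  C phi -> lift phi (pi s) = fsum_eval phi s.
Proof.
move=> hp; rewrite /lift.
have /eqmodP/asboolP h : repr (pi s) = s %[mod {eq_quot fsum_equiv_rel}].
  exact: reprK.
exact: h.
Qed.

Lemma pi_eq s t : (forall (L : lmodType k) (phi : Om -> L), C phi ->
        fsum_eval phi s = fsum_eval phi t) -> pi s = pi t.
Proof. by move=> h; apply/eqmodP/asboolP. Qed.

Definition padd (x y : presented) := pi (repr x ++ repr y).
Definition popp (x : presented) := pi [seq (- p.1, p.2) | p <- repr x].
Definition pscale (c : k) (x : presented) := pi [seq (c * p.1, p.2) | p <- repr x].

Lemma pi_repr x : pi (repr x) = x.
Proof. exact: reprK. Qed.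

Lemma presented_ext (x y : presented) :
  (forall (L : lmodType k) (phi : Om -> L), C phi -> lift phi x = lift phi y) -> x = y.
Proof. by move=> h; rewrite -(pi_repr x) -(pi_repr y); apply: pi_eq. Qed.

Lemma lift_add (L : lmodType k) (phi : Om -> L) x y : C phi ->
  lift phi (padd x y) = lift phi x + lift phi y.
Proof. by move=> h; rewrite lift_pi // /fsum_eval big_cat. Qed.
Lemma lift_opp (L : lmodType k) (phi : Om -> L) x : C phi ->
  lift phi (popp x) = - lift phi x.
Proof.
move=> h; rewrite lift_pi // /fsum_eval big_map -sumrN.
by apply: eq_bigr => p _ /=; rewrite scaleNr.
Qed.
Lemma lift_scale (L : lmodType k) (phi : Om -> L) c x : C phi ->
  lift phi (pscale c x) = c *: lift phi x.
Proof.
move=> h; rewrite lift_pi // /fsum_eval big_map scaler_sumr.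
by apply: eq_bigr => p _ /=; rewrite scalerA.
Qed.
Lemma lift_zero (L : lmodType k) (phi : Om -> L) : C phi -> lift phi (pi [::]) = 0.
Proof. by move=> h; rewrite lift_pi // /fsum_eval big_nil. Qed.

Fact paddA : associative padd.
Proof. by move=> x y z; apply: presented_ext => L phi h; rewrite !lift_add // addrA. Qed.
Fact paddC : commutative padd.
Proof. by move=> x y; apply: presented_ext => L phi h; rewrite !lift_add // addrC. Qed.
Fact padd0 : left_id (pi [::]) padd.
Proof. by move=> x; apply: presented_ext => L phi h; rewrite lift_add // lift_zero // add0r. Qed.
Fact paddN : left_inverse (pi [::]) popp padd.
Proof. by move=> x; apply: presented_ext => L phi h;
  rewrite lift_add // lift_opp // lift_zero // addNr. Qed.
HB.instance Definition _ := GRing.isZmodule.Build presented paddA paddC padd0 paddN.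

Fact pscaleA a b x : pscale a (pscale b x) = pscale (a * b) x.
Proof. by apply: presented_ext => L phi h; rewrite !lift_scale // scalerA. Qed.
Fact pscale1 : left_id 1 pscale.
Proof. by move=> x; apply: presented_ext => L phi h; rewrite !lift_scale // scale1r. Qed.
Fact pscaleDr : right_distributive pscale +%R.
Proof. by move=> a x y; apply: presented_ext => L phi h;
  rewrite /= lift_scale // !lift_add // !lift_scale // scalerDr. Qed.
Fact pscaleDl x : {morph pscale^~ x : a b / a + b}.
Proof. by move=> a b; apply: presented_ext => L phi h;
  rewrite /= lift_add // !lift_scale // scalerDl. Qed.
HB.instance Definition _ := GRing.Zmodule_isLmodule.Build k presented
  pscaleA pscale1 pscaleDr pscaleDl.

Definition pgen (w : Om) : presented := pi [:: (1, w)].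

Lemma lift_linear (L : lmodType k) (phi : Om -> L) : C phi -> linear (lift phi).
Proof. by move=> h a x y; rewrite lift_add // lift_scale. Qed.

Lemma lift_gen (L : lmodType k) (phi : Om -> L) w : C phi -> lift phi (pgen w) = phi w.
Proof. by move=> h; rewrite lift_pi // /fsum_eval big_seq1 scale1r. Qed.

Lemma presented_span (x : presented) :
  exists s : seq (k * Om), x = \sum_(p <- s) p.1 *: pgen p.2.
Proof.
exists (repr x); rewrite -{1}(pi_repr x).
elim: (repr x) => [|p s IH].
  by rewrite big_nil; apply: presented_ext.
rewrite big_cons -IH; apply: presented_ext => L phi h.
rewrite lift_add // lift_scale // lift_gen // !lift_pi //.
by rewrite /fsum_eval big_cons.
Qed.
End Presented.

Section Tensor.
Variable k : comPzRingType.

Definition bilinear2 (M N : lmodType k) (L : lmodType k) (phi : M * N -> L) :=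
  (forall y, linear (fun x => phi (x, y))) /\ (forall x, linear (fun y => phi (x, y))).

Definition tensor (M N : lmodType k) : lmodType k := presented (@bilinear2 M N).
Definition tmul (M N : lmodType k) (x : M) (y : N) : tensor M N := pgen (@bilinear2 M N) (x, y).

Definition graded := int -> lmodType k.
(* A graded module is a family of modules indexed by the degree. A letter is a
   homogeneous element together with its degree, and the word v1 ... vn
   of letters stands for the elementary tensor of its letters. *)
Definition letter (V : graded) := {i : int & V i}.
HB.instance Definition _ V := Choice.on (letter V).
Definition ltr (V : graded) i (x : V i) : letter V := Tagged (fun j => V j) x.
(* The degree j part of a homogeneous element: 0 unless its degree is j. It is
   used to compare elements of modules whose indices are equal but not
   convertible. *)
Definition component (V : graded) (j : int) (a : letter V) : V j :=
  @untag _ (fun i => V i) (V j) 0 j id a.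
Definition word (V : graded) := seq (letter V).
HB.instance Definition _ V := Choice.on (word V).
Definition wdeg (V : graded) (w : word V) : int := \sum_(a <- w) tag a.
(* Multilinear functions of words are the linear maps defined on the direct sum
   over n and over all degrees of the tensor powers of V. *)
Definition multilinear (V : graded) (L : lmodType k) (phi : word V -> L) :=
  forall u t i, linear (fun x : V i => phi (u ++ ltr x :: t)).
(* The underlying module of T^c(V), including the tensor power of exponent 0. *)
Definition cotensor (V : graded) : lmodType k := presented (@multilinear V).
Definition bar (V : graded) (w : word V) : cotensor V := pgen (@multilinear V) w.
End Tensor.

Section Linear.
Variables (k : comPzRingType) (L L' : lmodType k) (f : L -> L').
Hypothesis h : linear f.
Lemma linfun0 : f 0 = 0.
Proof. by have := h (-1) 0 0; rewrite scaler0 addr0 scaleN1r addNr. Qed.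
Lemma linfunD : {morph f : x y / x + y}.
Proof. by move=> x y; have := h 1 x y; rewrite !scale1r. Qed.
Lemma linfunZ a x : f (a *: x) = a *: f x.
Proof. by have := h a x 0; rewrite linfun0 !addr0. Qed.
Lemma linfunN x : f (- x) = - f x.
Proof. by rewrite -scaleN1r linfunZ scaleN1r. Qed.
Lemma linfun_sum (I : Type) (r : seq I) (P : pred I) (F : I -> L) :
  f (\sum_(i <- r | P i) F i) = \sum_(i <- r | P i) f (F i).
Proof.
elim: r => [|i r IH]; first by rewrite !big_nil linfun0.
by rewrite !big_cons; case: (P i); rewrite ?linfunD // IH.
Qed.
End Linear.

Section Infinity.
Variable k : comPzRingType.
Implicit Types (V : graded k) (L : lmodType k).

(* (-1)^d for an integer d; k is not assumed to be a unit ring, hence the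
   absolute value. *)
Definition koszul (d : int) : k := (-1) ^+ `|d|%N.

Lemma koszulD d e : koszul (d + e) = koszul d * koszul e.
Proof.
rewrite /koszul -exprD -signr_odd -[RHS]signr_odd; congr (_ ^+ _); congr nat_of_bool.
by rewrite oddD; lia.
Qed.

Lemma component_ltr V i (x : V i) : component i (ltr x) = x.
Proof. by rewrite /component untagE. Qed.
Lemma ltr_component V (a : letter V) : ltr (component (tag a) a) = a.
Proof. by case: a => i x /=; rewrite -/(ltr x) component_ltr. Qed.
Lemma component_neq V i (a : letter V) : tag a != i -> component i a = 0.
Proof. by move=> h; rewrite /component untag_dflt. Qed.
Lemma component_linear V i j : linear (fun x : V i => component j (ltr x)).
Proof.
move=> a x y; case: (eqVneq i j) => [<-|h]; first by rewrite !component_ltr.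
by rewrite !component_neq // scaler0 addr0.
Qed.

Lemma wdeg_cons V a (v : word V) : wdeg (a :: v) = tag a + wdeg v.
Proof. by rewrite /wdeg big_cons. Qed.
Lemma wdeg_nil V : wdeg ([::] : word V) = 0.
Proof. by rewrite /wdeg big_nil. Qed.

Lemma pgen_ext (Om : choiceType) (C : forall L : lmodType k, (Om -> L) -> Prop) L
  (F G : presented C -> L) : linear F -> linear G ->
  (forall w, F (pgen C w) = G (pgen C w)) -> F =1 G.
Proof.
move=> hF hG h x; have [s ->] := presented_span x.
rewrite !linfun_sum //; apply: eq_bigr => p _.
by rewrite !linfunZ // h.
Qed.

Lemma bar_multilinear V : multilinear (@bar k V).
Proof.
move=> u t i a x y; apply: presented_ext => L phi h.
have hl := lift_linear h.
by rewrite hl !lift_gen // h.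
Qed.

Lemma tmul_bilinear (M N : lmodType k) : bilinear2 (fun p : M * N => tmul p.1 p.2).
Proof.
split=> [y a x x'|x a y y']; apply: presented_ext => L phi h;
have hl := lift_linear h; rewrite hl !lift_gen //=; by case: h => h1 h2; rewrite ?h1 ?h2.
Qed.

Lemma bar_lin V (u t : word V) i a (x y : V i) :
  bar (u ++ ltr (a *: x + y) :: t) = a *: bar (u ++ ltr x :: t) + bar (u ++ ltr y :: t).
Proof. exact: bar_multilinear. Qed.
Lemma tmul_linl (M N : lmodType k) a (x x' : M) (y : N) :
  tmul (a *: x + x') y = a *: tmul x y + tmul x' y.
Proof. exact: (tmul_bilinear M N).1. Qed.
Lemma tmul_linr (M N : lmodType k) a (x : M) (y y' : N) :
  tmul x (a *: y + y') = a *: tmul x y + tmul x y'.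
Proof. exact: (tmul_bilinear M N).2. Qed.

Definition homog V (d : int) (x : cotensor V) :=
  exists s : seq (k * word V),
    all (fun p => wdeg p.2 == d) s /\ x = \sum_(p <- s) p.1 *: bar p.2.

Definition deconcatenation V (w : word V) : tensor (cotensor V) (cotensor V) :=
  \sum_(i < (size w).+1) tmul (bar (take i w)) (bar (drop i w)).
Definition coproduct V : cotensor V -> tensor (cotensor V) (cotensor V) :=
  lift (@deconcatenation V).

Definition counit V : cotensor V -> k := lift (fun w : word V => (nilp w)%:R : k^o).

Definition proj_word V j (w : word V) : V j :=
  if w is [:: a] then component j a else 0.
Definition proj V j : cotensor V -> V j := lift (@proj_word V j).

Lemma counit_multilinear V : multilinear (fun w : word V => (nilp w)%:R : k^o).
Proof. by move=> [|b u] t i a x y; rewrite /nilp /= scaler0 addr0. Qed.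

Lemma proj_multilinear V j : multilinear (@proj_word V j).
Proof.
move=> u t i a x y; case: u => [|b [|c u]]; case: t => [|c' t]; rewrite /= ?scaler0 ?addr0 //.
exact: component_linear.
Qed.

Lemma deconcatenation_multilinear V : multilinear (@deconcatenation V).
Proof.
move=> u t i a x y.
rewrite /deconcatenation !size_cat /= scaler_sumr -big_split /=.
apply: eq_bigr => -[n /= _] _.
rewrite !take_cat !drop_cat; case: ifP => hn.
  rewrite -/(_ < _)%N in hn.
  by rewrite bar_lin tmul_linr.
case: (n - size u)%N => [|m] /=.
  by rewrite cats0 -[ltr _ :: t]cat0s bar_lin tmul_linr.
by rewrite bar_lin tmul_linl.
Qed.

Definition shift V : graded k := fun i => V (i + 1).

(* A dg-bialgebra structure on (T^c(V), deconcatenation, counit, bar [::]).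
   Elementary tensors span T^c(V), so the identities saying that xmul is a
   coalgebra map and that xdiff is a coderivation are written on words, where
   the Koszul signs can be made explicit:
     (id (x) tau (x) id) contributes (-1)^(|u''||v'|), and
     (id (x) Q)(u' (x) u'') = (-1)^|u'| u' (x) Q u''. *)
Record XiBinf V := {
  xmul : cotensor V -> cotensor V -> cotensor V;
  xdiff : cotensor V -> cotensor V;
  xmul_linearl : forall y, linear (fun x => xmul x y);
  xmul_linearr : forall x, linear (xmul x);
  xmul_deg : forall d e x y, homog d x -> homog e y -> homog (d + e) (xmul x y);
  xmulA : associative xmul;
  xmul1x : left_id (bar [::]) xmul;
  xmulx1 : right_id (bar [::]) xmul;
  xmul_coproduct : forall u v : word V,
    coproduct (xmul (bar u) (bar v)) =
    \sum_(i < (size u).+1) \sum_(j < (size v).+1)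
      koszul (wdeg (drop i u) * wdeg (take j v)) *:
      tmul (xmul (bar (take i u)) (bar (take j v)))
           (xmul (bar (drop i u)) (bar (drop j v)));
  xmul_counit : forall x y, counit (xmul x y) = counit x * counit y;
  xdiff_linear : linear xdiff;
  xdiff_deg : forall d x, homog d x -> homog (d + 1) (xdiff x);
  xdiff_derivation : forall d x y, homog d x ->
    xdiff (xmul x y) = xmul (xdiff x) y + koszul d *: xmul x (xdiff y);
  xdiff_coderivation : forall w : word V,
    coproduct (xdiff (bar w)) =
    \sum_(i < (size w).+1)
      (tmul (xdiff (bar (take i w))) (bar (drop i w)) +
       koszul (wdeg (take i w)) *: tmul (bar (take i w)) (xdiff (bar (drop i w))));
  xdiff_sq : forall x, xdiff (xdiff x) = 0
}.

(* The letter f(w), for f of degree d. *)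
Definition value V V' (d : int) (f : word V -> forall j, V' j) (w : word V) : letter V' :=
  ltr (f w (wdeg w + d)).

(* A family, indexed by n >= 1, of degree d maps from the n-th tensor power of V
   to V', as one function of words: f w j is the component of degree j of the
   value on w. There is no map on the 0-th tensor power, hence the value 0 on
   the empty word. *)
Definition multimap V V' (d : int) (f : word V -> forall j, V' j) :=
  [/\ forall j, multilinear (f ^~ j),
      forall w j, j != wdeg w + d -> f w j = 0
    & forall j, f [::] j = 0].

(* (id^a (x) b_c (x) id^..) applied to w, up to the Koszul sign. *)
Definition insertion V (b : word V -> forall j, V j) (a c : nat) (w : word V) : word V :=
  take a w ++ value 1 b (take c (drop a w)) :: drop (a + c) w.

(* The sum of f_(a+1+b') o (id^a (x) b_c (x) id^b') over a + c + b' = size w, c >= 1. *)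
Definition ainf_sum V V' (f : word V -> forall j, V' j) (b : word V -> forall j, V j)
    (w : word V) (j : int) : V' j :=
  \sum_(a < size w) \sum_(1 <= c < (size w - a).+1)
    koszul (wdeg (take a w)) *: f (insertion b a c w) j.

Record ainf_algebra := {
  ainf_mod :> graded k;
  ainf_b : word (shift ainf_mod) -> forall j, shift ainf_mod j;
  ainf_b_map : multimap 1 ainf_b;
  ainf_b_rel : forall w j, ainf_sum ainf_b ainf_b w j = 0
}.

(* The sizes u_1, .., u_r >= 1 of the blocks of w sum up to its length; moving the
   f_(u_i), of degree 0, past tensor factors produces no sign. *)
Record ainf_morphism (W W' : ainf_algebra) := {
  ainf_f :> word (shift W) -> forall j, shift W' j;
  ainf_f_map : multimap 0 ainf_f;
  ainf_f_rel : forall w j,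
    \sum_(r < (size w).+1)
      \sum_(u : r.-tuple 'I_(size w).+1 | all (fun i : 'I__ => 0 < i)%N u
                                         && (\sum_(i <- u) i == size w)%N)
        ainf_b [seq value 0 ainf_f v | v <- reshape [seq val i | i <- u] w] j
    = ainf_sum ainf_f (@ainf_b W) w j
}.

(* H^i(f_1) is injective and surjective for every i. *)
Definition ainf_qiso (W W' : ainf_algebra) (f : ainf_morphism W W') :=
  forall i : int,
  (forall x : shift W i, ainf_b [:: ltr x] (i + 1) = 0 ->
     (exists z : shift W' (i - 1), f [:: ltr x] i = ainf_b [:: ltr z] i) ->
     exists z : shift W (i - 1), x = ainf_b [:: ltr z] i) /\
  (forall y : shift W' i, ainf_b [:: ltr y] (i + 1) = 0 ->
     exists x : shift W i, ainf_b [:: ltr x] (i + 1) = 0 /\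
     exists z : shift W' (i - 1), y = f [:: ltr x] i + ainf_b [:: ltr z] i).

Record binf_algebra := {
  binf_mod :> graded k;
  binf_str : XiBinf (shift binf_mod) }.

Section Binf.
Variables (V : graded k) (B : XiBinf V).
Let T := cotensor V.
(* Q^r, as a function of words of length r *)
Definition binf_b (w : word V) (j : int) : V j := proj j (xdiff B (bar w)).

Lemma proj_linear j : linear (@proj V j).
Proof. exact: lift_linear (@proj_multilinear V j). Qed.
Lemma coproduct_linear : linear (@coproduct V).
Proof. exact: lift_linear (@deconcatenation_multilinear V). Qed.
Lemma coproduct_bar w : coproduct (bar w) = deconcatenation (w : word V).
Proof. exact: lift_gen (@deconcatenation_multilinear V). Qed.
Lemma proj_bar j w : proj j (bar w) = proj_word j (w : word V).
Proof. exact: lift_gen (@proj_multilinear V j). Qed.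

Lemma cons_multilinear a : multilinear (fun w : word V => bar (a :: w)).
Proof. by move=> u t i c x y; exact: (bar_lin (a :: u)). Qed.

Definition headcat (y : T) (w : word V) : T :=
  if w is [:: a] then lift (fun w' => bar (a :: w')) y else 0.

Lemma headcat_linear w : linear (headcat ^~ w).
Proof.
case: w => [|a [|b w]] c x y /=; rewrite ?scaler0 ?addr0 //.
exact: lift_linear (cons_multilinear a) _ _ _.
Qed.
Lemma headcat_multilinear y : multilinear (headcat y).
Proof.
move=> u t i a x x'; case: u => [|b [|c u]]; case: t => [|c' t]; rewrite /= ?scaler0 ?addr0 //.
have H z := lift_linear (cons_multilinear (ltr (z : V i))).
pose F (y : T) := lift (fun w' => bar (ltr (a *: x + x') :: w')) y.
pose G (y : T) := a *: lift (fun w' => bar (ltr x :: w')) y + lift (fun w' => bar (ltr x' :: w')) y.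
suff: F =1 G by apply.
apply: pgen_ext => [||w].
- exact: H.
- move=> c z z'; rewrite /G !H !scalerDr !scalerA (mulrC a c) !addrA; congr (_ + _).
  by rewrite -!addrA; congr (_ + _); rewrite addrC.
- rewrite /F /G !lift_gen; first exact: (bar_lin [::]).
  all: exact: cons_multilinear.
Qed.

Definition headmul (p : T * T) : T := lift (headcat p.2) p.1.
Lemma headmul_bilinear : bilinear2 headmul.
Proof.
split=> [y|x].
  exact: lift_linear (headcat_multilinear y).
move=> c y y'; rewrite /headmul /=.
pose F (x : T) := lift (headcat (c *: y + y')) x.
pose G (x : T) := c *: lift (headcat y) x + lift (headcat y') x.
suff: F =1 G by apply.
apply: pgen_ext => [||w].
- exact: lift_linear (headcat_multilinear _).
- move=> d z z'; rewrite /G !(lift_linear (headcat_multilinear _)) !scalerDr !scalerA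
    (mulrC c d) !addrA; congr (_ + _).
  by rewrite -!addrA; congr (_ + _); rewrite addrC.
- rewrite /F /G !lift_gen; try exact: headcat_multilinear.
  exact: headcat_linear.
Qed.

Lemma counit_linear : linear (@counit V : T -> k^o).
Proof. exact: lift_linear (@counit_multilinear V). Qed.
Lemma counit_bar w : counit (bar w) = (nilp (w : word V))%:R.
Proof. exact: lift_gen (@counit_multilinear V). Qed.
Lemma counit_bilinear : bilinear2 (fun p : T * T => counit p.1 * counit p.2 : k^o).
Proof.
split=> [y|x] a u v; rewrite /= counit_linear.
  by rewrite -[LHS]/((a * counit u + counit v) * counit y) mulrDl -mulrA.
by rewrite -[LHS]/(counit x * (a * counit u + counit v)) mulrDr mulrCA.
Qed.

Lemma headmul_tmul x y : lift headmul (tmul x y) = lift (headcat y) x.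
Proof. by rewrite lift_gen //; exact: headmul_bilinear. Qed.
Lemma headmul_tmul_bar u y : lift headmul (tmul (bar u) y) = headcat y u.
Proof. by rewrite headmul_tmul lift_gen //; exact: headcat_multilinear. Qed.

Lemma headmul_coproduct (x : T) : x = counit x *: bar [::] + lift headmul (coproduct x).
Proof.
pose G (x : T) := counit x *: bar [::] + lift headmul (coproduct x).
suff: @id T =1 G by apply.
apply: pgen_ext.
- by move=> a y z.
- move=> a y z; rewrite /G coproduct_linear (lift_linear headmul_bilinear).
  rewrite [counit _](counit_linear a y z) -[_ *: (counit y : k^o)]/(a * _).
  rewrite scalerDr scalerDl scalerA !addrA; congr (_ + _).
  by rewrite -!addrA; congr (_ + _); rewrite addrC.
move=> w; rewrite /G -/(bar w) counit_bar coproduct_bar (linfun_sum (lift_linear headmul_bilinear)).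
under eq_bigr => i _ do rewrite headmul_tmul_bar.
case: w => [|a w].
  by rewrite big_ord1 scale1r addr0.
rewrite scale0r add0r big_ord_recl /= add0r big_ord_recl /= take0 drop0.
rewrite lift_gen; last exact: cons_multilinear.
rewrite big1 ?addr0 // => i _.
by case: w i => [|b w] [].
Qed.

Definition counit2 (p : T * T) : k^o := counit p.1 * counit p.2.
Lemma counit2_tmul x y : lift counit2 (tmul x y) = counit x * counit y.
Proof. by rewrite lift_gen //; exact: counit_bilinear. Qed.
Lemma counit_coproduct (x : T) : counit x = lift counit2 (coproduct x).
Proof.
pose G (x : T) : k^o := lift counit2 (coproduct x).
suff: (@counit V : T -> k^o) =1 G by apply.
have hl := lift_linear counit_bilinear.
apply: pgen_ext.
- exact: counit_linear.
- by move=> a y z; rewrite /G coproduct_linear hl.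
move=> w; rewrite /G -/(bar w) [LHS]counit_bar coproduct_bar (linfun_sum hl).
under eq_bigr => i _ do rewrite counit2_tmul !counit_bar.
case: w => [|a w]; first by rewrite big_ord1 mulr1.
rewrite big1 // => -[[|i] hi] _; rewrite ?drop0 /= ?mulr0 ?mul0r //.
Qed.

Lemma koszul0 : koszul 0 = 1. Proof. by []. Qed.

Lemma counit_xdiff (x : T) : counit (xdiff B x) = 0.
Proof.
pose F (x : T) : k^o := counit (xdiff B x).
suff: F =1 (fun _ => 0) by apply.
have hl := lift_linear counit_bilinear.
apply: pgen_ext.
- by move=> a y z; rewrite /F xdiff_linear; exact: counit_linear.
- by move=> a y z; rewrite scaler0 addr0.
move=> w; rewrite /F -/(bar w).
have E : counit (xdiff B (bar w)) = counit (xdiff B (bar w)) + counit (xdiff B (bar w)).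
  rewrite {1}counit_coproduct xdiff_coderivation (linfun_sum hl).
  under eq_bigr => i _ do rewrite (linfunD hl) (linfunZ hl) !counit2_tmul !counit_bar.
  rewrite big_split /=; congr (_ + _).
    rewrite big_ord_recr /= take_size drop_size mulr1 big1 ?add0r // => i _.
    by rewrite /nilp size_drop subn_eq0 leqNgt ltn_ord mulr0.
  rewrite big_ord_recl /= take0 drop0 wdeg_nil koszul0 mul1r scale1r big1 ?addr0 // => i _.
  by case: (w) i => [|a t] [] //= m hm; rewrite mul0r scaler0.
by move/eqP: E; rewrite -subr_eq0 opprD addNKr oppr_eq0 => /eqP.
Qed.

Lemma headcat_homog e (x : T) (t : word V) : homog e x ->
  lift (headcat (bar t)) x = bar (ltr (proj e x) :: t).
Proof.
case=> s [hs ->]; have hl := lift_linear (headcat_multilinear (bar t)).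
have h2 : linear (fun y : V e => bar (ltr y :: t))
    by move=> a y z; exact: (bar_lin [::]).
rewrite (linfun_sum hl) (linfun_sum (proj_linear e)) (linfun_sum h2).
rewrite big_seq [RHS]big_seq.
apply: eq_bigr => -[c w] hp; rewrite (linfunZ hl) (linfunZ (proj_linear e)) (linfunZ h2) /=.
congr (_ *: _); rewrite lift_gen; last exact: headcat_multilinear.
rewrite proj_bar; have /eqP /= E := allP hs _ hp.
case: w E {hp} => [|a [|b w]] E /=; rewrite ?(linfun0 h2) //.
rewrite -E /wdeg big_seq1 ltr_component lift_gen //; exact: cons_multilinear.
Qed.

Lemma homog_bar (w : word V) : homog (wdeg w) (bar w).
Proof. by exists [:: (1, w)]; rewrite /= eqxx big_seq1 scale1r. Qed.

Lemma xdiff_bar (w : word V) : xdiff B (bar w) =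
  \sum_(a < size w) \sum_(1 <= c < (size w - a).+1)
    koszul (wdeg (take a w)) *: bar (insertion binf_b a c w).
Proof.
have hl := lift_linear headmul_bilinear.
have step u : xdiff B (bar u) = \sum_(i < (size u).+1)
   (bar (value 1 binf_b (take i u) :: drop i u) +
       koszul (wdeg (take i u)) *: headcat (xdiff B (bar (drop i u))) (take i u)).
  rewrite [LHS]headmul_coproduct counit_xdiff scale0r add0r xdiff_coderivation (linfun_sum hl).
  apply: eq_bigr => i _; rewrite (linfunD hl) (linfunZ hl) headmul_tmul_bar headmul_tmul.
  congr (_ + _); rewrite (@headcat_homog (wdeg (take i u) + 1)) //.
  exact/xdiff_deg/homog_bar.
have b0 j : binf_b [::] j = 0.
  rewrite /binf_b.
  have -> : xdiff B (bar [::]) = 0; last exact: (linfun0 (proj_linear j)).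
  have := @xdiff_derivation _ B 0 (bar [::]) (bar [::]).
  rewrite xmul1x koszul0 scale1r => /(_ _)/eqP.
  rewrite xmul1x xmulx1 -subr_eq0 opprD addNKr oppr_eq0 => h; apply/eqP/h.
  by have := homog_bar [::]; rewrite wdeg_nil.
have hb (u t : word V) : u = [::] -> bar (value 1 binf_b u :: t) = 0.
  move=> ->; rewrite /value b0.
  have h2 : linear (fun y : V (wdeg ([::] : word V) + 1) => bar (ltr y :: t))
    by move=> a y z; exact: (bar_lin [::]).
  exact: (linfun0 h2).
elim: w => [|x w IH].
  by rewrite step big_ord1 big_ord0 /= scaler0 addr0 hb.
rewrite step big_split /=; rewrite [RHS]big_ord_recl; congr (_ + _).
  rewrite big_ord_recl hb // add0r /= subn0 big_add1 big_mkord /=.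
  apply: eq_bigr => i _.
  by rewrite wdeg_nil koszul0 scale1r /insertion /= add0n.
rewrite big_ord_recl /= scaler0 add0r big_ord_recl /= take0 drop0
  [X in _ + X]big1 ?addr0; last first.
  by case: (w) => [|b t] [m hm] _ //=; rewrite scaler0.
rewrite IH /wdeg big_seq1 (linfun_sum (lift_linear (cons_multilinear x))) scaler_sumr.
apply: eq_bigr => a _; rewrite (linfun_sum (lift_linear (cons_multilinear x))) scaler_sumr.
rewrite /= subSS; apply: eq_bigr => c _.
rewrite (linfunZ (lift_linear (cons_multilinear x))) lift_gen; last exact: cons_multilinear.
by rewrite big_cons scalerA -koszulD.
Qed.

Lemma binf_b_map : multimap 1 binf_b.
Proof.
split.
- move=> j u t i a x y.
  by rewrite /binf_b bar_lin (xdiff_linear B) (proj_linear j).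
- move=> w j hj; rewrite /binf_b.
  have [s [hs ->]] := xdiff_deg B (homog_bar w).
  rewrite (linfun_sum (proj_linear j)) big_seq big1 // => -[c u] hu.
  rewrite (linfunZ (proj_linear j)) proj_bar /=.
  have /eqP /= := allP hs _ hu.
  case: u {hu} => [|a [|b u]] /=; rewrite ?scaler0 // /wdeg big_seq1 => E.
  by rewrite component_neq ?scaler0 // E eq_sym.
- move=> j; rewrite /binf_b xdiff_bar big_ord0; exact: (linfun0 (proj_linear j)).
Qed.

Lemma binf_b_rel w j : ainf_sum binf_b binf_b w j = 0.
Proof.
have hp := proj_linear j.
have hQ := xdiff_linear B.
have := congr1 (proj j) (xdiff_sq B (bar w)).
rewrite (linfun0 hp) => <-; rewrite {1}xdiff_bar (linfun_sum hQ) (linfun_sum hp).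
apply: eq_bigr => a _; rewrite (linfun_sum hQ) (linfun_sum hp).
by apply: eq_bigr => c _; rewrite (linfunZ hQ) (linfunZ hp).
Qed.
End Binf.

Definition ainf_of_binf (B : binf_algebra) : ainf_algebra :=
  {| ainf_mod := B; ainf_b := binf_b (binf_str B);
     ainf_b_map := binf_b_map (binf_str B);
     ainf_b_rel := binf_b_rel (binf_str B) |}.

End Infinity.

Section DgAlgebra.
Variable k : comPzRingType.

Record dg_algebra := {
  dga_mod :> graded k;
  dga_d : forall i, dga_mod i -> dga_mod (i + 1);
  dga_mul : forall i j, dga_mod i -> dga_mod j -> dga_mod (i + j);
  dga_one : dga_mod 0;
  dga_d_linear : forall i, linear (@dga_d i);
  dga_mul_linearl : forall i j y, linear (fun x => @dga_mul i j x y);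
  dga_mul_linearr : forall i j x, linear (@dga_mul i j x);
  dga_dd : forall i (x : dga_mod i), dga_d (dga_d x) = 0;
  dga_mulA : forall i j l (x : dga_mod i) (y : dga_mod j) (z : dga_mod l),
    ltr (dga_mul x (dga_mul y z)) = ltr (dga_mul (dga_mul x y) z);
  dga_mul1x : forall i (x : dga_mod i), ltr (dga_mul dga_one x) = ltr x;
  dga_mulx1 : forall i (x : dga_mod i), ltr (dga_mul x dga_one) = ltr x;
  dga_leibniz : forall i j (x : dga_mod i) (y : dga_mod j),
    dga_d (dga_mul x y) =
      component (i + j + 1) (ltr (dga_mul (dga_d x) y)) +
      koszul k i *: component (i + j + 1) (ltr (dga_mul x (dga_d y)))
}.

Variable A : dg_algebra.

(* b_1(sx) = - s(dx), the differential of the suspension, and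
   b_2(sx, sy) = - s m(eta^-1 (x) eta^-1)(sx (x) sy) = - (-1)^|sx| s(xy),
   since eta^-1 has degree 1; the tags of letters are the degrees |sx|. *)
Definition dga_b (w : word (shift A)) (j : int) : shift A j :=
  match w with
  | [:: a] => - component (j + 1) (ltr (dga_d (tagged a : dga_mod A (tag a + 1))))
  | [:: a1; a2] =>
      - (koszul k (tag a1) *: component (j + 1)
          (ltr (dga_mul (tagged a1 : dga_mod A (tag a1 + 1)) (tagged a2 : dga_mod A (tag a2 + 1)))))
  | _ => 0
  end.

Lemma dga_b_map : multimap 1 dga_b.
Proof.
split => [j u t i c x y|w j|//].
- case: u => [|a [|a' u]]; case: t => [|b [|b' t]]; rewrite /= ?scaler0 ?addr0 //.
  + by rewrite dga_d_linear component_linear opprD scalerN.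
  + by rewrite dga_mul_linearl component_linear scalerDr opprD scalerN !scalerA mulrC.
  + by rewrite dga_mul_linearr component_linear scalerDr opprD scalerN !scalerA mulrC.
  1-3: by case: u => [|? ?]; rewrite /= ?scaler0 ?addr0.
- case: w => [|a [|b [|? ?]]] //; rewrite /wdeg ?big_cons ?big_nil ?addr0 => h.
    rewrite /= component_neq ?oppr0 //=; apply: contra h => /eqP; lia.
  by rewrite /= component_neq ?scaler0 ?oppr0 //=; apply: contra h => /eqP; lia.
Qed.

Lemma component_d l i (x : dga_mod A i) m : i = m ->
  component l (ltr (dga_d (component m (ltr x)))) = component l (ltr (dga_d x)).
Proof. by move=> <-; rewrite [component i _]component_ltr. Qed.
Lemma component_mull l i j (x : dga_mod A i) (y : dga_mod A j) m : i = m ->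
  component l (ltr (dga_mul (component m (ltr x)) y)) = component l (ltr (dga_mul x y)).
Proof. by move=> <-; rewrite [component i _]component_ltr. Qed.
Lemma component_mulr l i j (x : dga_mod A i) (y : dga_mod A j) m : j = m ->
  component l (ltr (dga_mul x (component m (ltr y)))) = component l (ltr (dga_mul x y)).
Proof. by move=> <-; rewrite [component j _]component_ltr. Qed.

Lemma value_eq (V V' : graded k) d (f : word V -> forall j, V' j) w e :
  wdeg w = e -> value d f w = ltr (f w (e + d)).
Proof. by move=> <-. Qed.

Let V := shift A.
Let lV i (x : dga_mod A (i + 1)) : letter V := @ltr k V i x.

Lemma dga_b1 i (x : dga_mod A (i + 1)) j :
  dga_b [:: lV x] j = - component (j + 1) (ltr (dga_d x)).
Proof. by []. Qed.
Lemma dga_b2 i1 i2 (x : dga_mod A (i1 + 1)) (y : dga_mod A (i2 + 1)) j :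
  dga_b [:: lV x; lV y] j =
    - (koszul k i1 *: component (j + 1) (ltr (dga_mul x y))).
Proof. by []. Qed.
Lemma wdeg1 i (x : dga_mod A (i + 1)) : wdeg [:: lV x] = i.
Proof. by rewrite /wdeg big_seq1. Qed.
Lemma wdeg2 i1 i2 (x : dga_mod A (i1 + 1)) (y : dga_mod A (i2 + 1)) :
  wdeg [:: lV x; lV y] = i1 + i2.
Proof. by rewrite /wdeg big_cons big_seq1. Qed.

Lemma value1 i (x : dga_mod A (i + 1)) :
  value 1 dga_b [:: lV x] = @lV (i + 1) (- dga_d x).
Proof. by rewrite (value_eq _ _ (wdeg1 x)) dga_b1 component_ltr. Qed.
Lemma value2 i j (x : dga_mod A (i + 1)) (y : dga_mod A (j + 1)) :
  value 1 dga_b [:: lV x; lV y] = @lV (i + j + 1)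
    (- (koszul k i *: component (i + j + 1 + 1) (ltr (dga_mul x y)))).
Proof. by rewrite (value_eq _ _ (wdeg2 x y)). Qed.

Lemma sum2 (M : zmodType) (F : nat -> nat -> M) :
  \sum_(a < 2) \sum_(1 <= c < (2 - a).+1) F a c = (F 0%N 1%N + F 0%N 2%N + F 1%N 1%N).
Proof. by rewrite big_ord_recl big_ord1 /= big_nat1 big_ltn // big_nat1. Qed.
Lemma sum3 (M : zmodType) (F : nat -> nat -> M) :
  \sum_(a < 3) \sum_(1 <= c < (3 - a).+1) F a c =
  F 0%N 1%N + F 0%N 2%N + F 0%N 3%N + (F 1%N 1%N + F 1%N 2%N) + F 2%N 1%N.
Proof.
rewrite !big_ord_recl big_ord0 /= addr0 /bump /= !addrA.
by rewrite big_ltn // big_ltn // big_nat1 big_ltn // !big_nat1 !addrA.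
Qed.

Lemma dga_b_long (w : word V) j : (2 < size w)%N -> dga_b w j = 0.
Proof. by case: w => [|? [|? [|]]]. Qed.
Lemma component2 l i (x : dga_mod A i) m : i = m ->
  component l (ltr (component m (ltr x))) = component l (ltr x).
Proof. by move=> <-; rewrite [component i _]component_ltr. Qed.
Lemma koszulS i : koszul k (i + 1) = - koszul k i.
Proof. by rewrite koszulD [koszul k 1]expr1 mulrN1. Qed.

Lemma dga_b_rel1 i (x : dga_mod A (i + 1)) j : ainf_sum dga_b dga_b [:: lV x] j = 0.
Proof.
rewrite /ainf_sum big_ord1 big_nat1 /insertion.
cbn [take drop cat addn]; rewrite wdeg_nil value1 dga_b1.
rewrite (linfunN (@dga_d_linear A _)) dga_dd oppr0.
by rewrite (linfun0 (@component_linear _ _ _ _)) oppr0 scaler0.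
Qed.
Lemma dga_b_rel2 i1 i2 (x : dga_mod A (i1 + 1)) (y : dga_mod A (i2 + 1)) j :
  ainf_sum dga_b dga_b [:: lV x; lV y] j = 0.
Proof.
apply: etrans (sum2 (fun a c => koszul k (wdeg (take a [:: lV x; lV y])) *:
  dga_b (insertion dga_b a c [:: lV x; lV y]) j)) _.
rewrite /insertion; cbn [take drop cat addn].
rewrite !value1 value2 wdeg_nil wdeg1 !dga_b1 !dga_b2 koszulS koszul0 !scale1r.
rewrite (linfunN (@dga_mul_linearl A _ _ y)) (linfunN (@dga_mul_linearr A _ _ x)).
rewrite (linfunN (@dga_d_linear A _)) (linfunZ (@dga_d_linear A _)).
have hc m := @component_linear _ A m (j + 1).
rewrite !(linfunN (hc _)) (linfunZ (hc _)) component_d; last by lia.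
rewrite dga_leibniz (linfunD (hc _)) (linfunZ (hc _)) !component2 /=; try by lia.
rewrite koszulS scalerN scaleNr !opprK scalerDr !scalerN scaleNr scalerN opprK.
by rewrite addKr; exact: addNr.
Qed.
Lemma dga_b_rel3 i1 i2 i3 (x : dga_mod A (i1 + 1)) (y : dga_mod A (i2 + 1))
    (z : dga_mod A (i3 + 1)) j :
  ainf_sum dga_b dga_b [:: lV x; lV y; lV z] j = 0.
Proof.
apply: etrans (sum3 (fun a c => koszul k (wdeg (take a [:: lV x; lV y; lV z])) *:
  dga_b (insertion dga_b a c [:: lV x; lV y; lV z]) j)) _.
rewrite /insertion; cbn [take drop cat addn].
rewrite !value1 !value2 wdeg_nil wdeg1 !dga_b2 koszulS koszul0 !scale1r.
have -> : dga_b (value 1 dga_b [:: lV x; lV y; lV z] :: drop (0 + 3)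
    [:: lV x; lV y; lV z]) j = 0.
  by case: dga_b_map => h _ _; exact: (linfun0 (h j [::] [::] _)).
cbn [dga_b]; rewrite !scaler0 !add0r !addr0.
have hc m := @component_linear _ A m (j + 1).
rewrite (linfunN (@dga_mul_linearl A _ _ z)) (linfunZ (@dga_mul_linearl A _ _ z)).
rewrite (linfunN (@dga_mul_linearr A _ _ x)) (linfunZ (@dga_mul_linearr A _ _ x)).
rewrite !(linfunN (hc _)) !(linfunZ (hc _)) component_mull; last by lia.
rewrite component_mulr; last by lia.
rewrite dga_mulA koszulD !scaleNr !scalerN !opprK !scalerA.
by rewrite mulrAC mulrA; exact: addNr.
Qed.

Lemma dga_b_rel (w : word V) j : ainf_sum dga_b dga_b w j = 0.
Proof.
case: w => [|[i1 x1] [|[i2 x2] [|[i3 x3] [|a4 w]]]].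
- by rewrite /ainf_sum big_ord0.
- exact: dga_b_rel1.
- exact: dga_b_rel2.
- exact: dga_b_rel3.
set w' := _ :: _.
rewrite /ainf_sum big1 // => -[a ha] _; rewrite big_nat big1 // => c /andP[h1 /= h2].
suff -> : dga_b (insertion dga_b a c w') j = 0 by rewrite scaler0.
have {}h2 : (c <= size w' - a)%N by [].
have hs : (3 < size w')%N by [].
case: (ltnP 2 c) => hc; last first.
  apply: dga_b_long; rewrite /insertion size_cat /= size_drop size_takel; last exact: ltnW.
  by move: ha hs h2 hc; clearbody w'; move: (size w') => n; lia.
rewrite /insertion /value [dga_b (take c _) _]dga_b_long; last first.
  by rewrite size_takel // size_drop.
case: dga_b_map => h _ _; exact: (linfun0 (h j (take a w') (drop (a + c) w') _)).
Qed.

Definition ainf_of_dga : ainf_algebra k :=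
  {| ainf_mod := A; ainf_b := dga_b; ainf_b_map := dga_b_map; ainf_b_rel := dga_b_rel |}.
End DgAlgebra.

Section Family.
Variables (k : comPzRingType) (I : Type) (M : I -> lmodType k).
Definition family_module := forall i, M i.
HB.instance Definition _ := Choice.on family_module.
Implicit Types x y : family_module.
Let fadd x y : family_module := fun i => x i + y i.
Let fopp x : family_module := fun i => - x i.
Let fzero : family_module := fun i => 0.
Let fscale (a : k) x : family_module := fun i => a *: x i.
Fact faddA : associative fadd.
Proof. by move=> x y z; apply: functional_extensionality_dep => i; rewrite /fadd addrA. Qed.
Fact faddC : commutative fadd.
Proof. by move=> x y; apply: functional_extensionality_dep => i; rewrite /fadd addrC. Qed.
Fact fadd0 : left_id fzero fadd.
Proof. by move=> x; apply: functional_extensionality_dep => i; rewrite /fadd add0r. Qed.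
Fact faddN : left_inverse fzero fopp fadd.
Proof. by move=> x; apply: functional_extensionality_dep => i; rewrite /fadd addNr. Qed.
HB.instance Definition _ := GRing.isZmodule.Build family_module faddA faddC fadd0 faddN.
Fact fscaleA a b x : fscale a (fscale b x) = fscale (a * b) x.
Proof. by apply: functional_extensionality_dep => i; rewrite /fscale scalerA. Qed.
Fact fscale1 : left_id 1 fscale.
Proof. by move=> x; apply: functional_extensionality_dep => i; rewrite /fscale scale1r. Qed.
Fact fscaleDr : right_distributive fscale +%R.
Proof. by move=> a x y; apply: functional_extensionality_dep => i; exact: scalerDr. Qed.
Fact fscaleDl x : {morph fscale^~ x : a b / a + b}.
Proof. by move=> a b; apply: functional_extensionality_dep => i; exact: scalerDl. Qed.
HB.instance Definition _ := GRing.Zmodule_isLmodule.Build k family_module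
  fscaleA fscale1 fscaleDr fscaleDl.
End Family.

Record klinear_category (k : comPzRingType) := {
  obj :> Type;
  mor : obj -> obj -> lmodType k;
  idm : forall X, mor X X;
  ccomp : forall X Y Z, mor Y Z -> mor X Y -> mor X Z;
  compA : forall X Y Z T (h : mor Z T) (g : mor Y Z) (f : mor X Y),
    ccomp h (ccomp g f) = ccomp (ccomp h g) f;
  comp1f : forall X Y (f : mor X Y), ccomp (idm Y) f = f;
  compf1 : forall X Y (f : mor X Y), ccomp f (idm X) = f;
  comp_linearl : forall X Y Z (f : mor X Y), linear (fun g : mor Y Z => ccomp g f);
  comp_linearr : forall X Y Z (g : mor Y Z), linear (fun f : mor X Y => ccomp g f)
}.
Arguments mor {_ _}.
Arguments idm {_ _}.
Arguments ccomp {_ _ _ _ _}.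
Notation "g \c f" := (ccomp g f) (at level 40, left associativity).

Section Category.
Variables (k : comPzRingType) (C : klinear_category k).
Implicit Types X Y Z : C.

Definition is_iso X Y (f : mor X Y) :=
  exists g : mor Y X, g \c f = idm X /\ f \c g = idm Y.
Definition monic X Y (f : mor X Y) :=
  forall Z (g h : mor Z X), f \c g = f \c h -> g = h.
Definition epic X Y (f : mor X Y) :=
  forall Z (g h : mor Y Z), g \c f = h \c f -> g = h.
Definition zero_object Z :=
  (forall X (f : mor X Z), f = 0) /\ (forall X (f : mor Z X), f = 0).
Definition is_biproduct X Y S (i1 : mor X S) (i2 : mor Y S) (p1 : mor S X) (p2 : mor S Y) :=
  [/\ p1 \c i1 = idm X, p2 \c i2 = idm Y, p1 \c i2 = 0, p2 \c i1 = 0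
    & i1 \c p1 + i2 \c p2 = idm S].
Definition is_kernel X Y K (f : mor X Y) (i : mor K X) :=
  f \c i = 0 /\
  forall Z (g : mor Z X), f \c g = 0 -> exists! h : mor Z K, i \c h = g.
Definition is_cokernel X Y Q (f : mor X Y) (q : mor Y Q) :=
  q \c f = 0 /\
  forall Z (g : mor Y Z), g \c f = 0 -> exists! h : mor Q Z, h \c q = g.

Record abelian : Prop := {
  abelian_zero : exists Z, zero_object Z;
  abelian_biproduct : forall X Y, exists S (i1 : mor X S) (i2 : mor Y S)
    (p1 : mor S X) (p2 : mor S Y), is_biproduct i1 i2 p1 p2;
  abelian_kernel : forall X Y (f : mor X Y), exists K (i : mor K X), is_kernel f i;
  abelian_cokernel : forall X Y (f : mor X Y), exists Q (q : mor Y Q), is_cokernel f q;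
  abelian_monic : forall X Y (f : mor X Y), monic f ->
    exists Z (g : mor Y Z), is_kernel g f;
  abelian_epic : forall X Y (f : mor X Y), epic f ->
    exists Z (g : mor Z X), is_cokernel g f
}.

Definition projective (P : C) :=
  forall X Y (e : mor X Y) (f : mor P Y), epic e -> exists g : mor P X, e \c g = f.
Definition enough_projectives :=
  forall X, exists P (e : mor P X), projective P /\ epic e.

Definition exact_at X Y Z (f : mor X Y) (g : mor Y Z) :=
  exists K (i : mor K Y) (p : mor X K), [/\ is_kernel g i, epic p & f = i \c p].
Definition short_exact X Y Z (f : mor X Y) (g : mor Y Z) :=
  is_kernel g f /\ is_cokernel f g.

Record cochain_complex := {
  cpx_obj :> int -> C;
  cpx_d : forall i, mor (cpx_obj i) (cpx_obj (i + 1));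
  cpx_dd : forall i, cpx_d (i + 1) \c cpx_d i = 0
}.

Record projective_resolution (M : C) := {
  res_cpx :> cochain_complex;
  res_aug : mor (res_cpx 0) M;
  res_projective : forall i, projective (res_cpx i);
  res_zero : forall i : int, 0 < i -> zero_object (res_cpx i);
  res_exact : forall i : int, i + 1 < 0 ->
    exact_at (cpx_d res_cpx i) (cpx_d res_cpx (i + 1));
  res_exact0 : exact_at (cpx_d res_cpx (-1)) res_aug;
  res_epic : epic res_aug
}.

Variable P : cochain_complex.

(* The endomorphism dg-algebra: degree n part prod_i Hom(P^i, P^(i+n)),
   d f = d_P f - (-1)^n f d_P, and product the composition. *)

Definition end_mod (n : int) : lmodType k :=
  family_module (fun i : int => mor (P i) (P (i + n))).

Definition mor_cast X (a b : int) (e : a = b) (f : mor X (P a)) : mor X (P b) :=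
  ecast c (mor X (P c)) e f.

Fact end_index (i n m : int) : i + n + m = i + (m + n). Proof. by rewrite -addrA (addrC n). Qed.

Definition end_d (n : int) (f : end_mod n) : end_mod (n + 1) := fun i =>
  mor_cast (esym (addrA i n 1)) (cpx_d P (i + n) \c f i) -
  koszul k n *: mor_cast (end_index i 1 n) (f (i + 1) \c cpx_d P i).
Definition end_mul m n (g : end_mod m) (f : end_mod n) : end_mod (m + n) := fun i =>
  mor_cast (end_index i n m) (g (i + n) \c f i).
Definition end_one : end_mod 0 := fun i => mor_cast (esym (addr0 i)) (idm (P i)).

Let row_mors i : graded k := fun j => mor (P i) (P j).
Definition entry n (f : end_mod n) (i j : int) : mor (P i) (P j) :=
  component j (@ltr k (row_mors i) (i + n) (f i)).
Let D i j : mor (P i) (P j) := component j (@ltr k (row_mors i) (i + 1) (cpx_d P i)).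

Lemma entry_cast i a b (e : a = b) (f : mor (P i) (P a)) j :
  component j (@ltr k (row_mors i) b (mor_cast e f)) = component j (@ltr k (row_mors i) a f).
Proof. by case: b / e. Qed.

Lemma entry_inj n (f g : end_mod n) : (forall i j, entry f i j = entry g i j) -> f = g.
Proof.
move=> h; apply: functional_extensionality_dep => i.
by have := h i (i + n); rewrite /entry !component_ltr.
Qed.
Lemma entry_lin n i j : linear (fun f : end_mod n => entry f i j).
Proof. by move=> a f g; exact: (@component_linear k (row_mors i)). Qed.
Arguments entry_lin {n}.
Lemma entryD n (f g : end_mod n) a i j :
  entry (a *: f + g) i j = a *: entry f i j + entry g i j.
Proof. exact: entry_lin. Qed.

Lemma ltr_entry m n (f : end_mod m) (g : end_mod n) : m = n ->
  (forall i j, entry f i j = entry g i j) -> ltr f = ltr g.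
Proof. by move=> e; move: g; case: n / e => g /entry_inj ->. Qed.
Lemma entry_component m n (f : end_mod m) i j : m = n ->
  entry (component n (@ltr k end_mod m f)) i j = entry f i j.
Proof. by case: n /; rewrite component_ltr. Qed.

Lemma comp_component i l a j (f : mor (P i) (P l)) (g : mor (P l) (P a)) :
  component j (@ltr k (row_mors i) a (g \c f)) = component j (@ltr k (row_mors l) a g) \c f.
Proof.
case: (eqVneq a j) => [<-|h]; first by rewrite !component_ltr.
by rewrite !component_neq // (linfun0 (comp_linearl f)).
Qed.

Lemma entry_mul m n (g : end_mod m) (f : end_mod n) i j l : l = i + n ->
  entry (end_mul g f) i j = entry g l j \c entry f i l.
Proof. by move=> ->; rewrite /entry /end_mul entry_cast comp_component component_ltr. Qed.
Lemma entry_d n (f : end_mod n) i j l l' : l = i + n -> l' = i + 1 ->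
  entry (end_d f) i j = D l j \c entry f i l - koszul k n *: (entry f l' j \c D i l').
Proof.
move=> -> ->; rewrite /entry /end_d.
have hl := @component_linear k (row_mors i) (i + (n + 1)) j.
rewrite (linfunD hl) (linfunN hl) (linfunZ hl) !entry_cast !comp_component.
by rewrite /D !component_ltr.
Qed.
Lemma entry_one i j : entry end_one i j = component j (@ltr k (row_mors i) i (idm (P i))).
Proof. by rewrite /entry entry_cast. Qed.
Lemma D_D i j l : D j l \c D i j = 0.
Proof.
rewrite /D; case: (eqVneq (i + 1) j) => [<-|h].
  rewrite -comp_component component_ltr cpx_dd.
  exact: (linfun0 (@component_linear k (row_mors i) _ _)).
by rewrite [X in _ \c X]component_neq // (linfun0 (comp_linearr _)).
Qed.

Fact end_d_linear n : linear (@end_d n).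
Proof.
move=> a f g; apply: entry_inj => i j; rewrite entryD !(entry_d _ _ erefl erefl) !entryD.
rewrite (comp_linearl _) (comp_linearr _).
rewrite !scalerDr opprD !scalerN !scalerA (mulrC (koszul k n)) !addrA.
by congr (_ + _); rewrite -!addrA; congr (_ + _); rewrite addrC.
Qed.
Fact end_mul_linearl m n f : linear (fun g => @end_mul m n g f).
Proof.
move=> a g g'; apply: entry_inj => i j.
by rewrite entryD !(entry_mul _ _ _ erefl) entryD (comp_linearl _).
Qed.
Fact end_mul_linearr m n g : linear (@end_mul m n g).
Proof.
move=> a f f'; apply: entry_inj => i j.
by rewrite entryD !(entry_mul _ _ _ erefl) entryD (comp_linearr _).
Qed.
Fact end_dd n (f : end_mod n) : end_d (end_d f) = 0.
Proof.
apply: entry_inj => i j; rewrite (linfun0 (entry_lin _ _)).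
rewrite (@entry_d _ _ _ _ (i + n + 1) (i + 1)) //; last by lia.
rewrite (@entry_d _ _ _ _ (i + n) (i + 1)) //
  (@entry_d _ f _ _ (i + n + 1) (i + 1 + 1)) //; last by lia.
rewrite (linfunD (comp_linearr _)) (linfunN (comp_linearr _)) (linfunZ (comp_linearr _)).
rewrite (linfunD (comp_linearl _)) (linfunN (comp_linearl _)) (linfunZ (comp_linearl _)).
rewrite compA D_D (linfun0 (comp_linearl _)) -!compA D_D (linfun0 (comp_linearr _)).
by rewrite scaler0 subr0 add0r koszulS scaleNr opprK addNr.
Qed.
Fact end_mulA l m n (x : end_mod l) (y : end_mod m) (z : end_mod n) :
  ltr (end_mul x (end_mul y z)) = ltr (end_mul (end_mul x y) z).
Proof.
apply: ltr_entry => [|i j]; first exact: addrA.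
rewrite (@entry_mul _ _ x _ i j (i + n + m)); last by lia.
rewrite (@entry_mul _ _ y z i _ (i + n)) // (@entry_mul _ _ _ z i j (i + n)) //.
by rewrite (@entry_mul _ _ x y _ _ (i + n + m)) // compA.
Qed.
Fact end_mul1x n (x : end_mod n) : ltr (end_mul end_one x) = ltr x.
Proof.
apply: ltr_entry => [|i j]; first exact: add0r.
rewrite (entry_mul _ _ _ erefl) entry_one.
rewrite -comp_component comp1f /entry.
by rewrite [component (i + n) _]component_ltr.
Qed.
Fact end_mulx1 n (x : end_mod n) : ltr (end_mul x end_one) = ltr x.
Proof.
apply: ltr_entry => [|i j]; first exact: addr0.
by rewrite (@entry_mul _ _ _ _ _ _ i) ?addr0 // entry_one component_ltr compf1.
Qed.
Fact end_leibniz m n (x : end_mod m) (y : end_mod n) :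
  end_d (end_mul x y) =
    component (m + n + 1) (@ltr k end_mod _ (end_mul (end_d x) y)) +
    koszul k m *: component (m + n + 1) (@ltr k end_mod _ (end_mul x (end_d y))).
Proof.
apply: entry_inj => i j.
rewrite (linfunD (entry_lin _ _)) (linfunZ (entry_lin _ _)) !entry_component; try by lia.
rewrite (@entry_d _ _ _ _ (i + n + m) (i + 1)) //; last by lia.
rewrite (@entry_mul _ _ x y i _ (i + n)) // (@entry_mul _ _ x y (i + 1) _ (i + n + 1)); last by lia.
rewrite (@entry_mul _ _ _ _ _ _ (i + n)) // (@entry_d _ _ _ _ (i + n + m) (i + n + 1)) //.
rewrite (@entry_mul _ _ _ _ _ _ (i + n + 1)) //; last by lia.
rewrite (@entry_d _ _ _ _ (i + n) (i + 1)) //.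
rewrite (linfunD (comp_linearr _)) (linfunN (comp_linearr _)) (linfunZ (comp_linearr _)).
rewrite (linfunD (comp_linearl _)) (linfunN (comp_linearl _)) (linfunZ (comp_linearl _)).
rewrite scalerDr scalerN scalerA -koszulD !compA !addrA; congr (_ - _).
by rewrite addrNK.
Qed.

Definition end_dga : dg_algebra k :=
  {| dga_d_linear := end_d_linear; dga_mul_linearl := end_mul_linearl;
     dga_mul_linearr := end_mul_linearr; dga_dd := end_dd; dga_mulA := end_mulA;
     dga_mul1x := end_mul1x; dga_mulx1 := end_mulx1; dga_leibniz := end_leibniz |}.
End Category.

Definition exact_functor (k : comPzRingType) (C D : klinear_category k) (F : C -> D)
    (Fm : forall X Y, mor X Y -> mor (F X) (F Y)) :=
  forall X Y Z (f : mor X Y) (g : mor Y Z), short_exact f g -> short_exact (Fm _ _ f) (Fm _ _ g).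

Record klinear_monoidal_category (k : comPzRingType) := {
  mon_cat :> klinear_category k;
  mon_tens : mon_cat -> mon_cat -> mon_cat;
  mon_tensm : forall X X' Y Y' : mon_cat,
    mor X X' -> mor Y Y' -> mor (mon_tens X Y) (mon_tens X' Y');
  mon_unit : mon_cat;
  mon_assoc : forall X Y Z : mon_cat,
    mor (mon_tens (mon_tens X Y) Z) (mon_tens X (mon_tens Y Z));
  mon_lunit : forall X : mon_cat, mor (mon_tens mon_unit X) X;
  mon_runit : forall X : mon_cat, mor (mon_tens X mon_unit) X;
  mon_tensm_id : forall X Y : mon_cat, mon_tensm (idm X) (idm Y) = idm (mon_tens X Y);
  mon_tensm_comp : forall (X X' X'' Y Y' Y'' : mon_cat) (f' : mor X' X'') (f : mor X X')
    (g' : mor Y' Y'') (g : mor Y Y'),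
    mon_tensm (f' \c f) (g' \c g) = mon_tensm f' g' \c mon_tensm f g;
  mon_tensm_linearl : forall (X X' Y Y' : mon_cat) (g : mor Y Y'),
    linear (fun f : mor X X' => mon_tensm f g);
  mon_tensm_linearr : forall (X X' Y Y' : mon_cat) (f : mor X X'),
    linear (fun g : mor Y Y' => mon_tensm f g);
  mon_assoc_iso : forall X Y Z, is_iso (mon_assoc X Y Z);
  mon_lunit_iso : forall X, is_iso (mon_lunit X);
  mon_runit_iso : forall X, is_iso (mon_runit X);
  mon_assoc_nat : forall (X X' Y Y' Z Z' : mon_cat)
    (f : mor X X') (g : mor Y Y') (h : mor Z Z'),
    mon_assoc X' Y' Z' \c mon_tensm (mon_tensm f g) h =
    mon_tensm f (mon_tensm g h) \c mon_assoc X Y Z;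
  mon_lunit_nat : forall (X X' : mon_cat) (f : mor X X'),
    mon_lunit X' \c mon_tensm (idm mon_unit) f = f \c mon_lunit X;
  mon_runit_nat : forall (X X' : mon_cat) (f : mor X X'),
    mon_runit X' \c mon_tensm f (idm mon_unit) = f \c mon_runit X;
  mon_pentagon : forall X Y Z T : mon_cat,
    mon_assoc X Y (mon_tens Z T) \c mon_assoc (mon_tens X Y) Z T =
    mon_tensm (idm X) (mon_assoc Y Z T) \c mon_assoc X (mon_tens Y Z) T
      \c mon_tensm (mon_assoc X Y Z) (idm T);
  mon_triangle : forall X Y : mon_cat,
    mon_tensm (idm X) (mon_lunit Y) \c mon_assoc X mon_unit Y =
    mon_tensm (mon_runit X) (idm Y)
}.

(* Main.v *)
(* Let P be the resolution of the unit I. For a word t = b1 .. bn of degrees write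
   P_t = P^b1 (x) .. (x) P^bn (x) I. The families of morphisms P^a -> P_t form a
   brace algebra V, in which x{y1,..,yp} inserts the yi into the output of x, and so
   T^c(V) is a bialgebra for the product that braces define. Since the P^a are
   projective and P^b (x) - is exact, the isomorphism I -> I (x) I lifts, arity by
   arity, to a coalgebra structure up to homotopy on P: an element m of degree 1 of
   V with m{m} = 0 whose arity 1 part is the differential of P. The commutator with
   m is then a differential on the bialgebra, which gives the B_infinity-algebra B.

   The A_infinity-morphism to End(P) sends v1,..,vn to the endomorphisms
   P^i -> P^b (x) P_s -> P^b, where the first arrow is a component of m and the
   second one applies v1 .. vn to P_s, leaving no letter. Its linear part only sees
   the arity 0 part Hom(P, I) of V, which computes the same cohomology as End(P).
   The elements of arity at least 1 are acyclic: up to homotopy the arity n part is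
   Hom(P, I) for every n, and the part of the differential that raises the arity from
   n to n + 1 is an alternating sum of isomorphisms, invertible for n odd. *)

From HB Require Import structures.
From mathcomp Require Import all_boot all_order all_algebra.
From mathcomp Require Import boolp zify ring.
Require Import Defs.

Set Implicit Arguments.
Unset Strict Implicit.
Unset Printing Implicit Defensive.
Import Order.TTheory GRing.Theory Num.Theory.
Local Open Scope ring_scope.

(** * Sums over deconcatenations and multilinear functions of words *)

(** Only [P ⊗ -] is exact, so maps into a tensor power can be lifted only through its last factor.
    Every lifting problem is therefore solved by descending induction on the degree of the last
    factor, and then by induction on the arity, augmenting that factor away. As a result a cochain
    of fixed arity that is closed for the differential of the tensor power is exact as soon as its
    image in Hom(P, I) is. The obstructions to extending m are tested there: P vanishes in positive
    degrees, so only the obstruction of arity 3 could survive, and it is the difference of two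
    iterated comultiplications with the same augmentation. Infinitely many corrections are made, so
    cochains are products, not sums, over the words t. The comultiplication is counital only up to
    homotopy. In the passage from arity n to n + 1 the two outer terms are the counit constraints,
    homotopic to the identity up to sign; the n inner terms have equal augmentations with
    alternating signs. The relations of the morphism to End(P) come from m{m} = 0 itself: insertions
    that avoid the first output factor are traded for those that involve it. *)

Section Cut.
Variable T : Type.
Implicit Type L : zmodType.

Definition cut (L : zmodType) (E : seq T -> seq T -> L) (w : seq T) : L :=
  \sum_(i < (size w).+1) E (take i w) (drop i w).

Lemma cut_nil L (E : seq T -> seq T -> L) : cut E [::] = E [::] [::].
Proof. by rewrite /cut big_ord1. Qed.

Lemma cut_cons L (E : seq T -> seq T -> L) a w :
  cut E (a :: w) = E [::] (a :: w) + cut (fun s t => E (a :: s) t) w.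
Proof. by rewrite /cut big_ord_recl. Qed.

Lemma cut_ext L (E E' : seq T -> seq T -> L) w :
  (forall s t, s ++ t = w -> E s t = E' s t) -> cut E w = cut E' w.
Proof. by move=> h; apply: eq_bigr => i _; apply: h; rewrite cat_take_drop. Qed.

Lemma cutD L (E E' : seq T -> seq T -> L) w :
  cut (fun s t => E s t + E' s t) w = cut E w + cut E' w.
Proof. exact: big_split. Qed.

Lemma cutN L (E : seq T -> seq T -> L) w : cut (fun s t => - E s t) w = - cut E w.
Proof. exact: sumrN. Qed.

Lemma cut0 L w : cut (fun _ _ => 0 : L) w = 0.
Proof. by rewrite /cut big1. Qed.

(** Coassociativity of deconcatenation: the regrouping used whenever a piece of a cut is cut
    again. *)
Lemma cut_cut L (E : seq T -> seq T -> seq T -> L) w :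
  cut (fun s r => cut (fun t1 t2 => E s t1 t2) r) w =
  cut (fun r t2 => cut (fun s t1 => E s t1 t2) r) w.
Proof.
elim: w E => [|a w IH] E; first by rewrite !cut_nil.
rewrite [LHS]cut_cons [RHS]cut_cons !cut_cons cut_nil IH -addrA -cutD.
by congr (_ + _); apply: cut_ext => s t _; rewrite cut_cons.
Qed.

Variable k : comPzRingType.
Lemma cutZ (L : lmodType k) a (E : seq T -> seq T -> L) w :
  cut (fun s t => a *: E s t) w = a *: cut E w.
Proof. by rewrite /cut scaler_sumr. Qed.

Lemma cut_linear (L L' : lmodType k) (g : L -> L') (E : seq T -> seq T -> L) w :
  linear g -> g (cut E w) = cut (fun s t => g (E s t)) w.
Proof. by move=> h; rewrite /cut (linfun_sum h). Qed.
End Cut.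

Lemma cut_exchange (L : zmodType) T T' (E : seq T -> seq T -> seq T' -> seq T' -> L) v w :
  cut (fun s t => cut (E s t) w) v = cut (fun s' t' => cut (fun s t => E s t s' t') v) w.
Proof. exact: exchange_big. Qed.

Lemma cut_only_nil T (L : zmodType) (E : seq T -> seq T -> L) w :
  (forall s t, s ++ t = w -> s <> [::] -> E s t = 0) -> cut E w = E [::] w.
Proof.
case: w => [|x w] h; first by rewrite cut_nil.
rewrite cut_cons -[RHS]addr0 -(cut0 L w); congr (_ + _); by apply: cut_ext => s t e; apply: h => //=; rewrite e.
Qed.
Lemma cut_only_full T (L : zmodType) (E : seq T -> seq T -> L) w :
  (forall s t, s ++ t = w -> t <> [::] -> E s t = 0) -> cut E w = E w [::].
Proof.
elim: w E => [|x w IH] E h; first by rewrite cut_nil.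
rewrite cut_cons h // add0r; apply: IH => s t e; apply: h.
by rewrite -e.
Qed.
Lemma cut_ends T (L : zmodType) (E : seq T -> seq T -> L) w : w <> [::] ->
  cut E w = E [::] w + \sum_(1 <= p < size w) E (take p w) (drop p w) + E w [::].
Proof.
move=> w0; have n0 : (0 < size w)%N by case: (w) w0.
rewrite /cut -(big_mkord xpredT (fun p => E (take p w) (drop p w))) big_nat_recr //= big_ltn //.
by rewrite take0 drop0 take_size drop_size.
Qed.
Lemma cut_rcons T (L : zmodType) (E : seq T -> seq T -> L) w x :
  cut E (w ++ [:: x]) = cut (fun s t => E s (t ++ [:: x])) w + E (w ++ [:: x]) [::].
Proof.
elim: w E => [|y w IH] E; first by rewrite /= cut_cons !cut_nil.
by rewrite [LHS]cut_cons IH cut_cons addrA.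
Qed.
Lemma cut_eq0 T (L : zmodType) (E : seq T -> seq T -> L) w :
  (forall s t, s ++ t = w -> E s t = 0) -> cut E w = 0.
Proof. by move=> h; rewrite -[RHS](cut0 L w); exact: cut_ext. Qed.

(** * Closure properties of linear maps *)

Section Linearity.
Variable k : comPzRingType.
Implicit Types L : lmodType k.

Lemma linear_id L : linear (@id L). Proof. by []. Qed.
Lemma linear_zero L L' : linear (fun _ : L => 0 : L').
Proof. by move=> a x y; rewrite scaler0 addr0. Qed.
Lemma linear_comp L L' L'' (f : L' -> L'') (g : L -> L') :
  linear f -> linear g -> linear (fun x => f (g x)).
Proof. by move=> hf hg a x y; rewrite hg hf. Qed.
Lemma linear_scale L L' c (f : L -> L') : linear f -> linear (fun x => c *: f x).
Proof. by move=> h a x y; rewrite h scalerDr !scalerA mulrC. Qed.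
Lemma linear_add L L' (f g : L -> L') : linear f -> linear g -> linear (fun x => f x + g x).
Proof. by move=> hf hg a x y; rewrite hf hg scalerDr addrACA. Qed.
Lemma linear_opp L L' (f : L -> L') : linear f -> linear (fun x => - f x).
Proof. by move=> hf a x y; rewrite hf opprD scalerN. Qed.
Lemma linear_sum L L' (I : Type) (r : seq I) (F : I -> L -> L') :
  (forall i, linear (F i)) -> linear (fun x => \sum_(i <- r) F i x).
Proof.
move=> h a x y; rewrite scaler_sumr -big_split; apply: eq_bigr => i _; exact: h.
Qed.
Lemma linear_cut L L' T (F : seq T -> seq T -> L -> L') w :
  (forall s t, linear (F s t)) -> linear (fun x => cut (fun s t => F s t x) w).
Proof. by move=> h; apply: linear_sum. Qed.
Lemma linear_ext L L' (f g : L -> L') : f =1 g -> linear g -> linear f.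
Proof. by move=> h hg a x y; rewrite !h hg. Qed.
End Linearity.

(** * Linear maps on the cotensor coalgebra, determined by words *)

Section Words.
Variables (k : comPzRingType) (V : graded k).
Notation T := (cotensor V).
Local Notation tlift := (@lift k (word V) (@multilinear k V) _).
Implicit Types (L : lmodType k) (u w : word V).

Lemma wdeg_cat (u w : word V) : wdeg (u ++ w) = wdeg u + wdeg w.
Proof. by rewrite /wdeg big_cat. Qed.
Lemma wdeg_ltr i (x : V i) : wdeg [:: ltr x] = i.
Proof. by rewrite /wdeg big_seq1. Qed.
Lemma wdeg_single (a : letter V) : wdeg [:: a] = tag a.
Proof. by rewrite /wdeg big_seq1. Qed.

Lemma ltr_eq (a : letter V) j : j = tag a -> ltr (component j a) = a.
Proof. by move->; rewrite ltr_component. Qed.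

Lemma T_ext L (F G : T -> L) : linear F -> linear G ->
  (forall w, F (bar w) = G (bar w)) -> F =1 G.
Proof. exact: pgen_ext. Qed.

Lemma lift_bar L (phi : word V -> L) w : multilinear phi -> lift phi (bar w) = phi w.
Proof. exact: lift_gen. Qed.
Lemma linear_lift L (phi : word V -> L) : multilinear phi -> linear (tlift phi).
Proof. exact: lift_linear. Qed.

(** A Koszul sign needs a degree, which only homogeneous elements have; an identity with a fixed
    sign is reduced here to the words of that degree. *)
Lemma homog_ext L e (F G : T -> L) z : linear F -> linear G ->
  (forall w, wdeg w = e -> F (bar w) = G (bar w)) -> homog e z -> F z = G z.
Proof.
move=> hF hG h [s [/allP hs ->]]; rewrite !(linfun_sum hF) !(linfun_sum hG).
rewrite big_seq [RHS]big_seq; apply: eq_bigr => p /hs /eqP hp.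
by rewrite (linfunZ hF) (linfunZ hG) h.
Qed.

Lemma homog0 e : homog e (0 : T).
Proof. by exists [::]; rewrite big_nil. Qed.
Lemma homogD e (x y : T) : homog e x -> homog e y -> homog e (x + y).
Proof.
by move=> [s [hs ->]] [t [ht ->]]; exists (s ++ t); rewrite all_cat hs ht big_cat.
Qed.
Lemma homogZ e a (x : T) : homog e x -> homog e (a *: x).
Proof.
move=> [s [hs ->]]; exists [seq (a * p.1, p.2) | p <- s]; split.
  by rewrite all_map; apply: sub_all hs.
by rewrite big_map scaler_sumr; apply: eq_bigr => p _; rewrite scalerA.
Qed.
Lemma homog_cut e (F : word V -> word V -> T) w :
  (forall s t, s ++ t = w -> homog e (F s t)) -> homog e (cut F w).
Proof.
move=> h; elim: w F h => [|a w IH] F h; first by rewrite cut_nil; exact: h.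
rewrite cut_cons; apply: homogD; first exact: h.
by apply: IH => s t E; apply: h; rewrite -E.
Qed.
Lemma homog_lin e e' (F : T -> T) z : linear F ->
  (forall w, wdeg w = e -> homog e' (F (bar w))) -> homog e z -> homog e' (F z).
Proof.
move=> hF h [s [/allP hs ->]]; rewrite (linfun_sum hF).
elim: s hs => [|p s IH] hs; first by rewrite big_nil; exact: homog0.
rewrite big_cons (linfunZ hF); apply: homogD.
  by apply/homogZ/h/eqP/hs; rewrite inE eqxx.
by apply: IH => q hq; apply: hs; rewrite inE hq orbT.
Qed.

Lemma multilinear_comp L L' (F : L -> L') (phi : word V -> L) :
  linear F -> multilinear phi -> multilinear (fun w => F (phi w)).
Proof. by move=> hF h u t i; apply: (linear_comp hF (h u t i)). Qed.
(** The degree of a word depends on the degree of the varied letter but not on its value, so the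
    factor is a constant. *)
Lemma multilinear_wdeg L (c : int -> k) (phi : word V -> L) :
  multilinear phi -> multilinear (fun w => c (wdeg w) *: phi w).
Proof.
move=> h u t i; apply: (linear_ext (g := fun x => c (wdeg u + (i + wdeg t)) *: phi (u ++ ltr x :: t))).
  by move=> x; rewrite wdeg_cat wdeg_cons.
exact/linear_scale/h.
Qed.
Lemma multilinear_pre L p (phi : word V -> L) :
  multilinear phi -> multilinear (fun w => phi (p ++ w)).
Proof.
move=> h u t i; apply: (linear_ext (g := fun x => phi ((p ++ u) ++ ltr x :: t))).
  by move=> x; rewrite catA.
exact: h.
Qed.
Lemma multilinear_cons L a (phi : word V -> L) :
  multilinear phi -> multilinear (fun w => phi (a :: w)).
Proof. exact: (@multilinear_pre L [:: a]). Qed.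
Lemma multilinear_cut L (E : word V -> word V -> L) :
  (forall s, multilinear (E s)) -> (forall t, multilinear (E ^~ t)) -> multilinear (cut E).
Proof.
move=> h1 h2 u t i; elim: u E h1 h2 => [|b u IH] E h1 h2 /=.
  apply: (linear_ext (g := fun x => E [::] (ltr x :: t) + cut (fun s t' => E (ltr x :: s) t') t)).
    by move=> x; rewrite cut_cons.
  apply: linear_add; first exact: (h1 [::] [::] t).
  by apply: linear_cut => s t'; exact: (h2 t' [::] s).
apply: (linear_ext (g := fun x => E [::] (b :: u ++ ltr x :: t) + cut (fun s t' => E (b :: s) t') (u ++ ltr x :: t))).
  by move=> x; rewrite cut_cons.
apply: linear_add; first exact: (h1 [::] (b :: u) t).
by apply: IH => [s|t']; [exact: h1 | exact: (multilinear_cons b (h2 t'))].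
Qed.

Definition bcat (u : word V) (y : T) : T := lift (fun w => bar (u ++ w)) y.
Lemma bcat_linear u : linear (bcat u).
Proof. exact/linear_lift/multilinear_pre/bar_multilinear. Qed.
Lemma bcat_bar u w : bcat u (bar w) = bar (u ++ w).
Proof. exact/lift_bar/multilinear_pre/bar_multilinear. Qed.
Lemma bcat_multilinear y : multilinear (bcat ^~ y).
Proof.
move=> u t i a b c.
apply: (T_ext (F := bcat (u ++ ltr (a *: b + c) :: t))
  (G := fun y => a *: bcat (u ++ ltr b :: t) y + bcat (u ++ ltr c :: t) y)).
- exact: bcat_linear.
- by apply: linear_add; [apply/linear_scale|]; exact: bcat_linear.
move=> w; rewrite !bcat_bar -!catA /=; exact: bar_multilinear.
Qed.
Lemma bcat_cat u w y : bcat (u ++ w) y = bcat u (bcat w y).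
Proof.
move: y; apply: T_ext; first exact: bcat_linear.
  exact: linear_comp (bcat_linear u) (bcat_linear w).
by move=> y; rewrite !bcat_bar catA.
Qed.
Lemma bcat_nil y : bcat [::] y = y.
Proof. by move: y; apply: T_ext; [exact: bcat_linear| |move=> y; rewrite bcat_bar]. Qed.
Lemma homog_bcat e u y : homog e y -> homog (wdeg u + e) (bcat u y).
Proof.
apply: homog_lin; first exact: bcat_linear.
by move=> w <-; rewrite bcat_bar -wdeg_cat; exact: homog_bar.
Qed.
End Words.

Lemma scale_koszul (k : comPzRingType) (L : lmodType k) a b (x : L) :
  koszul k a *: (koszul k b *: x) = koszul k (a + b) *: x.
Proof. by rewrite scalerA koszulD. Qed.

(** * The bialgebra of a brace algebra *)

Section Star.
Variables (k : comPzRingType) (V : graded k).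
Variable br : letter V -> word V -> forall j, V j.
Hypothesis br_linr : forall a j, multilinear (fun w => br a w j).
Hypothesis br_linl : forall i w j, linear (fun x : V i => br (ltr x) w j).
Hypothesis br_nil : forall a j, br a [::] j = component j a.
Notation T := (cotensor V).
Local Notation K := (koszul k).
Local Notation tlift := (@lift k (word V) (@multilinear k V) _).
Implicit Types (L : lmodType k) (u w : word V).

(** The brace as a letter, of the degree that a map of degree 0 gives it, so that it can again be
    part of a word. *)
Definition brl (a : letter V) (w : word V) : letter V := ltr (br a w (tag a + wdeg w)).

Lemma brl_nil a : brl a [::] = a.
Proof. by rewrite /brl br_nil ltr_eq // wdeg_nil addr0. Qed.

Lemma brl_linr a L (phi : letter V -> L) :
  (forall i, linear (fun x : V i => phi (ltr x))) -> multilinear (fun w => phi (brl a w)).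
Proof.
move=> h u t i; rewrite /brl.
apply: (linear_ext (g := fun x : V i => phi (ltr (br a (u ++ ltr x :: t) (tag a + (wdeg u + (i + wdeg t))))))).
  by move=> x; rewrite wdeg_cat wdeg_cons.
apply: (linear_comp (h _)); exact: br_linr.
Qed.

(* The product of T^c(V): the letters of u are shuffled, in order, between those of x,
   each of them swallowing the (possibly empty) block of x that it is placed on. *)
Fixpoint star (u x : word V) : T :=
  if u is v :: u' then
    cut (fun x1 x' => K (wdeg x1 * wdeg u) *: bcat x1
      (cut (fun x2 x3 => K (wdeg x2 * wdeg u') *: bcat [:: brl v x2] (star u' x3)) x')) x
  else bar x.

(** The terms of [star (v :: u) x] whose first output letter is v with the block that it
    swallows. *)
Definition eat v u x : T :=
  cut (fun x2 x3 => K (wdeg x2 * wdeg u) *: bcat [:: brl v x2] (star u x3)) x.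

Lemma star_cons v u x : star (v :: u) x =
  cut (fun x1 x' => K (wdeg x1 * wdeg (v :: u)) *: bcat x1 (eat v u x')) x.
Proof. by []. Qed.

Lemma star_cons_nil v u : star (v :: u) [::] = eat v u [::].
Proof. by rewrite star_cons cut_nil wdeg_nil mul0r scale1r bcat_nil. Qed.

(** The first letter of the output is either v with its block or the first letter of x. The
    inductions on [star] follow this alternative. *)
Lemma star_cons_cons v u y x : star (v :: u) (y :: x) =
  eat v u (y :: x) + K (tag y * wdeg (v :: u)) *: bcat [:: y] (star (v :: u) x).
Proof.
rewrite star_cons cut_cons wdeg_nil mul0r scale1r bcat_nil; congr (_ + _).
rewrite star_cons (cut_linear _ _ (bcat_linear _)) -cutZ; apply: cut_ext => s t _.
rewrite (linfunZ (bcat_linear _)) scale_koszul -bcat_cat; congr (K _ *: _).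
by rewrite [wdeg (y :: s)]wdeg_cons mulrDl.
Qed.

Lemma star_nil u : star u [::] = bar u.
Proof.
elim: u => [//|v u IH]; rewrite star_cons_nil /eat cut_nil wdeg_nil mul0r scale1r brl_nil.
by rewrite IH bcat_bar.
Qed.

Lemma star_linr u : multilinear (star u).
Proof.
elim: u => [|v u IH]; first exact: bar_multilinear.
have he : multilinear (eat v u).
  apply: multilinear_cut => s.
    exact: (multilinear_comp (linear_scale _ (bcat_linear _)) IH).
  apply: (multilinear_wdeg (fun d => K (d * wdeg u)) (phi := fun w => bcat [:: brl v w] (star u s))).
  apply: (brl_linr v (phi := fun a => bcat [:: a] (star u s))) => i.
  exact: (bcat_multilinear (star u s) [::] [::]).
apply: (multilinear_cut (E := fun x1 x' => K (wdeg x1 * wdeg (v :: u)) *: bcat x1 (eat v u x'))) => s.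
  exact: (multilinear_comp (linear_scale _ (bcat_linear _)) he).
exact: (multilinear_wdeg (fun d => K (d * wdeg (v :: u))) (bcat_multilinear _)).
Qed.

Lemma star_linl x : multilinear (star ^~ x).
Proof.
move=> u t i; elim: u x => [|v u IH] x.
  apply: (linear_ext (g := fun y : V i => cut (fun x1 x' => K (wdeg x1 * (i + wdeg t)) *:
    bcat x1 (cut (fun x2 x3 => K (wdeg x2 * wdeg t) *:
      bcat [:: brl (ltr y) x2] (star t x3)) x')) x)).
    by move=> y /=; rewrite !wdeg_cons.
  apply: linear_cut => x1 x'.
  apply/linear_scale/(linear_comp (bcat_linear _))/linear_cut => x2 x3.
  apply/linear_scale/(linear_comp (f := fun z : V (i + wdeg x2) => bcat [:: ltr z] (star t x3))).
    exact: (bcat_multilinear (star t x3) [::] [::]).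
  exact: br_linl.
rewrite /= -/star.
apply: (linear_ext (g := fun y : V i => cut (fun x1 x' => K (wdeg x1 * (tag v + (wdeg u + (i + wdeg t)))) *:
    bcat x1 (cut (fun x2 x3 => K (wdeg x2 * (wdeg u + (i + wdeg t))) *:
      bcat [:: brl v x2] (star (u ++ ltr y :: t) x3)) x')) x)).
  by move=> y /=; rewrite !wdeg_cons wdeg_cat wdeg_cons.
apply: linear_cut => x1 x'.
apply/linear_scale/(linear_comp (bcat_linear _))/linear_cut => x2 x3.
apply/linear_scale/(linear_comp (bcat_linear _)); exact: IH.
Qed.

Definition mul (x y : T) : T := tlift (fun u => tlift (star u) y) x.

Lemma mul_lin_aux y : multilinear (fun u => tlift (star u) y).
Proof.
move=> u t i a b c.
apply: (T_ext (F := tlift (star (u ++ ltr (a *: b + c) :: t)))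
  (G := fun y => a *: tlift (star (u ++ ltr b :: t)) y + tlift (star (u ++ ltr c :: t)) y)).
- exact/linear_lift/star_linr.
- by apply: linear_add; [apply/linear_scale|]; exact/linear_lift/star_linr.
move=> w; rewrite !lift_bar; try exact: star_linr.
exact: star_linl.
Qed.
Lemma mul_linl y : linear (mul^~ y).
Proof. exact/linear_lift/mul_lin_aux. Qed.
Lemma mul_bar u x : mul (bar u) (bar x) = star u x.
Proof. by rewrite /mul lift_bar ?lift_bar //; [exact: star_linr|exact: mul_lin_aux]. Qed.
Lemma mul_linr x : linear (mul x).
Proof.
move=> a y z; move: x.
apply: (T_ext (F := fun x => mul x (a *: y + z)) (G := fun x => a *: mul x y + mul x z)).
- exact: mul_linl.
- by apply: linear_add; [apply/linear_scale|]; exact: mul_linl.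
move=> u; rewrite /mul !lift_bar; try exact: mul_lin_aux.
exact: (linear_lift (@star_linr u)).
Qed.

Lemma star_homog u x : homog (wdeg u + wdeg x) (star u x).
Proof.
elim: u x => [|v u IH] x; first by rewrite wdeg_nil add0r; exact: homog_bar.
rewrite star_cons; apply: homog_cut => s t <-; apply: homogZ.
rewrite wdeg_cat addrCA; apply: homog_bcat.
apply: homog_cut => s' t' <-; apply: homogZ.
have -> : wdeg (v :: u) + wdeg (s' ++ t') = wdeg [:: brl v s'] + (wdeg u + wdeg t').
  by rewrite wdeg_single wdeg_cat wdeg_cons /=; ring.
exact: homog_bcat.
Qed.

Lemma mul_homog d e x y : homog d x -> homog e y -> homog (d + e) (mul x y).
Proof.
move=> hx hy; move: hx; apply: (homog_lin (F := mul^~ y)); first exact: mul_linl.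
move=> u <-; move: hy; apply: (homog_lin (F := mul (bar u))); first exact: mul_linr.
by move=> w <-; rewrite mul_bar; exact: star_homog.
Qed.

Lemma mul1x : left_id (bar [::]) mul.
Proof.
apply: (T_ext (F := mul (bar [::])) (G := id)) => //; first exact: mul_linr.
by move=> w; rewrite mul_bar.
Qed.
Lemma mulx1 : right_id (bar [::]) mul.
Proof.
apply: (T_ext (F := mul^~ (bar [::])) (G := id)) => //; first exact: mul_linl.
by move=> w; rewrite mul_bar star_nil.
Qed.

Definition tl (f : T -> T) : tensor T T -> tensor T T :=
  @lift k _ (@bilinear2 k T T) _ (fun p : T * T => tmul (f p.1) p.2).
Lemma tl_bilinear (f : T -> T) : linear f -> bilinear2 (fun p : T * T => tmul (f p.1) p.2 : tensor T T).
Proof.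
move=> h; split=> [y|x] /=; last exact: (tmul_bilinear T T).2.
exact: (linear_comp ((tmul_bilinear T T).1 y) h).
Qed.
Lemma tl_linear (f : T -> T) : linear f -> linear (tl f).
Proof. by move=> h; apply: lift_linear; exact: tl_bilinear. Qed.
Lemma tl_tmul (f : T -> T) x y : linear f -> tl f (tmul x y) = tmul (f x) y.
Proof. by move=> h; rewrite /tl lift_gen //; exact: tl_bilinear. Qed.

Lemma coproduct_cut w : coproduct (bar w) = cut (fun s t => tmul (bar s) (bar t)) (w : word V).
Proof. exact: coproduct_bar. Qed.

Lemma coproduct_bcat a (z : T) :
  coproduct (bcat [:: a] z) = tmul (bar [::]) (bcat [:: a] z) + tl (bcat [:: a]) (coproduct z).
Proof.
move: z; apply: T_ext.
- exact: (linear_comp (@coproduct_linear k V) (bcat_linear _)).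
- apply: linear_add; first exact: (linear_comp ((tmul_bilinear T T).2 _) (bcat_linear _)).
  exact: (linear_comp (tl_linear (bcat_linear _)) (@coproduct_linear k V)).
move=> w; rewrite bcat_bar !coproduct_cut cut_cons; congr (_ + _).
rewrite (cut_linear _ _ (tl_linear (bcat_linear _))); apply: cut_ext => s t _.
by rewrite tl_tmul ?bcat_bar //; exact: bcat_linear.
Qed.

(** Prepending a letter a turns Δ z into 1 ⊗ az + (a ⊗ 1) Δ z. The hypothesis on u and
    coassociativity for the cuts of x do the rest. *)
Lemma coproduct_eat v u x :
  (forall x, coproduct (star u x) = cut (fun u1 u2 => cut (fun x1 x2 =>
    K (wdeg u2 * wdeg x1) *: tmul (star u1 x1) (star u2 x2)) x) u) ->
  coproduct (eat v u x) = tmul (bar [::]) (eat v u x) +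
    cut (fun u1 u2 => cut (fun x1 x2 =>
      K (wdeg u2 * wdeg x1) *: tmul (eat v u1 x1) (star u2 x2)) x) u.
Proof.
move=> IH; rewrite (cut_linear _ _ (@coproduct_linear k V)).
rewrite (cut_linear _ _ ((tmul_bilinear T T).2 (bar [::]))).
under cut_ext => s t _.
  rewrite (linfunZ (@coproduct_linear k V)) coproduct_bcat scalerDr.
  rewrite IH (cut_linear _ _ (tl_linear (bcat_linear _))) -(cutZ (K (wdeg s * wdeg u))).
  over.
rewrite cutD; congr (_ + _).
  by apply: cut_ext => s t _; rewrite (linfunZ ((tmul_bilinear T T).2 _)).
rewrite cut_exchange; apply: cut_ext => u1 u2 hu.
transitivity (cut (fun r t2 => cut (fun s t1 => K (wdeg u2 * wdeg r) *:
   tmul (K (wdeg s * wdeg u1) *: bcat [:: brl v s] (star u1 t1)) (star u2 t2)) r) x); last first.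
  apply: cut_ext => r t2 _; rewrite /eat.
  by rewrite (cut_linear _ _ ((tmul_bilinear T T).1 (star u2 t2))) cutZ.
(* The sign must be written in terms of the pieces s and t1 of r before [cut_cut] can regroup the
   sums. *)
transitivity (cut (fun r t2 => cut (fun s t1 => K (wdeg u2 * wdeg (s ++ t1)) *:
   tmul (K (wdeg s * wdeg u1) *: bcat [:: brl v s] (star u1 t1)) (star u2 t2)) r) x); last first.
  by apply: cut_ext => r t2 _; apply: cut_ext => s t1 <-.
rewrite -[RHS]cut_cut; apply: cut_ext => s r _.
rewrite (cut_linear _ _ (tl_linear (bcat_linear _))) -cutZ; apply: cut_ext => t1 t2 _.
rewrite (linfunZ (tl_linear (bcat_linear _))) tl_tmul; last exact: bcat_linear.
rewrite (linfunZ ((tmul_bilinear T T).1 (star u2 t2))) !scale_koszul; congr (K _ *: _).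
by rewrite -hu !wdeg_cat; ring.
Qed.

(** A cut of the output cuts u and x independently, because the block swallowed by a letter of u
    stays on its side of the cut; the sign moves u2 past x1. *)
Lemma coproduct_star u x : coproduct (star u x) = cut (fun u1 u2 => cut (fun x1 x2 =>
    K (wdeg u2 * wdeg x1) *: tmul (star u1 x1) (star u2 x2)) x) u.
Proof.
elim: u x => [|v u IH] x.
  rewrite cut_nil coproduct_cut; apply: cut_ext => s t _.
  by rewrite wdeg_nil mul0r scale1r.
elim: x => [|y x IHx].
  rewrite star_cons_nil coproduct_eat // [RHS]cut_cons; congr (_ + _).
    by rewrite cut_nil wdeg_nil mulr0 scale1r star_cons_nil.
  by apply: cut_ext => s t _; rewrite !cut_nil star_cons_nil.
rewrite star_cons_cons (linfunD (@coproduct_linear k V)) (linfunZ (@coproduct_linear k V)).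
rewrite coproduct_bcat coproduct_eat // IHx scalerDr addrACA.
rewrite -(linfunZ ((tmul_bilinear T T).2 (bar [::]))) -(linfunD ((tmul_bilinear T T).2 (bar [::]))) /=.
rewrite -star_cons_cons.
rewrite [RHS]cut_cons [X in _ = X + _]cut_cons wdeg_nil mulr0 scale1r -addrA; congr (_ + _).
rewrite [X in _ + _ *: tl _ X]cut_cons (linfunD (tl_linear (bcat_linear _))) scalerDr.
rewrite addrCA; congr (_ + _).
  rewrite (cut_linear _ _ (tl_linear (bcat_linear _))) -cutZ; apply: cut_ext => s t _.
  rewrite (linfunZ (tl_linear (bcat_linear _))) tl_tmul; last exact: bcat_linear.
  rewrite scale_koszul /= bcat_bar; congr (K _ *: _).
  by rewrite [wdeg (y :: s)]wdeg_cons; ring.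
rewrite (cut_linear _ _ (tl_linear (bcat_linear _))) -cutZ -cutD.
apply: cut_ext => s t hs; rewrite [RHS]cut_cons [in LHS]cut_cons star_cons_nil -addrA; congr (_ + _).
rewrite (cut_linear _ _ (tl_linear (bcat_linear _))) -cutZ -cutD.
apply: cut_ext => x1 x2 _; rewrite star_cons_cons (linfunD ((tmul_bilinear T T).1 _)) scalerDr.
congr (_ + _); rewrite (linfunZ (tl_linear (bcat_linear _))) tl_tmul; last exact: bcat_linear.
rewrite (linfunZ ((tmul_bilinear T T).1 _)) !scale_koszul /=; congr (K _ *: _).
by rewrite -hs [wdeg (y :: x1)]wdeg_cons !wdeg_cons wdeg_cat; ring.
Qed.

Lemma counit_bcat a (z : T) : counit (bcat [:: a] z) = 0.
Proof.
move: z; apply: (T_ext (L := k^o) (F := fun z => counit (bcat [:: a] z)) (G := fun=> 0)).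
- exact: (linear_comp (@counit_linear k V) (bcat_linear _)).
- exact: linear_zero.
- by move=> w; rewrite bcat_bar counit_bar.
Qed.

Lemma counit_mul x y : counit (mul x y) = counit x * counit y.
Proof.
move: x; apply: (T_ext (L := k^o) (F := fun x => counit (mul x y)) (G := fun x => counit x * counit y)).
- exact: (linear_comp (@counit_linear k V) (mul_linl y)).
- exact: (counit_bilinear V).1.
move=> u; move: y.
apply: (T_ext (L := k^o) (F := fun y => counit (mul (bar u) y)) (G := fun y => counit (bar u) * counit y)).
- exact: (linear_comp (@counit_linear k V) (mul_linr _)).
- exact: (counit_bilinear V).2.
move=> x; rewrite mul_bar !counit_bar.
have he v u' x' : counit (eat v u' x') = 0.
  rewrite (cut_linear _ _ (@counit_linear k V)) -[RHS](cut0 k^o x').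
  apply: cut_ext => s t _.
  by rewrite (linfunZ (@counit_linear k V)) counit_bcat; exact: mulr0.
case: u => [|v u]; first by rewrite counit_bar /= mul1r.
case: x => [|b x]; first by rewrite star_cons_nil he mul0r.
rewrite star_cons_cons (linfunD (@counit_linear k V)) he.
by rewrite (linfunZ (@counit_linear k V)) counit_bcat mul0r add0r; exact: mulr0.
Qed.

(** The linear form of [eat]: precomposed with the coproduct, it also applies to sums such as
    [star x y], as associativity requires. *)
Definition eatT v u : tensor T T -> T :=
  @lift k _ (@bilinear2 k T T) _ (fun p : T * T =>
    tlift (fun w => K (wdeg w * wdeg u) *: bcat [:: brl v w] (mul (bar u) p.2)) p.1).

Lemma eatT_multilinear v u z :
  multilinear (fun w => K (wdeg w * wdeg u) *: bcat [:: brl v w] (mul (bar u) z)).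
Proof.
apply: (multilinear_wdeg (fun d => K (d * wdeg u)) (phi := fun w => bcat [:: brl v w] (mul (bar u) z))).
apply: (brl_linr v (phi := fun a => bcat [:: a] (mul (bar u) z))) => i.
exact: (bcat_multilinear _ [::] [::]).
Qed.

Lemma eatT_bilinear v u : bilinear2 (fun p : T * T =>
  tlift (fun w => K (wdeg w * wdeg u) *: bcat [:: brl v w] (mul (bar u) p.2)) p.1).
Proof.
split=> [z|z] /=; first exact: (linear_lift (eatT_multilinear v u z)).
move=> a x y; move: z.
apply: (T_ext (F := tlift (fun w => K (wdeg w * wdeg u) *: bcat [:: brl v w] (mul (bar u) (a *: x + y))))
  (G := fun z => a *: tlift (fun w => K (wdeg w * wdeg u) *: bcat [:: brl v w] (mul (bar u) x)) z +
    tlift (fun w => K (wdeg w * wdeg u) *: bcat [:: brl v w] (mul (bar u) y)) z)).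
- exact/linear_lift/eatT_multilinear.
- by apply: linear_add; [apply/linear_scale|]; exact/linear_lift/eatT_multilinear.
move=> w; rewrite !lift_bar; try exact: eatT_multilinear.
exact: (linear_scale _ (linear_comp (bcat_linear _) (mul_linr (bar u)))).
Qed.
Lemma eatT_linear v u : linear (eatT v u).
Proof. exact: lift_linear (@eatT_bilinear v u). Qed.

Lemma eatT_bar v u s t : eatT v u (tmul (bar s) (bar t)) =
  K (wdeg s * wdeg u) *: bcat [:: brl v s] (star u t).
Proof.
rewrite /eatT lift_gen; last exact: eatT_bilinear.
by rewrite lift_bar /=; [rewrite mul_bar | exact: eatT_multilinear].
Qed.

Lemma eatT_tmul v u e (x y : T) : homog e x -> eatT v u (tmul x y) =
  K (e * wdeg u) *: bcat [:: ltr (tlift (fun w => br v w (tag v + e)) x)] (mul (bar u) y).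
Proof.
rewrite /eatT lift_gen; last exact: eatT_bilinear.
rewrite /=.
apply: (homog_ext (F := tlift (fun w => K (wdeg w * wdeg u) *: bcat [:: brl v w] (mul (bar u) y)))
  (G := fun x => K (e * wdeg u) *: bcat [:: ltr (tlift (fun w => br v w (tag v + e)) x)] (mul (bar u) y))).
- exact/linear_lift/eatT_multilinear.
- apply: linear_scale.
  apply: (linear_comp (f := fun z : V (tag v + e) => bcat [:: ltr z] (mul (bar u) y))).
    exact: (bcat_multilinear _ [::] [::]).
  exact: (linear_lift (br_linr v (tag v + e))).
move=> w <-; rewrite lift_bar; last exact: eatT_multilinear.
by rewrite lift_bar //; exact: br_linr.
Qed.

Lemma eat_eatT v u x : eat v u x = eatT v u (coproduct (bar x)).
Proof.
rewrite coproduct_cut (cut_linear _ _ (@eatT_linear v u)).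
by apply: cut_ext => s t _; rewrite eatT_bar.
Qed.

Lemma mul_cons_bcat v u b z : mul (bar (v :: u)) (bcat [:: b] z) =
  eatT v u (coproduct (bcat [:: b] z)) +
  K (tag b * wdeg (v :: u)) *: bcat [:: b] (mul (bar (v :: u)) z).
Proof.
move: z; apply: T_ext.
- exact: (linear_comp (mul_linr _) (bcat_linear _)).
- apply: linear_add; last exact: (linear_scale _ (linear_comp (bcat_linear _) (mul_linr _))).
  exact: (linear_comp (@eatT_linear v u) (linear_comp (@coproduct_linear k V) (bcat_linear _))).
by move=> w; rewrite bcat_bar !mul_bar star_cons_cons eat_eatT.
Qed.

Lemma mul_bcat_cons a e z b (y : word V) : homog e z ->
  mul (bcat [:: a] z) (bar (b :: y)) =
  cut (fun s t => K (wdeg s * e) *: bcat [:: brl a s] (mul z (bar t))) (b :: y) +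
  K (tag b * (tag a + e)) *: bcat [:: b] (mul (bcat [:: a] z) (bar y)).
Proof.
apply: (homog_ext (F := fun z => mul (bcat [:: a] z) (bar (b :: y)))
  (G := fun z => cut (fun s t => K (wdeg s * e) *: bcat [:: brl a s] (mul z (bar t))) (b :: y) +
  K (tag b * (tag a + e)) *: bcat [:: b] (mul (bcat [:: a] z) (bar y)))).
- exact: (linear_comp (mul_linl _) (bcat_linear _)).
- apply: linear_add.
    by apply: linear_cut => s t; exact/linear_scale/(linear_comp (bcat_linear _))/mul_linl.
  apply/linear_scale/(linear_comp (bcat_linear _))/(linear_comp (mul_linl _)); exact: bcat_linear.
move=> w <-; rewrite !bcat_bar !mul_bar star_cons_cons wdeg_cons; congr (_ + _).
by apply: cut_ext => s t _; rewrite mul_bar.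
Qed.

Hypothesis br_rel : forall a x y j,
  tlift (fun z => br a z j) (star x y) = br (brl a x) y j.

Lemma mul_cons_eat v u a x (y : word V) : mul (bar (v :: u)) (eat a x y) =
  eatT v u (coproduct (eat a x y)) +
  cut (fun s t => K (wdeg s * wdeg x + (tag a + wdeg s) * wdeg (v :: u)) *:
      bcat [:: brl a s] (mul (bar (v :: u)) (star x t))) y.
Proof.
rewrite [in LHS]/eat (cut_linear _ _ (mul_linr _)).
rewrite (cut_linear _ _ (@coproduct_linear k V)) (cut_linear _ _ (@eatT_linear v u)) -cutD.
apply: cut_ext => s t _; rewrite (linfunZ (mul_linr _)) mul_cons_bcat scalerDr scale_koszul.
by rewrite (linfunZ (@coproduct_linear k V)) (linfunZ (@eatT_linear v u)).
Qed.

Lemma mul_eat_cons v u x b (y : word V) : mul (eat v u x) (bar (b :: y)) =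
  cut (fun s t => cut (fun s' t' => K (wdeg s * wdeg u + wdeg s' * (wdeg u + wdeg t)) *:
    bcat [:: brl (brl v s) s'] (mul (star u t) (bar t'))) (b :: y)) x +
  K (tag b * (tag v + wdeg u + wdeg x)) *: bcat [:: b] (mul (eat v u x) (bar y)).
Proof.
rewrite [in LHS]/eat (cut_linear _ _ (mul_linl _)).
rewrite [in X in _ = _ + _ *: bcat _ X]/eat (cut_linear _ _ (mul_linl _)).
rewrite (cut_linear _ _ (bcat_linear _)) -cutZ -cutD.
apply: cut_ext => s t <-; rewrite (linfunZ (mul_linl _)).
rewrite (mul_bcat_cons _ _ _ (star_homog u t)) scalerDr; congr (_ + _).
  by rewrite -cutZ; apply: cut_ext => s' t' _; rewrite scale_koszul.
rewrite (linfunZ (mul_linl _)) (linfunZ (bcat_linear _)) !scale_koszul; congr (K _ *: _).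
by rewrite wdeg_cat /=; ring.
Qed.

(** v swallows the left factor of the coproduct of [star x y]. That coproduct is multiplicative, so
    the factor is a product [star s s'], and [br_rel] turns v applied to it into (v{s}){s'}. *)
Lemma eatT_star v u x y : (forall x y, mul (bar u) (star x y) = mul (star u x) (bar y)) ->
  eatT v u (coproduct (star x y)) =
  cut (fun s t => cut (fun s' t' => K (wdeg s * wdeg u + wdeg s' * (wdeg u + wdeg t)) *:
    bcat [:: brl (brl v s) s'] (mul (star u t) (bar t'))) y) x.
Proof.
move=> IH; rewrite coproduct_star (cut_linear _ _ (@eatT_linear v u)).
apply: cut_ext => s t _; rewrite (cut_linear _ _ (@eatT_linear v u)).
apply: cut_ext => s' t' _; rewrite (linfunZ (@eatT_linear v u)).
rewrite (eatT_tmul _ _ _ (star_homog s s')) br_rel IH addrA scale_koszul.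
by congr (K _ *: _); ring.
Qed.

(** Both sides are expanded by the first letter of the output, which stems from v, a or b. The three
    cases are settled by [eatT_star] (with the induction on u), the induction on x and the induction
    on y. *)
Lemma star_assoc u x y : mul (bar u) (star x y) = mul (star u x) (bar y).
Proof.
elim: u x y => [|v u IHu] x y; first by rewrite mul1x mul_bar.
elim: x y => [|a x IHx] y; first by rewrite star_nil mul_bar.
elim: y => [|b y IHy]; first by rewrite star_nil mulx1 mul_bar.
rewrite {1}[star (a :: x) (b :: y)]star_cons_cons (linfunD (mul_linr _)) mul_cons_eat.
rewrite star_cons_cons [in RHS](linfunD (mul_linl _)) mul_eat_cons -eatT_star //.
rewrite star_cons_cons (linfunD (@coproduct_linear k V)) (linfunD (@eatT_linear v u)).
rewrite (linfunZ (mul_linr _)) mul_cons_bcat.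
rewrite (linfunZ (@coproduct_linear k V)) (linfunZ (@eatT_linear v u)).
rewrite (linfunZ (mul_linl _)) (mul_bcat_cons _ _ _ (star_homog (v :: u) x)).
rewrite !scalerDr !scale_koszul IHy star_cons_cons (linfunD (mul_linl _)).
rewrite (linfunZ (mul_linl _)) (linfunD (bcat_linear _)) (linfunZ (bcat_linear _)) scalerDr scale_koszul.
rewrite -!addrA; congr (_ + _); rewrite [LHS]addrCA; congr (_ + _).
rewrite [LHS]addrCA -cutZ; congr (_ + (_ + _)).
- by rewrite !wdeg_cons; congr (K _ *: _); ring.
- by apply: cut_ext => s t _; rewrite scale_koszul IHx; congr (K _ *: _); ring.
- by congr (K _ *: _); rewrite !wdeg_cons; ring.
Qed.

Lemma mulA : associative (mul).
Proof.
move=> x y z; move: x.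
apply: (T_ext (F := mul^~ (mul y z)) (G := fun x => mul (mul x y) z)).
- exact: mul_linl.
- exact: (linear_comp (mul_linl z) (mul_linl y)).
move=> u; move: y.
apply: (T_ext (F := fun y => mul (bar u) (mul y z)) (G := fun y => mul (mul (bar u) y) z)).
- exact: (linear_comp (mul_linr _) (mul_linl z)).
- exact: (linear_comp (mul_linl z) (mul_linr _)).
move=> x; move: z.
apply: (T_ext (F := fun z => mul (bar u) (mul (bar x) z)) (G := mul (mul (bar u) (bar x)))).
- exact: (linear_comp (mul_linr _) (mul_linr _)).
- exact: mul_linr.
by move=> y; rewrite !mul_bar star_assoc.
Qed.

End Star.

(** * Twisting by a Maurer-Cartan element of the brace algebra *)

Section Twist.
Variables (k : comPzRingType) (V : graded k).
Variable br : letter V -> word V -> forall j, V j.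
Hypothesis br_linr : forall a j, multilinear (fun w => br a w j).
Hypothesis br_linl : forall i w j, linear (fun x : V i => br (ltr x) w j).
Hypothesis br_nil : forall a j, br a [::] j = component j a.
Hypothesis br_rel : forall a x y j,
  lift (fun z => br a z j) (star br x y) = br (brl br a x) y j.
Variable m : V 1.
Hypothesis m_mc : forall j, br (ltr m) [:: ltr m] j = 0.
Notation T := (cotensor V).
Local Notation K := (koszul k).
Local Notation tlift := (@lift k (word V) (@multilinear k V) _).
Local Notation "x ** y" := (mul br x y) (at level 40, left associativity).
Local Notation M := (bar [:: ltr m]).

Let mull := mul_linl br_linr br_linl.
Let mulr := mul_linr br_linr br_linl.
Let mulA := mulA br_linr br_linl br_nil br_rel.
Let mul_bar := mul_bar br_linr br_linl.

(** The grading involution; with it the graded commutator with M is defined on inhomogeneous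
    elements too. *)
Definition sgn : T -> T := tlift (fun w : word V => K (wdeg w) *: bar w).
Lemma sgn_multilinear : multilinear (fun w : word V => K (wdeg w) *: bar w).
Proof. exact: (multilinear_wdeg K (@bar_multilinear k V)). Qed.
Lemma sgn_linear : linear sgn.
Proof. exact: (linear_lift sgn_multilinear). Qed.
Lemma sgn_bar w : sgn (bar w) = K (wdeg w) *: bar w.
Proof. exact: (lift_bar _ sgn_multilinear). Qed.
Lemma sgn_homog e x : homog e x -> sgn x = K e *: x.
Proof.
apply: (homog_ext (F := sgn) (G := fun x => K e *: x)).
- exact: sgn_linear.
- exact: (linear_scale _ (@linear_id k T)).
- by move=> w <-; rewrite sgn_bar.
Qed.
Lemma sgn_mul x y : sgn (x ** y) = sgn x ** sgn y.
Proof.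
move: x; apply: (T_ext (F := fun x => sgn (x ** y)) (G := fun x => sgn x ** sgn y)).
- exact: (linear_comp sgn_linear (mull y)).
- exact: (linear_comp (mull _) sgn_linear).
move=> u; move: y; apply: (T_ext (F := fun y => sgn (bar u ** y)) (G := fun y => sgn (bar u) ** sgn y)).
- exact: (linear_comp sgn_linear (mulr _)).
- exact: (linear_comp (mulr _) sgn_linear).
move=> w; rewrite !sgn_bar (linfunZ (mull _)) (linfunZ (mulr _)) mul_bar scale_koszul.
exact/sgn_homog/star_homog.
Qed.
Lemma koszul_sq d : K (d + d) = 1.
Proof. by rewrite /koszul -signr_odd (_ : odd `|d + d| = false) //; lia. Qed.
Lemma sgnK : involutive sgn.
Proof.
apply: (T_ext (F := fun x => sgn (sgn x)) (G := id)) => //.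
  exact: (linear_comp sgn_linear sgn_linear).
by move=> w; rewrite sgn_bar (linfunZ sgn_linear) sgn_bar scale_koszul koszul_sq scale1r.
Qed.
Lemma sgn_M : sgn M = - M.
Proof. by rewrite sgn_bar wdeg_ltr /koszul expr1 scaleN1r. Qed.
Lemma homog_M : homog 1 M.
Proof. by rewrite -{1}(wdeg_ltr m); exact: homog_bar. Qed.

Lemma star_single (a b : letter V) :
  star br [:: a] [:: b] = bar [:: a; b] + bar [:: brl br a [:: b]] + K (tag b * tag a) *: bar [:: b; a].
Proof.
rewrite star_cons_cons // star_cons_nil /eat cut_cons !cut_nil /=.
rewrite !wdeg_nil !mulr0 !scale1r !brl_nil // !bcat_bar /= wdeg_single; congr (_ + _).
Qed.

(** M is odd, so the two concatenations in its square cancel and only m{m} is left. *)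
Lemma mulMM : M ** M = 0.
Proof.
rewrite mul_bar star_single.
rewrite /brl m_mc (linfun0 (@bar_multilinear k V [::] [::] _)) addr0.
by rewrite /= /koszul mulr1 expr1 scaleN1r subrr.
Qed.

Definition diff (x : T) : T := M ** x - sgn x ** M.
Lemma diff_linear : linear diff.
Proof.
apply: linear_add; first exact: mulr.
apply: linear_opp; exact: (linear_comp (mull M) sgn_linear).
Qed.
Lemma diff_homog d x : homog d x -> homog (d + 1) (diff x).
Proof.
move=> h; apply: homogD; first by rewrite addrC; exact: mul_homog homog_M h.
rewrite -scaleN1r; apply/homogZ/mul_homog => //; last exact: homog_M.
by rewrite (sgn_homog h); exact: homogZ.
Qed.
Lemma diff_derivation d x y : homog d x -> diff (x ** y) = diff x ** y + K d *: (x ** diff y).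
Proof.
move=> h; rewrite /diff sgn_mul (sgn_homog h) (linfunD (mull y)) (linfunN (mull y)).
rewrite (linfunD (mulr x)) (linfunN (mulr x)) scalerDr scalerN.
rewrite !(linfunZ (mull _)) -!mulA addrA addrNK; congr (_ - _).
Qed.
Lemma diff_sq x : diff (diff x) = 0.
Proof.
rewrite /diff (linfunD (mulr _)) (linfunN (mulr _)) (linfunD sgn_linear) (linfunN sgn_linear).
rewrite !sgn_mul sgnK sgn_M (linfunN (mull _)) (linfunN (mulr x)) opprK.
rewrite (linfunD (mull _)) (linfunN (mull _)) !mulA mulMM -[x ** M ** M]mulA mulMM.
by rewrite (linfun0 (mull _)) (linfun0 (mulr _)) addr0 opprK sub0r addNr.
Qed.
Lemma diff_bar (w : word V) : diff (bar w) = star br [:: ltr m] w - K (wdeg w) *: star br w [:: ltr m].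
Proof. by rewrite /diff sgn_bar (linfunZ (mull _)) !mul_bar. Qed.

(** M is primitive and the product is a coalgebra map, so the commutator with M is a
    coderivation. *)
Lemma diff_coderivation (w : word V) : coproduct (diff (bar w)) =
    \sum_(i < (size w).+1)
      (tmul (diff (bar (take i w))) (bar (drop i w)) +
       K (wdeg (take i w)) *: tmul (bar (take i w)) (diff (bar (drop i w)))).
Proof.
have hc := @coproduct_linear k V.
have htl (y : T) : linear (fun x : T => tmul x y) := (tmul_bilinear T T).1 y.
have htr (x : T) : linear (fun y : T => tmul x y) := (tmul_bilinear T T).2 x.
rewrite -[RHS]/(cut (fun s t => tmul (diff (bar s)) (bar t) + K (wdeg s) *: tmul (bar s) (diff (bar t))) w).
rewrite diff_bar (linfunD hc) (linfunN hc) (linfunZ hc) !coproduct_star //.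
rewrite cut_cons cut_nil -cutZ -cutN -!cutD; apply: cut_ext => s t <-.
rewrite cut_cons cut_nil !diff_bar (linfunD (htl _)) (linfunN (htl _)) (linfunZ (htl _)).
rewrite (linfunD (htr _)) (linfunN (htr _)) (linfunZ (htr _)) !star_nil //.
rewrite [star br [::] s]/= [star br [::] t]/= wdeg_nil mul0r scale1r wdeg_ltr mul1r mulr0 scale1r.
rewrite mulr1 !scalerDr !scalerN scale_koszul opprD wdeg_cat !scale_koszul.
rewrite -[in K (_ + wdeg t + _)]addrA [K (_ + (_ + _))]koszulD koszul_sq mulr1.
by rewrite [X in X + _]addrC [X in _ + X = _]addrC addrACA.
Qed.

Lemma mul_coproduct (u v : word V) :
  coproduct (bar u ** bar v) =
    \sum_(i < (size u).+1) \sum_(j < (size v).+1)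
      K (wdeg (drop i u) * wdeg (take j v)) *:
      tmul (bar (take i u) ** bar (take j v)) (bar (drop i u) ** bar (drop j v)).
Proof.
rewrite mul_bar coproduct_star; apply: eq_bigr => i _; apply: eq_bigr => j _.
by rewrite !mul_bar.
Qed.

Definition twist : XiBinf V :=
  {| xmul_linearl := mull; xmul_linearr := mulr;
     xmul_deg := @mul_homog k V br br_linr br_linl; xmulA := mulA;
     xmul1x := @mul1x k V br br_linr br_linl; xmulx1 := @mulx1 k V br br_linr br_linl br_nil;
     xmul_coproduct := mul_coproduct;
     xmul_counit := @counit_mul k V br br_linr br_linl;
     xdiff_linear := diff_linear; xdiff_deg := diff_homog; xdiff_derivation := diff_derivation;
     xdiff_coderivation := diff_coderivation; xdiff_sq := diff_sq |}.

Lemma proj_star_single (a b : letter V) j : proj j (star br [:: a] [:: b]) = component j (brl br a [:: b]).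
Proof.
have hp := @proj_linear k V j.
by rewrite star_single !(linfunD hp) (linfunZ hp) !proj_bar /= scaler0 addr0 add0r.
Qed.
Lemma twist_b1 (a : letter V) j : binf_b twist [:: a] j =
  component j (brl br (ltr m) [:: a]) - K (tag a) *: component j (brl br a [:: ltr m]).
Proof.
have hp := @proj_linear k V j.
rewrite /binf_b /= diff_bar (linfunD hp) (linfunN hp) (linfunZ hp) !proj_star_single.
by rewrite wdeg_single.
Qed.
End Twist.

(** * The brace algebra of cochains with values in tensor powers *)

Section Cast.
Variables (k : comPzRingType) (I : eqType) (F : I -> lmodType k).
(** Transport along an equality of indices, made total by the value 0 when they differ; statements
    then need no equality proofs. *)
Definition tcast (i j : I) (x : F i) : F j := @untag _ (fun i => F i) (F j) 0 j id (Tagged (fun i => F i) x).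
Lemma tcast_id i (x : F i) : tcast i x = x.
Proof. by rewrite /tcast untagE. Qed.
Lemma tcast_neq i j (x : F i) : i != j -> tcast j x = 0.
Proof. by move=> h; rewrite /tcast untag_dflt. Qed.
Lemma tcast_linear i j : linear (@tcast i j).
Proof.
move=> a x y; case: (eqVneq i j) => [<-|h]; first by rewrite !tcast_id.
by rewrite !tcast_neq // scaler0 addr0.
Qed.
End Cast.

(** Equality of words of integers is decidable, so [tcast] back to t recovers the second component
    of a dependent pair. *)
Lemma tagged_inj (k : comPzRingType) (F : seq int -> lmodType k) t (f g : F t) : Tagged F f = Tagged F g -> f = g.
Proof.
move=> h; have := congr1 (fun a : {t & F t} => tcast (F := F) t (tagged a)) h.
by rewrite /= !tcast_id.
Qed.

Section Whiskers.
Variables (k : comPzRingType) (M : seq int -> seq int -> lmodType k).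
Variable lw : forall b s t, M s t -> M (b :: s) (b :: t).
Fixpoint lwhisks (J : seq int) s t (f : M s t) : M (J ++ s) (J ++ t) :=
  if J is b :: J' then lw b (lwhisks J' f) else f.
End Whiskers.

(* wm s t stands for Hom(P_s, P_t), with lw b = P^b (x) - and rw r = - (x) P_r. The
   associativity constraints are absorbed in rw, so that the laws hold strictly; where
   the words on both sides are equal but not convertible, the laws compare them as
   dependent pairs. *)
Record word_cat (k : comPzRingType) := {
  wm : seq int -> seq int -> lmodType k;
  wid : forall s, wm s s;
  wc : forall s t r, wm t r -> wm s t -> wm s r;
  wcA : forall s t r q (h : wm r q) (g : wm t r) (f : wm s t), wc h (wc g f) = wc (wc h g) f;
  wc1f : forall s t (f : wm s t), wc (wid t) f = f;
  wcf1 : forall s t (f : wm s t), wc f (wid s) = f;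
  wc_linl : forall s t r (f : wm s t), linear (fun g : wm t r => wc g f);
  wc_linr : forall s t r (g : wm t r), linear (fun f : wm s t => wc g f);
  lw : forall b s t, wm s t -> wm (b :: s) (b :: t);
  lw_linear : forall b s t, linear (@lw b s t);
  lw_id : forall b s, lw b (wid s) = wid (b :: s);
  lw_comp : forall b s t r (g : wm t r) (f : wm s t), lw b (wc g f) = wc (lw b g) (lw b f);
  rw : forall r s t, wm s t -> wm (s ++ r) (t ++ r);
  rw_linear : forall r s t, linear (@rw r s t);
  rw_id : forall r s, rw r (wid s) = wid (s ++ r);
  rw_comp : forall q s t r (g : wm t r) (f : wm s t), rw q (wc g f) = wc (rw q g) (rw q f);
  rw_lw : forall q b s t (f : wm s t), rw q (lw b f) = lw b (rw q f);
  rw_rw : forall a J t1 t2 (x : wm [:: a] J),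
    Tagged (wm (a :: t1 ++ t2)) (rw t2 (rw t1 x)) =
    Tagged (wm (a :: t1 ++ t2)) (rw (t1 ++ t2) x);
  rw_lwhisks : forall a J s t (x : wm [:: a] J) (f : wm s t),
    wc (rw t x) (lw a f) = wc (lwhisks lw J f) (rw s x);
  rw_nil : forall a J (x : wm [:: a] J), Tagged (wm [:: a]) (rw [::] x) = Tagged (wm [:: a]) x
}.
Arguments wm {_ _}.
Arguments wid {_ _}.
Arguments wc {_ _ _ _ _}.
Arguments lw {_ _} _ {_ _}.
Arguments rw {_ _} _ {_ _}.
Notation "g \w f" := (wc g f) (at level 40, left associativity).

(* Each P^b counts with its suspended degree. *)
Definition wt (t : seq int) : int := \sum_(b <- t) (b + 1).
Lemma wt_nil : wt [::] = 0. Proof. by rewrite /wt big_nil. Qed.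
Lemma wt_cons b t : wt (b :: t) = b + 1 + wt t.
Proof. by rewrite /wt big_cons. Qed.
Lemma wt_cat s t : wt (s ++ t) = wt s + wt t.
Proof. by rewrite /wt big_cat. Qed.

Section Act.
Variables (k : comPzRingType) (C : word_cat k).
Local Notation wm := (@wm k C).
Local Notation K := (koszul k).
Implicit Types (L : lmodType k) (s t r : seq int).

(** A product over t, so that an element may have components in infinitely many arities, which the
    limits taken later need. The arity 0 part in degree n is Hom(P^(-n), I). *)
Definition cochains : graded k := fun n => family_module (fun t => wm [:: wt t - n] t).
Notation V := (shift cochains).
Implicit Types (w : word V).

Definition src (j : int) (t : seq int) : int := wt t - (j + 1).
Definition ev (x : letter V) (t : seq int) : wm [:: src (tag x) t] t :=
  (tagged x : family_module (fun t => wm [:: wt t - (tag x + 1)] t)) t.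
(* The component P^a -> P_t of x, which is 0 unless the degrees match; written
   x`_[a, t] below. *)
Definition hat (x : letter V) (a : int) (t : seq int) : wm [:: a] t :=
  tcast (F := fun a => wm [:: a] t) a (ev x t).

Lemma hat_linear i a t : linear (fun x : V i => hat (ltr x) a t).
Proof.
by move=> c x y; exact: (@tcast_linear k int (fun a => wm [:: a] t)).
Qed.

Definition functional L := forall s t, wm s t -> L.
Definition flinear L (Psi : functional L) := forall s t, linear (Psi s t).

(* The sum of Psi over all morphisms P_s -> P_t that apply the letters of w, in
   order, to pairwise disjoint blocks of t: the head of t is either left untouched or
   belongs to the block J of the first letter. The source s varies with the blocks,
   hence a functional Psi rather than a morphism. *)
Fixpoint act L (w : word V) : seq int -> functional L -> L :=
  if w is x :: w' then
    fix acts (t : seq int) (Psi : functional L) : L :=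
      (if t is b :: t' then acts t' (fun s t th => Psi (b :: s) (b :: t) (lw b th)) else 0)
      + cut (fun J r => K (tag x * (wt r - wdeg w')) *:
          @act L w' r (fun s r' th => Psi (src (tag x) J :: s) (J ++ r')
            (rw r' (ev x J) \w lw _ th))) t
  else fun t Psi => Psi t t (wid t).

Definition eats L x w t (Psi : functional L) : L :=
  cut (fun J r => K (tag x * (wt r - wdeg w)) *:
          act w r (fun s r' th => Psi (src (tag x) J :: s) (J ++ r')
            (rw r' (ev x J) \w lw _ th))) t.

Lemma act_nil L t (Psi : functional L) : act [::] t Psi = Psi t t (wid t).
Proof. by []. Qed.
Lemma act_cons_nil L x w (Psi : functional L) : act (x :: w) [::] Psi = eats x w [::] Psi.
Proof. exact: add0r. Qed.
Lemma act_cons_cons L x w b t (Psi : functional L) : act (x :: w) (b :: t) Psi =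
  act (x :: w) t (fun s t th => Psi (b :: s) (b :: t) (lw b th)) + eats x w (b :: t) Psi.
Proof. by []. Qed.

(** A letter of degree d raises the weight from source to target by d, so only morphisms with the
    stated weights occur. In particular the exponent [wt r - wdeg w'] in [act] is the weight of the
    source of what lies to the right of the letter. *)
Lemma act_ext L w t (Psi Psi' : functional L) :
  (forall s (th : wm s t), wt s + wdeg w = wt t -> Psi s t th = Psi' s t th) ->
  act w t Psi = act w t Psi'.
Proof.
elim: w t Psi Psi' => [|x w IH] t Psi Psi' h.
  by rewrite !act_nil h // wdeg_nil addr0.
have he t0 (P P' : functional L) : (forall s (th : wm s t0), wt s + wdeg (x :: w) = wt t0 ->
    P s t0 th = P' s t0 th) -> eats x w t0 P = eats x w t0 P'.
  move=> hP; apply: cut_ext => J r E; congr (_ *: _); apply: IH => s th hs.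
  move: hP; rewrite -E => hP; apply: hP.
  by rewrite wt_cons wdeg_cons wt_cat -hs /src; ring.
elim: t Psi Psi' h => [|b t IHt] Psi Psi' h; first by rewrite !act_cons_nil; exact: he.
rewrite !act_cons_cons; congr (_ + _); last exact: he.
by apply: IHt => s th hs; apply: h; rewrite !wt_cons -hs; ring.
Qed.

Lemma act_linear L L' (g : L -> L') w t (Psi : functional L) : linear g ->
  g (act w t Psi) = act w t (fun s t th => g (Psi s t th)).
Proof.
move=> hg; elim: w t Psi => [//|x w IH] t Psi.
have he t0 (P : functional L) : g (eats x w t0 P) = eats x w t0 (fun s t th => g (P s t th)).
  rewrite /eats (cut_linear _ _ hg); apply: cut_ext => J r _.
  by rewrite (linfunZ hg) IH.
elim: t Psi => [|b t IHt] Psi; first by rewrite !act_cons_nil.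
by rewrite !act_cons_cons (linfunD hg) IHt he.
Qed.

Lemma act0 L w t : act w t (fun _ _ _ => 0 : L) = 0.
Proof. by rewrite -(act_linear (g := fun=> 0) w t (fun _ _ _ => 0 : L) (@linear_zero k L L)). Qed.

(** Linearity in the functional follows from naturality in L: the pair of P and Q is a single
    functional with values in L * L. *)
Lemma actP L w t a (P Q : functional L) :
  act w t (fun s t th => a *: P s t th + Q s t th) = a *: act w t P + act w t Q.
Proof.
pose R : functional (L * L)%type := fun s t th => (P s t th, Q s t th).
have h1 : linear (fun p : L * L => a *: p.1 + p.2).
  by move=> c x y /=; rewrite !scalerDr !scalerA mulrC -!addrA; congr (_ + _); rewrite addrCA.
have h2 : linear (fun p : L * L => p.1) by [].
have h3 : linear (fun p : L * L => p.2) by [].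
by rewrite -(act_linear w t R h1) (act_linear w t R h2) (act_linear w t R h3).
Qed.

Lemma actD L w t (P Q : functional L) :
  act w t (fun s t th => P s t th + Q s t th) = act w t P + act w t Q.
Proof.
rewrite -[act w t P]scale1r -actP; apply: act_ext => s th _; by rewrite scale1r.
Qed.

Lemma act_multilinear L t (Psi : functional L) : flinear Psi ->
  multilinear (fun w => act w t Psi).
Proof.
move=> hP u v i; elim: u t Psi hP => [|y u IH] t Psi hP.
  rewrite /=.
  have he t0 (P : functional L) : flinear P -> linear (fun x : V i => eats (ltr x) v t0 P).
    move=> hP'; apply: linear_cut => J r; apply: linear_scale.
    move=> a x x'; rewrite -actP; apply: act_ext => s th _.
    rewrite -(hP' _ _) -wc_linl; congr (P _ _ (_ \w _)); exact: rw_linear.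
  elim: t Psi hP => [|b t IHt] Psi hP; first exact: (linear_ext (fun=> act_cons_nil _ _ _) (he _ _ hP)).
  apply: (linear_ext (g := fun x : V i =>
      act (ltr x :: v) t (fun s t th => Psi (b :: s) (b :: t) (lw b th)) + eats (ltr x) v (b :: t) Psi)) => //.
  apply: linear_add; last exact: he.
  apply: IHt => s r; exact: (linear_comp (hP _ _) (@lw_linear _ _ _ _ _)).
rewrite /=.
have he t0 (P : functional L) : flinear P -> linear (fun x : V i => eats y (u ++ ltr x :: v) t0 P).
  move=> hP'; apply: (linear_ext (g := fun x : V i =>
     cut (fun J r => K (tag y * (wt r - (wdeg u + (i + wdeg v)))) *:
          act (u ++ ltr x :: v) r (fun s r' th => P (src (tag y) J :: s) (J ++ r')
            (rw r' (ev y J) \w lw _ th))) t0)).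
    by move=> x; rewrite /eats wdeg_cat wdeg_cons.
  apply: linear_cut => J r; apply/linear_scale/IH => s q.
  exact: (linear_comp (hP' _ _) (linear_comp (wc_linr _) (@lw_linear _ _ _ _ _))).
elim: t Psi hP => [|b t IHt] Psi hP; first exact: (linear_ext (fun=> act_cons_nil _ _ _) (he _ _ hP)).
apply: (linear_ext (g := fun x : V i =>
    act (y :: u ++ ltr x :: v) t (fun s t th => Psi (b :: s) (b :: t) (lw b th)) +
    eats y (u ++ ltr x :: v) (b :: t) Psi)) => //.
apply: linear_add; last exact: he.
apply: IHt => s r; exact: (linear_comp (hP _ _) (@lw_linear _ _ _ _ _)).
Qed.
End Act.

(** * Cutting the source of the action of a word *)

Section Split.
Variables (k : comPzRingType) (C : word_cat k).
Local Notation wm := (@wm k C).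
Local Notation K := (koszul k).
Local Notation V := (shift (cochains C)).
Implicit Types (L : lmodType k) (s t r : seq int).
Implicit Types (w : word V).

Lemma lwhisks_id J s : lwhisks (@lw k C) J (wid s) = wid (J ++ s).
Proof. by elim: J => //= b J ->; rewrite lw_id. Qed.

Definition tens s1 t1 s2 t2 (f1 : wm s1 t1) (f2 : wm s2 t2) : wm (s1 ++ s2) (t1 ++ t2) :=
  rw t2 f1 \w lwhisks (@lw k C) s1 f2.

Lemma tens_id s t : tens (wid s) (wid t) = wid (s ++ t).
Proof. by rewrite /tens lwhisks_id rw_id wc1f. Qed.
Lemma tens_nil s t (f : wm s t) : tens (wid [::]) f = f.
Proof. by rewrite /tens rw_id wc1f. Qed.
Lemma tens_lw b s1 t1 s2 t2 (f1 : wm s1 t1) (f2 : wm s2 t2) :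
  tens (lw b f1) f2 = lw b (tens f1 f2).
Proof. by rewrite /tens rw_lw lw_comp. Qed.

Lemma actZ L w t a (P : functional C L) :
  act w t (fun s t th => a *: P s t th) = a *: act w t P.
Proof. by rewrite -(act_linear w t P (linear_scale a (@linear_id k L))). Qed.

Lemma functional_tag L (P : functional C L) s t t' (f : wm s t) (f' : wm s t') :
  Tagged (wm s) f = Tagged (wm s) f' -> P s t f = P s t' f'.
Proof. by move=> h; exact: (congr1 (fun a : {t & wm s t} => P s (tag a) (tagged a)) h). Qed.

Lemma tagged_wc s r t t' (h : wm s t) (h' : wm s t') (f : wm r s) :
  Tagged (wm s) h = Tagged (wm s) h' -> Tagged (wm r) (h \w f) = Tagged (wm r) (h' \w f).
Proof. by move=> e; exact: (congr1 (fun a : {t & wm s t} => Tagged (wm r) (tagged a \w f)) e). Qed.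

Definition act2 L x1 t1 x2 t2 (G : seq int -> seq int -> functional C L) : L :=
  act x1 t1 (fun s1 t1' th1 => act x2 t2 (fun s2 t2' th2 =>
    G s1 s2 (s1 ++ s2) (t1' ++ t2') (tens th1 th2))).

Section Eat.
Variables (y : letter V) (x : word V).
Definition split_at L (t : seq int) (G : seq int -> seq int -> functional C L) : Prop :=
  act x t (fun s t th => cut (fun s1 s2 => G s1 s2 s t th) s) =
  cut (fun t1 t2 => cut (fun x1 x2 => K (wdeg x1 * (wt t2 - wdeg x2)) *:
     act2 x1 t1 x2 t2 G) x) t.

Definition eats2 L (G : seq int -> seq int -> functional C L) t1 t2 : L :=
  cut (fun x1 x2 => K ((tag y + wdeg x1) * (wt t2 - wdeg x2)) *:
    eats y x1 t1 (fun s1 t1' th1 => act x2 t2 (fun s2 t2' th2 =>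
      G s1 s2 (s1 ++ s2) (t1' ++ t2') (tens th1 th2)))) x.

(** The source starts with the source of the block of y. The cut in front of it is the first
    summand; every other cut leaves y on the left, and coassociativity regroups the cuts of t. *)
Lemma eats_split L : (forall t G, @split_at L t G) -> forall t (G : seq int -> seq int -> functional C L),
  eats y x t (fun s t th => cut (fun s1 s2 => G s1 s2 s t th) s) =
  eats y x t (fun s t th => G [::] s s t th) + cut (eats2 G) t.
Proof.
move=> IH t G; rewrite {1}/eats.
under cut_ext => J r _.
  rewrite (act_ext (Psi' := fun s r' th =>
     G [::] (src (tag y) J :: s) (src (tag y) J :: s) (J ++ r') (rw r' (ev y J) \w lw (src (tag y) J) th) +
     cut (fun s1 s2 => G (src (tag y) J :: s1) s2 (src (tag y) J :: s) (J ++ r')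
        (rw r' (ev y J) \w lw (src (tag y) J) th)) s)); last by move=> s th _; rewrite cut_cons.
  rewrite actD scalerDr.
  rewrite (IH r (fun s1 s2 s r' th => G (src (tag y) J :: s1) s2 (src (tag y) J :: s) (J ++ r')
        (rw r' (ev y J) \w lw (src (tag y) J) th))) -cutZ.
  over.
rewrite cutD; congr (_ + _).
pose F J t1 t2 := cut (fun x1 x2 => K (tag y * (wt t1 + wt t2 - wdeg x) + wdeg x1 * (wt t2 - wdeg x2)) *:
  act2 x1 t1 x2 t2 (fun s1 s2 s r' th => G (src (tag y) J :: s1) s2 (src (tag y) J :: s) (J ++ r')
        (rw r' (ev y J) \w lw (src (tag y) J) th))) x.
transitivity (cut (fun J r => cut (fun t1 t2 => F J t1 t2) r) t).
  apply: cut_ext => J r _; apply: cut_ext => t1 t2 <-; rewrite -cutZ; apply: cut_ext => x1 x2 _.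
  by rewrite scale_koszul wt_cat.
rewrite cut_cut; apply: cut_ext => r t2 _.
rewrite /F; cbv beta; rewrite [LHS]cut_exchange /eats2; apply: cut_ext => x1 x2 hx; rewrite /eats -cutZ.
apply: cut_ext => J t1 _; rewrite scale_koszul; congr (K _ *: _); first by rewrite -hx wdeg_cat; ring.
apply: act_ext => s1 th1 _; apply: act_ext => s2 th2 _.
(* The two targets are equal words that differ in the bracketing of the concatenations, hence the
   comparison as dependent pairs. *)
apply: functional_tag; rewrite {2}/tens rw_comp -wcA rw_lw /= -lw_comp.
by apply: tagged_wc; rewrite rw_rw.
Qed.
End Eat.

(** Each letter of the source is an untouched letter of t or the source of one block. A cut of the
    source hence cuts the target and the word x, and the morphism becomes a tensor product; the sign
    moves x1 past the source of the second factor. *)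
Lemma act_split L x t (G : seq int -> seq int -> functional C L) :
  act x t (fun s t th => cut (fun s1 s2 => G s1 s2 s t th) s) =
  cut (fun t1 t2 => cut (fun x1 x2 => K (wdeg x1 * (wt t2 - wdeg x2)) *:
     act2 x1 t1 x2 t2 G) x) t.
Proof.
elim: x t G => [|y x IHx] t G.
  rewrite act_nil; apply: cut_ext => t1 t2 <-; rewrite cut_nil wdeg_nil mul0r scale1r.
  by rewrite /act2 !act_nil tens_id.
pose E0 (G : seq int -> seq int -> functional C L) t1 t2 : L := act (y :: x) t2 (fun s2 t2' th2 =>
   G t1 s2 (t1 ++ s2) (t1 ++ t2') (tens (wid t1) th2)).
pose Rest (G : seq int -> seq int -> functional C L) t1 t2 : L := cut (fun x1 x2 => K ((tag y + wdeg x1) * (wt t2 - wdeg x2)) *: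
     act2 (y :: x1) t1 x2 t2 G) x.
have hR G' t' : cut (fun t1 t2 => cut (fun x1 x2 => K (wdeg x1 * (wt t2 - wdeg x2)) *:
     act2 x1 t1 x2 t2 G') (y :: x)) t' = cut (E0 G') t' + cut (Rest G') t'.
  rewrite -cutD; apply: cut_ext => t1 t2 _.
  rewrite cut_cons wdeg_nil mul0r scale1r; congr (_ + _).
  by apply: cut_ext => x1 x2 _; rewrite wdeg_cons.
elim: t G => [|b t IHt] G.
  rewrite act_cons_nil (eats_split y IHx) hR !cut_nil; congr (_ + _).
    rewrite /E0 act_cons_nil; congr (eats _ _ _ _).
    by do 3! (apply: functional_extensionality_dep => ?); rewrite tens_nil.
  by apply: cut_ext => x1 x2 _; rewrite /act2 act_cons_nil.
rewrite act_cons_cons (eats_split y IHx) hR [cut (E0 G) _]cut_cons.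
rewrite (act_ext (Psi' := fun s t th => G [::] (b :: s) (b :: s) (b :: t) (lw b th) +
  cut (fun s1 s2 => G (b :: s1) s2 (b :: s) (b :: t) (lw b th)) s)); last first.
  by move=> s th _; rewrite cut_cons.
rewrite actD (IHt (fun s1 s2 s t th => G (b :: s1) s2 (b :: s) (b :: t) (lw b th))) hR.
have -> : E0 G [::] (b :: t) =
    act (y :: x) t (fun s t th => G [::] (b :: s) (b :: s) (b :: t) (lw b th)) +
    eats y x (b :: t) (fun s t th => G [::] s s t th).
  have e s t' (th : wm s t') : G [::] s s t' (tens (wid [::]) th) = G [::] s s t' th.
    by rewrite tens_nil.
  rewrite -act_cons_cons; apply: act_ext => s th _; exact: e.
rewrite addrACA -!addrA; congr (_ + (_ + (_ + _))).
  apply: cut_ext => t1 t2 _; apply: act_ext => s th _.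
  by rewrite -tens_lw lw_id.
rewrite [in RHS]cut_cons [in LHS]cut_cons addrCA; congr (_ + _).
  by apply: cut_ext => x1 x2 _; rewrite /act2 act_cons_nil.
rewrite -cutD; apply: cut_ext => t1 t2 _; rewrite -cutD; apply: cut_ext => x1 x2 _.
rewrite -scalerDr; congr (_ *: _); rewrite /act2 act_cons_cons; congr (_ + _).
apply: act_ext => s1 th1 _; apply: act_ext => s2 th2 _.
by rewrite tens_lw.
Qed.
End Split.

(** * The brace relation, from the multiplicativity of the action *)

Section Brace.
Variables (k : comPzRingType) (C : word_cat k).
Local Notation wm := (@wm k C).
Local Notation K := (koszul k).
Local Notation V := (shift (cochains C)).
Local Notation T := (cotensor V).
Implicit Types (L : lmodType k) (s t r : seq int).
Implicit Types (w : word V) (v : letter V).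

(** A functional must accept every target word; [wcast] brings it back to the expected one and is
    the identity on the terms that occur in [act]. *)
Definition wcast s t t' (f : wm s t) : wm s t' := tcast (F := wm s) t' f.
Lemma wcast_id s t (f : wm s t) : wcast t f = f.
Proof. exact: tcast_id. Qed.
Lemma wcast_neq s t t' (f : wm s t) : t != t' -> wcast t' f = 0.
Proof. exact: tcast_neq. Qed.
Lemma wcast_linear s t t' : linear (@wcast s t t').
Proof. exact: tcast_linear. Qed.
Lemma wcast_wc s t t' r (g : wm t r) (f : wm s t) : wcast t' (g \w f) = wcast t' g \w f.
Proof.
case: (eqVneq r t') => [<-|h]; first by rewrite !wcast_id.
by rewrite !wcast_neq // (linfun0 (wc_linl f)).
Qed.
Lemma wcast_lw b s t t' (f : wm s t) : wcast (b :: t') (lw b f) = lw b (wcast t' f).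
Proof.
case: (eqVneq t t') => [<-|h]; first by rewrite !wcast_id.
rewrite !wcast_neq ?(linfun0 (@lw_linear _ _ _ _ _)) //.
by apply: contra h => /eqP [->].
Qed.
Definition wcc s t s' r (g : wm s t) (f : wm r s') : wm r t := g \w wcast s f.
Lemma wcc_id s t r (g : wm s t) (f : wm r s) : wcc g f = g \w f.
Proof. by rewrite /wcc wcast_id. Qed.
Lemma wcc_neq s t s' r (g : wm s t) (f : wm r s') : s' != s -> wcc g f = 0.
Proof. by move=> h; rewrite /wcc wcast_neq // (linfun0 (wc_linr _)). Qed.
Lemma wcc_lw b s t s' r (g : wm s t) (f : wm r s') :
  wcc (lw b g) (lw b f) = lw b (wcc g f).
Proof. by rewrite /wcc wcast_lw lw_comp. Qed.

(** The interchange law for tensor products, in the form that allows words that do not match. *)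
Lemma wcc_tens a s1 t1 s2 t2 s2' r (f1 : wm s1 t1) (f2 : wm s2 t2) (x : wm [:: a] s1)
    (h : wm r s2') :
  wcc (tens f1 f2) (rw s2' x \w lw a h) = rw t2 (f1 \w x) \w lw a (wcc f2 h).
Proof.
case: (eqVneq s2' s2) => [e|ne]; last first.
  rewrite !wcc_neq //; last by rewrite eqseq_cat // eqxx.
  by rewrite (linfun0 (@lw_linear _ _ _ _ _)) (linfun0 (wc_linr _)).
case: s2 / e f2 => f2; rewrite !wcc_id /tens rw_comp lw_comp -!wcA; congr (_ \w _).
by rewrite !wcA rw_lwhisks.
Qed.

Definition br v w (j : int) : V j :=
  (fun t => act w t (fun s t' th => wcast t (th \w hat v (src j t) s))) : family_module _.

Lemma brE v w j t : (br v w j : family_module _) t =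
  act w t (fun s t' th => wcast t (th \w hat v (src j t) s)).
Proof. by []. Qed.

Lemma br_functional v a t : flinear (fun s t' (th : wm s t') => wcast t (th \w hat v a s)).
Proof. move=> s t'; exact: (linear_comp (@wcast_linear _ _ _) (wc_linl _)). Qed.

Lemma family_linear (I : Type) (M : I -> lmodType k) L (f : L -> family_module M) :
  (forall i, linear (fun x => f x i)) -> linear f.
Proof. by move=> h a x y; apply: functional_extensionality_dep => i; exact: h. Qed.

Lemma br_linr v j : multilinear (fun w => br v w j).
Proof.
by move=> u t i; apply: family_linear => r; exact: (act_multilinear r (@br_functional v (src j r) r) u t).
Qed.
Lemma br_linl i w j : linear (fun x : V i => br (ltr x) w j).
Proof.
apply: family_linear => t a x y; rewrite !brE -actP; apply: act_ext => s th _.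
by rewrite hat_linear wc_linr wcast_linear.
Qed.
Lemma hatE v t : hat v (src (tag v) t) t = ev v t.
Proof. exact: (@tcast_id k int (fun a => wm [:: a] t)). Qed.
Lemma hat_neq v t a : a != src (tag v) t -> hat v a t = 0.
Proof. by move=> h; apply: (@tcast_neq k int (fun a => wm [:: a] t)); rewrite eq_sym. Qed.

Lemma ev_component v j t : ev (ltr (component j v)) t = hat v (src j t) t.
Proof.
case: v => i x; case: (eqVneq i j) => [<-|h].
  by rewrite hatE component_ltr.
rewrite hat_neq; last by rewrite /src; apply: contra h => /eqP; rewrite /=; lia.
by rewrite component_neq.
Qed.
Lemma br_nil v j : br v [::] j = component j v.
Proof.
apply: functional_extensionality_dep => t; rewrite brE act_nil wcast_id wc1f.
by rewrite -ev_component.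
Qed.

Local Notation tlift := (@lift k (word V) (@multilinear k V) _).

Lemma eats_functional L y J (Psi : functional C L) : flinear Psi ->
  flinear (fun s r' (th : wm s r') => Psi (src (tag y) J :: s) (J ++ r')
            (rw r' (ev y J) \w lw (src (tag y) J) th)).
Proof.
move=> hP s r; exact: (linear_comp (hP _ _) (linear_comp (wc_linr _) (@lw_linear _ _ _ _ _))).
Qed.

Lemma eats_multilinear L y t (Psi : functional C L) : flinear Psi ->
  multilinear (fun w => eats y w t Psi).
Proof.
move=> hP u v i; apply: linear_cut => J r.
exact: (multilinear_wdeg (fun d => K (tag y * (wt r - d)))
  (act_multilinear r (eats_functional y J hP)) u v).
Qed.

Lemma lift_eats L y e z t (Psi : functional C L) : flinear Psi -> homog e z ->
  tlift (fun w => eats y w t Psi) z =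
  cut (fun J r => K (tag y * (wt r - e)) *: tlift (fun w => act w r
    (fun s r' th => Psi (src (tag y) J :: s) (J ++ r') (rw r' (ev y J) \w lw _ th))) z) t.
Proof.
move=> hP; have hm J r := act_multilinear r (eats_functional y J hP).
apply: (homog_ext (F := tlift (fun w => eats y w t Psi)) (G := fun z =>
  cut (fun J r => K (tag y * (wt r - e)) *: tlift (fun w => act w r
    (fun s r' th => Psi (src (tag y) J :: s) (J ++ r') (rw r' (ev y J) \w lw _ th))) z) t)).
- exact/linear_lift/eats_multilinear.
- apply: linear_cut => J r; apply: linear_scale; exact: (linear_lift (hm J r)).
move=> w <-; rewrite lift_bar; last exact: eats_multilinear.
by apply: cut_ext => J r _; rewrite (lift_bar _ (hm J r)).
Qed.

(** Multiplicativity of the action: the product of u and x acts as u followed by x, with u nearer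
    the source. *)
Definition lifted L u x t (P : functional C L) :=
    act x t (fun s t' th => act u s (fun r s' eta => P r t' (wcc th eta))) =
    tlift (fun z => act z t P) (star br u x).

(** v swallows a first piece of the source of the action of x. By [act_split], x is cut into x1,
    whose action on that piece forms the brace v{x1}, and x2, which the hypothesis on u handles. *)
Lemma eats_lift v u x L t (Psi : functional C L) : flinear Psi ->
  (forall x2 t (P : functional C L), flinear P -> lifted u x2 t P) ->
  act x t (fun s t' th => eats v u s (fun r s' eta => Psi r t' (wcc th eta))) =
  cut (fun x1 x2 => K (wdeg x1 * wdeg u) *:
    tlift (fun z => eats (brl br v x1) z t Psi) (star br u x2)) x.
Proof.
move=> hP IH.
rewrite (act_split x t (fun s1 s2 s t' th => K (tag v * (wt s2 - wdeg u)) *: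
  act u s2 (fun r s2' eta => Psi (src (tag v) s1 :: r) t'
    (wcc th (rw s2' (ev v s1) \w lw (src (tag v) s1) eta))))).
rewrite cut_exchange; apply: cut_ext => x1 x2 _.
rewrite (lift_eats _ _ hP (star_homog br u x2)) -cutZ.
apply: cut_ext => t1 t2 _; rewrite scale_koszul -IH; last exact: eats_functional.
(* Everything apart from the block of v, as a linear function of the morphism on that block. The sum
   over the actions of x1 can then be moved inside, where it is the brace. *)
pose H c t1' (z : wm [:: c] t1') : L := act x2 t2 (fun s2 t2' th2 => act u s2 (fun r s2' eta =>
  Psi (c :: r) (t1' ++ t2') (rw t2' z \w lw c (wcc th2 eta)))).
have hH c t1' : linear (@H c t1').
  move=> a z z'; rewrite /H -actP; apply: act_ext => s2 th2 _.
  rewrite -actP; apply: act_ext => r eta _.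
  by rewrite rw_linear wc_linl hP.
rewrite -/(H _ _ (ev (brl br v x1) t1)).
rewrite /act2 (act_ext (Psi' := fun s1 t1' th1 =>
    K (tag v * (wt t2 - wdeg x2 - wdeg u)) *: H (src (tag v) s1) t1' (th1 \w ev v s1))).
  rewrite actZ scale_koszul; congr (K _ *: _); first by rewrite /=; ring.
  rewrite [X in H _ _ X](_ : _ = act x1 t1 (fun s t' th => wcast t1 (th \w hat v (src (tag v + wdeg x1) t1) s))) //.
  rewrite (act_linear _ _ _ (hH _ _)); apply: act_ext => s th hs; rewrite wcast_id.
  rewrite (_ : src (tag v + wdeg x1) t1 = src (tag v) s) ?hatE //.
  by rewrite /src -hs; ring.
move=> s1 th1 _; rewrite /H -actZ; apply: act_ext => s2 th2 hs2; congr (K _ *: _).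
  by rewrite -hs2; ring.
by apply: act_ext => r eta _; rewrite wcc_tens.
Qed.

Definition keepT L t (Psi : functional C L) (z : T) : L :=
  if t is b :: t' then
    tlift (fun w => act w t' (fun s t th => Psi (b :: s) (b :: t) (lw b th))) z
  else 0.
Lemma lw_functional L b (Psi : functional C L) : flinear Psi ->
  flinear (fun s t (th : wm s t) => Psi (b :: s) (b :: t) (lw b th)).
Proof. move=> hP s t; exact: (linear_comp (hP _ _) (@lw_linear _ _ _ _ _)). Qed.
Lemma keepT_linear L t (Psi : functional C L) : flinear Psi -> linear (keepT t Psi).
Proof.
case: t => [|b t] hP; first exact: linear_zero.
exact: (linear_lift (act_multilinear t (lw_functional b hP))).
Qed.
Lemma lift_act_bcat L t (Psi : functional C L) a z : flinear Psi ->
  tlift (fun w => act w t Psi) (bcat [:: a] z) =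
  keepT t Psi (bcat [:: a] z) + tlift (fun w => eats a w t Psi) z.
Proof.
move=> hP; have hm := act_multilinear t hP.
move: z; apply: T_ext.
- exact: (linear_comp (linear_lift hm) (bcat_linear _)).
- apply: linear_add; first exact: (linear_comp (keepT_linear t hP) (bcat_linear _)).
  exact/linear_lift/eats_multilinear.
move=> w; rewrite !bcat_bar (lift_bar _ hm) lift_bar; last exact: eats_multilinear.
case: t {hm} => [|b t]; first by rewrite act_cons_nil add0r.
by rewrite act_cons_cons /keepT lift_bar //; exact: (act_multilinear t (lw_functional b hP)).
Qed.

(** The head of the intermediate word s is swallowed by v ([EV]) or kept ([KP]). A kept head is the
    source of the block of y ([step]) or the kept head of t (induction on t). The recursion of
    [star] has the same alternatives. *)
Lemma act_star L u x t (Psi : functional C L) : flinear Psi -> lifted u x t Psi.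
Proof.
elim: u x t Psi => [|v u IHu] x t Psi hP.
  rewrite /lifted lift_bar; last exact: act_multilinear.
  by apply: act_ext => s th _; rewrite act_nil wcc_id wcf1.
elim: x t Psi hP => [|y x IHx] t Psi hP.
  rewrite /lifted star_nil; last exact: br_nil.
  rewrite lift_bar; last exact: act_multilinear.
  by rewrite act_nil; apply: act_ext => s th _; rewrite wcc_id wc1f.
pose KP (P : functional C L) : functional C L := fun s t' =>
  if s is b :: s0 return wm s t' -> L then
    fun th => act (v :: u) s0 (fun r s' eta => P (b :: r) t' (wcc th (lw b eta)))
  else fun=> 0.
pose EV (P : functional C L) : functional C L := fun s t' th =>
  eats v u s (fun r s' eta => P r t' (wcc th eta)).
have split t0 (P : functional C L) : act (y :: x) t0 (fun s t' th =>
    act (v :: u) s (fun r s' eta => P r t' (wcc th eta))) =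
    act (y :: x) t0 (KP P) + act (y :: x) t0 (EV P).
  rewrite -actD; apply: act_ext => -[|b s] th _; first by rewrite act_cons_nil add0r.
  by rewrite act_cons_cons.
have step t0 (P : functional C L) : flinear P -> eats y x t0 (KP P) =
    K (tag y * wdeg (v :: u)) *: tlift (fun w => eats y w t0 P) (star br (v :: u) x).
  move=> h; rewrite (lift_eats _ _ h (star_homog br (v :: u) x)) -cutZ.
  apply: cut_ext => J r _; rewrite scale_koszul -IHx; last exact: eats_functional.
  congr (K _ *: _); first by rewrite /=; ring.
  apply: act_ext => s th _; rewrite /KP; apply: act_ext => q eta _.
  by rewrite -wcc_lw /wcc wcA.
have rhs t0 (P : functional C L) : flinear P ->
    tlift (fun w => act w t0 P) (star br (v :: u) (y :: x)) =
    keepT t0 P (star br (v :: u) (y :: x)) + (act (y :: x) t0 (EV P) + eats y x t0 (KP P)).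
  move=> h; have hm := linear_lift (act_multilinear t0 h); have hk := keepT_linear t0 h.
  rewrite step // /EV (eats_lift _ _ _ h) // star_cons_cons !(linfunD hm) !(linfunD hk).
  rewrite (linfunZ hm) (linfunZ hk) lift_act_bcat // scalerDr [RHS]addrACA; congr (_ + _).
  rewrite /eat (cut_linear _ _ hm) (cut_linear _ _ hk) -cutD; apply: cut_ext => x1 x2 _.
  by rewrite (linfunZ hm) (linfunZ hk) lift_act_bcat // scalerDr.
elim: t Psi hP => [|b t IHt] Psi hP.
  by rewrite /lifted split rhs // act_cons_nil /keepT add0r addrC.
rewrite /lifted split rhs // act_cons_cons -/(eats y x (b :: t) (KP Psi)) -addrA [_ + act _ _ (EV _)]addrC; congr (_ + _).
rewrite /keepT -(IHt _ (lw_functional b hP)) /KP; apply: act_ext => s th _.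
by apply: act_ext => r eta _; rewrite wcc_lw.
Qed.

Lemma hat_brl v x a t : hat (brl br v x) a t =
  act x t (fun s t' th => wcast t (th \w hat v a s)).
Proof.
case: (eqVneq a (src (tag (brl br v x)) t)) => [->|h]; first by rewrite hatE.
rewrite hat_neq // -[LHS](act0 _ x t); apply: act_ext => s th hs.
rewrite hat_neq ?(linfun0 (wc_linr _)) ?(linfun0 (@wcast_linear _ _ _)) //.
by apply: contra h => /eqP ->; rewrite /src -hs /=; apply/eqP; ring.
Qed.

Lemma br_rel v x y j : tlift (fun z => br v z j) (star br x y) = br (brl br v x) y j.
Proof.
apply: functional_extensionality_dep => t.
have hm := act_multilinear t (@br_functional v (src j t) t).
have -> z : (tlift (fun z => br v z j) z : family_module _) t =
    tlift (fun z => act z t (fun s t' th => wcast t (th \w hat v (src j t) s))) z.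
  move: z; apply: T_ext; last by move=> w; rewrite (lift_bar _ (br_linr v j)) (lift_bar _ hm).
    have h := linear_lift (br_linr v j).
    by move=> a z z'; rewrite h.
  exact: (linear_lift hm).
rewrite -(act_star x y t (@br_functional v (src j t) t)).
rewrite brE; apply: act_ext => s th _; rewrite wcast_id hat_brl (act_linear _ _ _ (wc_linr th)).
by apply: act_ext => r eta _; rewrite !wcast_id wcc_id wcA.
Qed.

Definition binf_of_mc (m : V 1) (m_mc : forall j, br (ltr m) [:: ltr m] j = 0) : binf_algebra k :=
  {| binf_mod := cochains C; binf_str := twist br_linr br_linl br_nil br_rel m_mc |}.
End Brace.

(** * Tensor powers of a resolution of the unit *)

Section Iso.
Variables (k : comPzRingType) (A : klinear_category k).
Implicit Types X Y Z : A.
Lemma iso_epic X Y (f : mor X Y) : is_iso f -> epic f.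
Proof.
move=> [g [_ e]] Z a b h; have := congr1 (fun c => c \c g) h.
by rewrite -!compA e !compf1.
Qed.
Lemma iso_monic X Y (f : mor X Y) : is_iso f -> monic f.
Proof.
move=> [g [e _]] Z a b h; have := congr1 (fun c => g \c c) h.
by rewrite !compA e !comp1f.
Qed.
Lemma iso_comp X Y Z (g : mor Y Z) (f : mor X Y) : is_iso g -> is_iso f -> is_iso (g \c f).
Proof.
move=> [g' [g1 g2]] [f' [f1 f2]]; exists (f' \c g'); split.
  by rewrite compA -[f' \c g' \c g]compA g1 compf1.
by rewrite compA -[g \c f \c f']compA f2 compf1.
Qed.
Definition inv_of X Y (f : mor X Y) (h : is_iso f) : mor Y X := projT1 (cid h).
Lemma inv_ofK X Y (f : mor X Y) (h : is_iso f) : inv_of h \c f = idm X.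
Proof. by rewrite /inv_of; case: (cid h) => g []. Qed.
Lemma inv_ofVK X Y (f : mor X Y) (h : is_iso f) : f \c inv_of h = idm Y.
Proof. by rewrite /inv_of; case: (cid h) => g []. Qed.
End Iso.

(** * Words of tensor powers and the coherence of the monoidal category *)

Section MonoidalWords.
Variables (k : comPzRingType) (A : klinear_monoidal_category k) (P : int -> A).
Implicit Types X Y Z : A.
Local Notation "X (x) Y" := (mon_tens X Y) (at level 45, right associativity).
Local Notation "f [x] g" := (mon_tensm f g) (at level 35, right associativity).
Local Notation I := (mon_unit A).
Local Notation "\1" := (idm _).
Local Notation al := (@mon_assoc k A).
Local Notation lu := (@mon_lunit k A).
Local Notation ru := (@mon_runit k A).

Lemma tensm_comp X X' X'' Y Y' Y'' (f' : mor X' X'') (f : mor X X')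
  (g' : mor Y' Y'') (g : mor Y Y') : (f' [x] g') \c (f [x] g) = (f' \c f) [x] (g' \c g).
Proof. by rewrite mon_tensm_comp. Qed.
Lemma tensm_compl X X' X'' Y (f' : mor X' X'') (f : mor X X') :
  (f' \c f) [x] idm Y = (f' [x] \1) \c (f [x] \1).
Proof. by rewrite tensm_comp compf1. Qed.
Lemma tensm_compr X Y Y' Y'' (f' : mor Y' Y'') (f : mor Y Y') :
  idm X [x] (f' \c f) = (\1 [x] f') \c (\1 [x] f).
Proof. by rewrite tensm_comp compf1. Qed.
Lemma tensm_swap X X' Y Y' (f : mor X X') (g : mor Y Y') :
  (f [x] \1) \c (\1 [x] g) = (\1 [x] g) \c (f [x] \1).
Proof. by rewrite !tensm_comp !comp1f !compf1. Qed.
Lemma iso_tensm X X' Y Y' (f : mor X X') (g : mor Y Y') : is_iso f -> is_iso g -> is_iso (f [x] g).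
Proof.
move=> [f' [f1 f2]] [g' [g1 g2]]; exists (f' [x] g').
by rewrite !tensm_comp f1 f2 g1 g2 !mon_tensm_id.
Qed.
Lemma iso_id X : is_iso (idm X).
Proof. by exists (idm _); rewrite comp1f. Qed.

(** Kelly's argument: I ⊗ - is faithful because the left unitor is natural and invertible, and after
    tensoring with I the identity follows from pentagon and triangle. *)
Lemma lunit_assoc X Y : lu (X (x) Y) \c al I X Y = lu X [x] \1.
Proof.
have h : idm I [x] (lu (X (x) Y) \c al I X Y) = \1 [x] (lu X [x] idm Y).
  apply: (@iso_epic _ _ _ _ (al I (I (x) X) Y \c (al I I X [x] \1))).
    by apply: iso_comp; [exact: mon_assoc_iso|apply: iso_tensm; [exact: mon_assoc_iso|exact: iso_id]].
  rewrite tensm_compr -!compA [_ \c (al I (I (x) X) Y \c _)]compA -mon_pentagon.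
  rewrite compA mon_triangle -(mon_tensm_id X Y) -mon_assoc_nat.
  by rewrite -mon_triangle tensm_compl compA mon_assoc_nat -!compA.
apply: (iso_epic (mon_lunit_iso _)).
by rewrite -!mon_lunit_nat h.
Qed.

Fixpoint tpow (t : seq int) : A := if t is b :: t' then P b (x) tpow t' else I.

Fixpoint kap (s r : seq int) : mor (tpow s (x) tpow r) (tpow (s ++ r)) :=
  if s is b :: s' then (\1 [x] kap s' r) \c al (P b) (tpow s') (tpow r) else lu (tpow r).

Lemma kap_iso s r : is_iso (kap s r).
Proof.
elim: s => [|b s IH]; first exact: mon_lunit_iso.
apply: iso_comp; last exact: mon_assoc_iso.
apply: iso_tensm => //; exact: iso_id.
Qed.

Definition twm (s t : seq int) : lmodType k := mor (tpow s) (tpow t).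
Definition tlw b s t (f : twm s t) : twm (b :: s) (b :: t) := idm (P b) [x] f.
Definition trw r s t (f : twm s t) : twm (s ++ r) (t ++ r) :=
  kap t r \c (f [x] \1) \c inv_of (kap_iso s r).

Lemma trwE r s t (f : twm s t) : trw r f \c kap s r = kap t r \c (f [x] \1).
Proof. by rewrite /trw -!compA inv_ofK compf1. Qed.

Lemma trw_unique r s t (f : twm s t) (g : twm (s ++ r) (t ++ r)) :
  g \c kap s r = kap t r \c (f [x] \1) -> trw r f = g.
Proof. by move=> h; apply: (iso_epic (kap_iso s r)); rewrite trwE h. Qed.

Lemma tlw_linear b s t : linear (@tlw b s t).
Proof. exact: mon_tensm_linearr. Qed.
Lemma tlw_id b s : tlw b (idm (tpow s)) = idm (tpow (b :: s)).
Proof. exact: mon_tensm_id. Qed.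
Lemma tlw_comp b s t r (g : twm t r) (f : twm s t) : tlw b (g \c f) = tlw b g \c tlw b f.
Proof. exact: tensm_compr. Qed.
Lemma trw_linear r s t : linear (@trw r s t).
Proof.
by move=> a f g; rewrite /trw mon_tensm_linearl (comp_linearr _) (comp_linearl _).
Qed.
Lemma trw_id r s : trw r (idm (tpow s)) = idm (tpow (s ++ r)).
Proof. by apply: trw_unique; rewrite comp1f mon_tensm_id compf1. Qed.
Lemma trw_comp q s t r (g : twm t r) (f : twm s t) : trw q (g \c f) = trw q g \c trw q f.
Proof. by apply: trw_unique; rewrite -compA trwE compA trwE -compA -tensm_compl. Qed.
Lemma trw_lw q b s t (f : twm s t) : trw q (tlw b f) = tlw b (trw q f).
Proof.
apply: trw_unique; rewrite /= compA -tensm_compr trwE tensm_compr.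
by rewrite -!compA mon_assoc_nat.
Qed.

Local Notation lwhs := (@lwhisks k twm tlw).
Lemma lwhisks_kap J s t (f : twm s t) : lwhs J f \c kap J s = kap J t \c (\1 [x] f).
Proof.
elim: J => [|b J IH] /=; first by rewrite mon_lunit_nat.
by rewrite compA -tensm_compr IH tensm_compr -!compA -mon_assoc_nat mon_tensm_id.
Qed.

Lemma trw_lwhisks a J s t (x : twm [:: a] J) (f : twm s t) :
  trw t x \c tlw a f = lwhs J f \c trw s x.
Proof.
apply: (iso_epic (kap_iso [:: a] s)); rewrite -[LHS]compA -[RHS]compA trwE.
rewrite (lwhisks_kap [:: a] f) compA trwE [RHS]compA lwhisks_kap -!compA.
by rewrite tensm_swap.
Qed.

(** The pentagon gives the induction step, and the compatibility of the left unitor with the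
    associator the base. *)
Lemma kap_kap s t1 t2 :
  Tagged (fun t => mor ((tpow s (x) tpow t1) (x) tpow t2) (tpow t))
    (kap (s ++ t1) t2 \c (kap s t1 [x] \1)) =
  Tagged (fun t => mor ((tpow s (x) tpow t1) (x) tpow t2) (tpow t))
    (kap s (t1 ++ t2) \c (\1 [x] kap t1 t2) \c al _ _ _).
Proof.
elim: s => [|b s IH] /=.
  by congr (Tagged _ _); rewrite mon_lunit_nat -compA lunit_assoc.
have -> : (idm (P b) [x] kap (s ++ t1) t2) \c al (P b) (tpow (s ++ t1)) (tpow t2)
   \c ((\1 [x] kap s t1 \c al (P b) (tpow s) (tpow t1)) [x] \1) =
   (\1 [x] (kap (s ++ t1) t2 \c (kap s t1 [x] \1))) \c (al _ _ _ \c (al _ _ _ [x] \1)).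
  by rewrite tensm_compl -compA [al _ _ _ \c (_ \c _)]compA mon_assoc_nat tensm_compr !compA.
have -> : (idm (P b) [x] kap s (t1 ++ t2)) \c al (P b) (tpow s) (tpow (t1 ++ t2))
   \c (\1 [x] kap t1 t2) \c al (P b (x) tpow s) (tpow t1) (tpow t2) =
   (\1 [x] (kap s (t1 ++ t2) \c (\1 [x] kap t1 t2) \c al _ _ _)) \c (al _ _ _ \c (al _ _ _ [x] \1)).
  rewrite -(mon_tensm_id (P b) (tpow s)) -!compA [al _ _ _ \c (_ \c _)]compA mon_assoc_nat.
  by rewrite -compA mon_pentagon !tensm_compr !compA.
exact: (congr1 (fun a : {t : seq int & mor ((tpow s (x) tpow t1) (x) tpow t2) (tpow t)} =>
  Tagged (fun t => mor (((P b (x) tpow s) (x) tpow t1) (x) tpow t2) (tpow t)) (i := b :: tag a)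
  (mon_tensm (idm (P b)) (tagged a) \c (al _ _ _ \c (al _ _ _ [x] \1)))) IH).
Qed.

Lemma trw_trw a J t1 t2 (x : twm [:: a] J) :
  Tagged (twm (a :: t1 ++ t2)) (trw t2 (trw t1 x)) =
  Tagged (twm (a :: t1 ++ t2)) (trw (t1 ++ t2) x).
Proof.
have h1 := tagged_inj (kap_kap [:: a] t1 t2).
have iso1 : is_iso (kap [:: a] (t1 ++ t2) \c (\1 [x] kap t1 t2) \c al (tpow [:: a]) (tpow t1) (tpow t2)).
  apply: iso_comp; last exact: mon_assoc_iso.
  apply: iso_comp; first exact: kap_iso.
  apply: iso_tensm; [exact: iso_id|exact: kap_iso].
set ka := (X in is_iso X) in iso1.
have e1 : trw t2 (trw t1 x) \c ka = kap (J ++ t1) t2 \c (kap J t1 [x] \1) \c ((x [x] \1) [x] \1).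
  rewrite /ka -h1.
  transitivity ((trw t2 (trw t1 x) \c kap (a :: t1) t2) \c (kap [:: a] t1 [x] \1)); first exact: compA.
  have E := congr1 (fun z => z \c (kap [:: a] t1 [x] idm (tpow t2))) (trwE t2 (trw t1 x)).
  apply: (etrans E); rewrite -compA -tensm_compl.
  by rewrite (trwE t1 x) tensm_compl compA.
have e2 : trw (t1 ++ t2) x \c ka = kap J (t1 ++ t2) \c (\1 [x] kap t1 t2) \c al _ _ _ \c ((x [x] \1) [x] \1).
  rewrite /ka [LHS]compA [X in X \c _ = _]compA (trwE (t1 ++ t2) x).
  by rewrite -!compA mon_assoc_nat mon_tensm_id [X in _ \c X]compA tensm_swap -compA.
have inv t (f : twm (a :: t1 ++ t2) t) : f \c ka \c inv_of iso1 = f.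
  by rewrite -compA inv_ofVK compf1.
rewrite -[trw t2 _]inv -[trw (t1 ++ t2) x]inv e1 e2.
exact: (congr1 (fun b : {t : seq int & mor ((tpow J (x) tpow t1) (x) tpow t2) (tpow t)} =>
  Tagged (twm (a :: t1 ++ t2)) (tagged b \c ((x [x] \1) [x] \1) \c inv_of iso1)) (kap_kap J t1 t2)).
Qed.

Lemma tensm_unit_inj X Y (f g : mor X Y) : f [x] idm I = g [x] \1 -> f = g.
Proof.
by move=> h; apply: (iso_epic (mon_runit_iso _)); rewrite -!mon_runit_nat h.
Qed.
Lemma runit_assoc X Y : (\1 [x] ru Y) \c al X Y I = ru (X (x) Y).
Proof.
apply/esym/tensm_unit_inj/(iso_monic (mon_assoc_iso _ _ _)).
rewrite -mon_triangle compA -(mon_tensm_id X Y) mon_assoc_nat.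
rewrite -compA mon_pentagon !compA -tensm_compr mon_triangle.
by rewrite -mon_assoc_nat -compA -tensm_compl.
Qed.
Lemma lunit_runit : lu I = ru I.
Proof.
have e : lu (I (x) I) = \1 [x] lu I.
  by apply: (iso_monic (mon_lunit_iso _)); rewrite mon_lunit_nat.
by apply: tensm_unit_inj; rewrite -mon_triangle -e lunit_assoc.
Qed.
Lemma kap_nil s : Tagged (fun t => mor (tpow s (x) I) (tpow t)) (kap s [::]) =
  Tagged (fun t => mor (tpow s (x) I) (tpow t)) (ru (tpow s)).
Proof.
elim: s => [|b s IH]; first by rewrite /= lunit_runit.
rewrite /= -runit_assoc.
exact: (congr1 (fun a : {t : seq int & mor (tpow s (x) I) (tpow t)} =>
  Tagged (fun t => mor ((P b (x) tpow s) (x) I) (tpow t)) (i := b :: tag a)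
  (mon_tensm (idm (P b)) (tagged a) \c al _ _ _)) IH).
Qed.

Lemma trw_nil a J (x : twm [:: a] J) : Tagged (twm [:: a]) (trw [::] x) = Tagged (twm [:: a]) x.
Proof.
have h : kap [:: a] [::] = ru (tpow [:: a]) := tagged_inj (kap_nil [:: a]).
have e : ru (tpow J) \c (x [x] \1) \c inv_of (kap_iso [:: a] [::]) = x.
  by rewrite mon_runit_nat -h -compA inv_ofVK compf1.
rewrite -[in RHS]e.
exact: (congr1 (fun b : {t : seq int & mor (tpow J (x) I) (tpow t)} =>
  Tagged (twm [:: a]) (tagged b \c _ \c inv_of (kap_iso [:: a] [::]))) (kap_nil J)).
Qed.

Definition tword_cat : word_cat k :=
  {| wcA := fun s t r q h g f => compA h g f;
     wc1f := fun s t f => comp1f f;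
     wcf1 := fun s t f => compf1 f;
     wc_linl := fun s t r f => comp_linearl f;
     wc_linr := fun s t r g => comp_linearr g;
     lw_linear := tlw_linear; lw_id := tlw_id; lw_comp := tlw_comp;
     rw_linear := trw_linear; rw_id := trw_id; rw_comp := trw_comp; rw_lw := trw_lw;
     rw_rw := trw_trw; rw_lwhisks := trw_lwhisks; rw_nil := trw_nil |}.
End MonoidalWords.

(** * Exact sequences in an abelian category and exact functors *)

Section Exactness.
Variables (k : comPzRingType) (C : klinear_category k).
Hypothesis ab : abelian C.
Implicit Types X Y Z : C.

Lemma comp0f X Y Z (f : mor X Y) : (0 : mor Y Z) \c f = 0.
Proof. exact: (linfun0 (comp_linearl f)). Qed.
Lemma compf0 X Y Z (g : mor Y Z) : g \c (0 : mor X Y) = 0.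
Proof. exact: (linfun0 (comp_linearr g)). Qed.

Lemma monic_of_kernel X Y (f : mor X Y) :
  (forall Z (z : mor Z X), f \c z = 0 -> z = 0) -> monic f.
Proof.
move=> h Z a b e; apply/eqP; rewrite -subr_eq0; apply/eqP/h.
by rewrite (linfunD (comp_linearr f)) (linfunN (comp_linearr f)) e subrr.
Qed.
Lemma kernel_monic X Y K (f : mor X Y) (i : mor K X) : is_kernel f i -> monic i.
Proof.
move=> [e h] Z a b E; have [|c [_ hc]] := h _ (i \c a); first by rewrite compA e comp0f.
by rewrite -(hc a) // -(hc b).
Qed.
Lemma cokernel_epic X Y Q (f : mor X Y) (q : mor Y Q) : is_cokernel f q -> epic q.
Proof.
move=> [e h] Z a b E; have [|c [_ hc]] := h _ (a \c q); first by rewrite -compA e compf0.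
by rewrite -(hc a) // -(hc b).
Qed.
Lemma epic_short_exact X Y (p : mor X Y) : epic p -> exists K (i : mor K X), short_exact i p.
Proof.
move=> hp; have [K [i hi]] := abelian_kernel ab p; exists K, i; split=> //.
have [Z [g [e hg]]] := abelian_epic ab hp; split; first by case: hi.
move=> Q h eh; apply: hg; case: hi => _ /(_ _ g e) [l [<- _]].
by rewrite compA eh comp0f.
Qed.
Lemma monic_short_exact X Y (i : mor X Y) : monic i -> exists Q (p : mor Y Q), short_exact i p.
Proof.
move=> hi; have [Q [p hp]] := abelian_cokernel ab i; exists Q, p; split=> //.
have [Z [g [e hg]]] := abelian_monic ab hi; split; first by case: hp.
move=> K h eh; apply: hg; case: hp => _ /(_ _ g e) [l [<- _]].
by rewrite -compA eh compf0.
Qed.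

(** For z with m∘z = 0 and cokernel q, the kernel of q∘e is killed by g, hence by e. As q∘e is the
    cokernel of its kernel, e factors as r∘q∘e; thus r∘q is the identity and z = r∘q∘z = 0. *)
Lemma coimage_monic Y Z K Q (g : mor Y Z) (i : mor K Y) (e : mor Y Q) (m : mor Q Z) :
  is_kernel g i -> is_cokernel i e -> m \c e = g -> monic m.
Proof.
move=> [gi hg] he em; apply: monic_of_kernel => W z mz.
have [Q' [q hq]] := abelian_cokernel ab z.
have [m' [m'q _]] : exists! m', m' \c q = m by apply: hq.2.
have qe : epic (q \c e).
  move=> T a b; rewrite !compA => /(cokernel_epic he); exact: (cokernel_epic hq).
have [L [l [[ql hl] [_ hqe]]]] := epic_short_exact qe.
have [|l' [il _]] := hg _ l; first by rewrite -em -m'q -!compA [q \c _]compA ql compf0.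
have [|r [rq _]] := hqe _ e; first by rewrite -il compA he.1 comp0f.
have {}rq : r \c q = idm Q by apply: (cokernel_epic he); rewrite -compA rq comp1f.
by rewrite -[z]comp1f -rq -compA hq.1 compf0.
Qed.

Section Functor.
Variables (F : C -> C) (Fm : forall X Y, mor X Y -> mor (F X) (F Y)).
Hypothesis F_comp : forall X Y Z (g : mor Y Z) (f : mor X Y), Fm (g \c f) = Fm g \c Fm f.
Hypothesis F_exact : exact_functor Fm.

(** [exact_functor] speaks of short exact sequences only, so the exact pair is broken into such
    sequences, using that the coimage of g embeds into Z. *)
Lemma exact_functor_exact_at X Y Z (f : mor X Y) (g : mor Y Z) :
  exact_at f g -> exact_at (Fm f) (Fm g).
Proof.
move=> [K [i [p [hi hp ->]]]]; exists (F K), (Fm i), (Fm p); split=> //.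
  have [Q [e he]] := monic_short_exact (kernel_monic hi).
  have [m [em _]] := he.2.2 _ g hi.1.
  have [Q2 [q /F_exact [/kernel_monic hm _]]] := monic_short_exact (coimage_monic hi he.2 em).
  have [[ei hk] _] := F_exact he; rewrite -em F_comp; split.
    by rewrite -compA ei compf0.
  move=> W w; rewrite -compA => ew; apply: hk; apply: hm.
  by rewrite ew compf0.
by have [L [l /F_exact [_ /cokernel_epic]]] := epic_short_exact hp.
Qed.
Lemma exact_functor_epic X Y (f : mor X Y) : epic f -> epic (Fm f).
Proof. by move=> hp; have [L [l /F_exact [_ /cokernel_epic]]] := epic_short_exact hp. Qed.
End Functor.

Lemma exact_iso X Y Z X' Y' Z' (f : mor X Y) (g : mor Y Z) (f' : mor X' Y') (g' : mor Y' Z')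
  (a : mor X' X) (b : mor Y' Y) (c : mor Z' Z) : is_iso a -> is_iso b -> is_iso c ->
  b \c f' = f \c a -> c \c g' = g \c b -> exact_at f g -> exact_at f' g'.
Proof.
move=> ia ib ic ef eg [K [i [p [[gi hi] hp fip]]]].
have eb := inv_ofVK ib.
exists K, (inv_of ib \c i), (p \c a); split.
- split; first by apply: (iso_monic ic); rewrite !compA eg -!compA [b \c _]compA eb comp1f gi compf0.
  move=> W w gw; have [|h [ih hu]] := hi _ (b \c w); first by rewrite compA -eg -compA gw compf0.
  exists h; split; first by rewrite -compA ih compA inv_ofK comp1f.
  by move=> h' E; apply: hu; rewrite -E !compA eb comp1f.
- by move=> W s t; rewrite !compA => /(iso_epic ia)/hp.
- by apply: (iso_monic ib); rewrite ef fip !compA eb comp1f.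
Qed.

Lemma projective_iso X Y (f : mor X Y) : is_iso f -> projective Y -> projective X.
Proof.
move=> hf hY U W e g he; have [h eh] := hY _ _ e (g \c inv_of hf) he.
by exists (h \c f); rewrite compA eh -compA inv_ofK compf1.
Qed.

Lemma exact_lift Q X Y Z (f : mor X Y) (g : mor Y Z) (h : mor Q Y) :
  projective Q -> exact_at f g -> g \c h = 0 -> exists h', h = f \c h'.
Proof.
move=> hQ [K [i [p [[_ hi] hp ->]]]] /hi [h1 [<- _]].
by have [h' <-] := hQ _ _ p h1 hp; exists h'; rewrite compA.
Qed.
End Exactness.

Section LiftingUnits.
Variables (k : comPzRingType) (C : word_cat k) (u : @wm k C [:: 0] [::]).
Fixpoint lwu (s : seq int) : @wm k C (s ++ [:: 0]) s :=
  if s is b :: s' then lw b (lwu s') else u.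
End LiftingUnits.

(* What is used of the resolution: maps from P^a lift along P_s (x) rd and P_s (x) ru,
   because P^a is projective and P_s (x) - is exact. *)
Record resolution_on (k : comPzRingType) (C : word_cat k) := {
  rd : forall a b, @wm k C [:: a] [:: b];
  ru : @wm k C [:: 0] [::];
  rd_deg : forall a b, b != a + 1 -> rd a b = 0;
  rdd : forall a b c, rd b c \w rd a b = 0;
  rud : forall a, ru \w rd a 0 = 0;
  r_source : forall a t (f : @wm k C [:: a] t), 0 < a -> f = 0;
  r_target : forall a s b (f : @wm k C [:: a] (s ++ [:: b])), 0 < b -> f = 0;
  r_exact : forall a s i (f : @wm k C [:: a] (s ++ [:: i + 1])), i + 1 < 0 ->
    lwhisks (@lw k C) s (rd (i + 1) (i + 1 + 1)) \w f = 0 ->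
    exists g : @wm k C [:: a] (s ++ [:: i]), f = lwhisks (@lw k C) s (rd i (i + 1)) \w g;
  r_exact0 : forall a s (f : @wm k C [:: a] (s ++ [:: 0])), lwu ru s \w f = 0 ->
    exists g : @wm k C [:: a] (s ++ [:: -1]), f = lwhisks (@lw k C) s (rd (-1) 0) \w g;
  r_epi : forall a s (f : @wm k C [:: a] s), exists g : @wm k C [:: a] (s ++ [:: 0]), f = lwu ru s \w g
}.

(** * Exactness of the tensor powers in the last factor *)

Section Resolution.
Variables (k : comPzRingType) (A : klinear_monoidal_category k).
Hypothesis ab : abelian A.
Hypothesis flat : forall Q : A, projective Q ->
       exact_functor (F := fun X : A => mon_tens Q X)
         (fun (X Y : A) (f : mor X Y) => mon_tensm (idm Q) f).
Variable P : projective_resolution (mon_unit A).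
Let C := tword_cat P.
Local Notation wm := (@wm k C).
Local Notation I := (mon_unit A).

Definition dw i : wm [:: i] [:: i + 1] := mon_tensm (cpx_d P i) (idm I).
Definition dtot a b : wm [:: a] [:: b] := wcast [:: b] (dw a).
Definition augw : wm [:: 0] [::] := res_aug P \c mon_runit (P 0).

Lemma runit_iso (X : A) : is_iso (mon_runit X). Proof. exact: mon_runit_iso. Qed.

Lemma dw_exact i : i + 1 < 0 -> exact_at (dw i) (dw (i + 1)).
Proof.
move=> h; apply: (exact_iso (runit_iso _) (runit_iso _) (runit_iso _) _ _ (res_exact P h)).
- exact: mon_runit_nat.
- exact: mon_runit_nat.
Qed.
Lemma dw_exact0 : exact_at (dw (-1)) augw.
Proof.
apply: (exact_iso (runit_iso _) (runit_iso _) (iso_id I) _ _ (res_exact0 P)).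
- exact: mon_runit_nat.
- by rewrite comp1f.
Qed.
Lemma augw_epic : epic augw.
Proof.
by move=> Z a b; rewrite /augw !compA => /(iso_epic (runit_iso _))/(@res_epic _ _ _ P).
Qed.
Lemma tlw_exact b s t r (f : wm s t) (g : wm t r) :
  exact_at (f : mor (tpow P s) (tpow P t)) g ->
  exact_at (tlw b f : mor (tpow P (b :: s)) (tpow P (b :: t))) (tlw b g).
Proof.
pose F (X : A) := mon_tens (P b) X.
pose Fm (X Y : A) (h : mor X Y) : mor (F X) (F Y) := mon_tensm (idm (P b)) h.
have F_comp X Y Z (h : mor Y Z) (h' : mor X Y) : Fm _ _ (h \c h') = Fm _ _ h \c Fm _ _ h'.
  exact: tensm_compr.
exact: (exact_functor_exact_at ab F_comp (flat (@res_projective _ _ _ P b))).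
Qed.

Lemma src_projective a : projective (tpow P [:: a]).
Proof. exact: (projective_iso (runit_iso (P a)) (@res_projective _ _ _ P a)). Qed.

Lemma lwhisks_exact J s t r (f : wm s t) (g : wm t r) :
  exact_at (f : mor (tpow P s) (tpow P t)) g ->
  exact_at (lwhisks (@lw k C) J f : mor (tpow P (J ++ s)) (tpow P (J ++ t))) (lwhisks (@lw k C) J g).
Proof. by move=> h; elim: J => //= b J IH; exact: tlw_exact. Qed.
Lemma lwu_exact J :
  exact_at (lwhisks (@lw k C) J (dw (-1)) : mor (tpow P (J ++ [:: -1])) (tpow P (J ++ [:: 0]))) (lwu augw J).
Proof. by elim: J => [|b J IH]; [exact: dw_exact0|exact: tlw_exact]. Qed.
Lemma lwu_epic J : epic (lwu augw J : mor (tpow P (J ++ [:: 0])) (tpow P J)).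
Proof.
elim: J => [|b J IH]; first exact: augw_epic.
exact: (exact_functor_epic ab (flat (@res_projective _ _ _ P b)) IH).
Qed.

Lemma tensm0 (X X' Y Y' : A) (f : mor X X') : mon_tensm f (0 : mor Y Y') = 0.
Proof. exact: (linfun0 (mon_tensm_linearr f)). Qed.
Lemma tens0m (X X' Y Y' : A) (f : mor Y Y') : mon_tensm (0 : mor X X') f = 0.
Proof. exact: (linfun0 (mon_tensm_linearl f)). Qed.

Lemma zero_id a s : 0 < a -> idm (tpow P (s ++ [:: a])) = 0.
Proof.
move=> h; elim: s => [|b s IH] /=; last by rewrite -mon_tensm_id IH tensm0.
have [h1 _] := res_zero P h.
by rewrite -mon_tensm_id (h1 _ (idm _)) tens0m.
Qed.

Lemma dtotE a : dtot a (a + 1) = dw a. Proof. exact: wcast_id. Qed.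

Lemma dwdw a : dw (a + 1) \w dw a = 0.
Proof. by rewrite /= /dw tensm_comp cpx_dd comp1f tens0m. Qed.

Lemma dtot_deg a b : b != a + 1 -> dtot a b = 0.
Proof. by move=> h; apply: wcast_neq; apply: contra h => /eqP [->]. Qed.

Lemma dtot_dtot a b c : dtot b c \w dtot a b = 0.
Proof.
case: (eqVneq b (a + 1)) => [->|h]; last by rewrite (dtot_deg h) (linfun0 (wc_linr _)).
rewrite dtotE -wcast_wc dwdw; exact: (linfun0 (@wcast_linear _ _ _ _ _)).
Qed.

Lemma aug_dtot a : augw \w dtot a 0 = 0.
Proof.
case: (eqVneq 0 (a + 1)) => h; last by rewrite (dtot_deg h) (linfun0 (wc_linr _)).
have -> : a = -1 by lia.
rewrite [dtot _ _]dtotE.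
by have [K [i [p [[e _] _ E]]]] := dw_exact0; rewrite E /= compA e comp0f.
Qed.

Definition resolution : resolution_on C.
Proof.
refine {| rd := dtot; ru := augw; rd_deg := dtot_deg; rdd := dtot_dtot; rud := aug_dtot |}.
- move=> a t f h; rewrite -[f](wcf1 (w := C)) [wid _](zero_id [::] h); exact: compf0.
- move=> a s b f h; rewrite -[f](wc1f (w := C)) [wid _](zero_id s h); exact: comp0f.
- move=> a s i f h; rewrite !dtotE => e.
  have [g fg] := exact_lift (@src_projective a) (lwhisks_exact s (dw_exact h)) e.
  by exists g; exact: fg.
- move=> a s f e; rewrite [dtot _ _]dtotE.
  have [g fg] := exact_lift (@src_projective a) (lwu_exact s) e.
  by exists g; exact: fg.
- move=> a s f; have [g <-] := @src_projective a _ _ _ f (@lwu_epic s).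
  by exists g.
Defined.
End Resolution.

(** * The Maurer-Cartan element *)

Notation "x `_[ a , t ]" := (hat (ltr x) a t) (at level 2, a, t at level 200, format "x `_[ a , t ]").

Section Rows.
Variables (k : comPzRingType) (C : word_cat k).
Local Notation wm := (@wm k C).
Local Notation K := (koszul k).
Local Notation V := (shift (cochains C)).
Local Notation LW := (lwhisks (@lw k C)).
Implicit Types (L : lmodType k) (s t r : seq int) (a b c i j : int).

Definition row a := forall t, wm [:: a] t.

Lemma wc0f s t r (f : wm s t) : (0 : wm t r) \w f = 0.
Proof. exact: (linfun0 (wc_linl f)). Qed.
Lemma wcf0 s t r (g : wm t r) : g \w (0 : wm s t) = 0.
Proof. exact: (linfun0 (wc_linr g)). Qed.
Lemma rw0 r s t : rw r (0 : wm s t) = 0.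
Proof. exact: (linfun0 (@rw_linear _ _ _ _ _)). Qed.
Lemma lw0 b s t : lw b (0 : wm s t) = 0.
Proof. exact: (linfun0 (@lw_linear _ _ _ _ _)). Qed.
Lemma wcast0 s t t' : wcast t' (0 : wm s t) = 0.
Proof. exact: (linfun0 (@wcast_linear _ _ _ _ _)). Qed.

Definition mk j (f : forall a, row a) : V j := (fun t => f (src j t) t) : family_module _.

Lemma hat_src j (x : V j) t : x`_[src j t, t] = ev (ltr x) t.
Proof. exact: (hatE (ltr x)). Qed.
Lemma hat_off j (x : V j) a t : a != src j t -> x`_[a, t] = 0.
Proof. exact: (@hat_neq _ _ (ltr x)). Qed.
Lemma hat_mk j f a t : (mk j f)`_[a, t] = if a == src j t then f a t else 0.
Proof.
case: eqP => [->|/eqP h]; last exact: hat_off.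
exact: hat_src.
Qed.
Lemma hat_mk_hom j (f : forall a, row a) a t : (a != src j t -> f a t = 0) -> (mk j f)`_[a, t] = f a t.
Proof. by rewrite hat_mk; case: eqP => // /eqP h ->. Qed.
Lemma V_ext j (x y : V j) : (forall a t, x`_[a, t] = y`_[a, t]) -> x = y.
Proof.
move=> h; apply: functional_extensionality_dep => t.
have := h (src j t) t; rewrite !hat_src => e; exact: e.
Qed.
Lemma hatD j (x y : V j) a t : (x + y)`_[a, t] = x`_[a, t] + y`_[a, t].
Proof. by have := @hat_linear k C j a t 1 x y; rewrite !scale1r. Qed.
Lemma hatZ j (x : V j) e a t : (e *: x)`_[a, t] = e *: x`_[a, t].
Proof. by have := @hat_linear k C j a t e x 0; rewrite addr0 (linfun0 (@hat_linear k C j a t)) addr0. Qed.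
Lemma hatN j (x : V j) a t : (- x)`_[a, t] = - x`_[a, t].
Proof. by rewrite -scaleN1r hatZ scaleN1r. Qed.
Lemma hat0 j a t : (0 : V j)`_[a, t] = 0.
Proof. by rewrite -(scale0r (0 : V j)) hatZ scale0r. Qed.

Lemma act1E L (y : letter V) t (Psi : functional C L) : act [:: y] t Psi =
  cut (fun t0 r => cut (fun J r' => K (tag y * wt r') *:
    Psi (t0 ++ src (tag y) J :: r') (t0 ++ (J ++ r')) (LW t0 (rw r' (ev y J)))) r) t.
Proof.
have he P t' : eats y [::] t' P = cut (fun J r' => K (tag y * wt r') *:
    P (src (tag y) J :: r') (J ++ r') (rw r' (ev y J))) t'.
  apply: cut_ext => J r' _; rewrite act_nil wdeg_nil subr0 lw_id.
  by congr (_ *: P _ _ _); exact: wcf1.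
elim: t Psi => [|b t IH] Psi; first by rewrite act_cons_nil he !cut_nil.
by rewrite act_cons_cons IH he [RHS]cut_cons addrC.
Qed.

(* f followed by one application of y, in all possible positions. *)
Definition ract j (y : V j) q (f : forall s, wm q s) (t : seq int) : wm q t :=
  act [:: ltr y] t (fun s t' th => wcast t (th \w f s)).

Lemma ract_functional q (f : forall s, wm q s) t :
  flinear (fun s t' (th : wm s t') => wcast t (th \w f s)).
Proof. move=> s t'; exact: (linear_comp (@wcast_linear _ _ _ _ _) (wc_linl _)). Qed.

Lemma ract_linr j (y : V j) q (f g : forall s, wm q s) e t :
  ract y (fun s => e *: f s + g s) t = e *: ract y f t + ract y g t.
Proof. by rewrite /ract -actP; apply: act_ext => s th _; rewrite wc_linr wcast_linear. Qed.
Lemma ract_ext j (y : V j) q (f g : forall s, wm q s) t :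
  (forall s, wt s + j = wt t -> f s = g s) -> ract y f t = ract y g t.
Proof. by move=> h; apply: act_ext => s th; rewrite wdeg_ltr => hs; rewrite h. Qed.
Lemma ract0 j (y : V j) q t : ract y (fun s => 0 : wm q s) t = 0.
Proof. by rewrite -[RHS](act0 _ [:: ltr y] t); apply: act_ext => s th _; rewrite wcf0 wcast0. Qed.
Lemma ractZ j (y : V j) q (f : forall s, wm q s) e t : ract y (fun s => e *: f s) t = e *: ract y f t.
Proof.
rewrite -[RHS]addr0 -(ract0 y q t) -ract_linr; apply: ract_ext => s _; by rewrite addr0.
Qed.
Lemma ractN j (y : V j) q (f : forall s, wm q s) t : ract y (fun s => - f s) t = - ract y f t.
Proof. by rewrite -scaleN1r -ractZ; apply: ract_ext => s _; rewrite scaleN1r. Qed.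
Lemma ractD j (y : V j) q (f g : forall s, wm q s) t : ract y (fun s => f s + g s) t = ract y f t + ract y g t.
Proof. by rewrite -[ract y f t]scale1r -ract_linr; apply: ract_ext => s _; rewrite scale1r. Qed.
Lemma ract_lin j q (f : forall s, wm q s) t : linear (fun y : V j => ract y f t).
Proof. exact: (act_multilinear t (@ract_functional q f t) [::] [::]). Qed.
Lemma ractDl j (x y : V j) q (f : forall s, wm q s) t : ract (x + y) f t = ract x f t + ract y f t.
Proof. exact: (linfunD (@ract_lin j q f t)). Qed.
Lemma ract_wc j (y : V j) q q' (f : forall s, wm q s) (g : wm q' q) t :
  ract y (fun s => f s \w g) t = ract y f t \w g.
Proof.
rewrite /ract (act_linear _ _ _ (wc_linl g)); apply: act_ext => s th _.
by rewrite wcA wcast_wc.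
Qed.

Lemma ractE j (y : V j) q (f : forall s, wm q s) t : ract y f t =
  cut (fun t0 r => cut (fun J r' => K (j * wt r') *:
    wcast t (LW t0 (rw r' (ev (ltr y) J)) \w f (t0 ++ src j J :: r'))) r) t.
Proof. exact: act1E. Qed.

Lemma ract_size j (x y : V j) q (f g : forall s, wm q s) t :
  (forall t0 J r, t = t0 ++ (J ++ r) ->
     LW t0 (rw r (ev (ltr x) J)) \w f (t0 ++ src j J :: r) =
     LW t0 (rw r (ev (ltr y) J)) \w g (t0 ++ src j J :: r)) ->
  ract x f t = ract y g t.
Proof.
move=> h; rewrite !ractE; apply: cut_ext => t0 r0 e; apply: cut_ext => J r e'.
by rewrite h // e' e.
Qed.

Lemma LW0 t0 s t : LW t0 (0 : wm s t) = 0.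
Proof. by elim: t0 => //= b t0 ->; rewrite lw0. Qed.

Lemma ev0 j (x : V j) J : (forall a, x`_[a, J] = 0) -> ev (ltr x) J = 0.
Proof. by move=> h; rewrite -hat_src h. Qed.

Lemma ract_term j (y : V j) q (f : forall s, wm q s) t t0 J r : t0 ++ (J ++ r) = t ->
  ev (ltr y) J = 0 \/ f (t0 ++ src j J :: r) = 0 ->
  wcast t (LW t0 (rw r (ev (ltr y) J)) \w f (t0 ++ src j J :: r)) = 0.
Proof. by move=> _ [->|->]; rewrite ?rw0 ?LW0 ?wc0f ?wcf0 wcast0. Qed.

Lemma ract_only j (y : V j) q (f : forall s, wm q s) t :
  (forall t0 J r, t0 ++ (J ++ r) = t -> t0 ++ r <> [::] ->
     ev (ltr y) J = 0 \/ f (t0 ++ src j J :: r) = 0) ->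
  ract y f t = ev (ltr y) t \w f [:: src j t].
Proof.
move=> h; rewrite ractE cut_only_nil => [|t0 r e n0]; last first.
  apply: cut_eq0 => J r' e'; rewrite ract_term ?scaler0 // ?e' //.
  by apply: h; rewrite ?e' //; case: t0 n0 {e}.
rewrite cut_only_full => [|J r e n]; last first.
  rewrite ract_term ?scaler0 //; exact: h.
rewrite wt_nil mulr0 /koszul expr0 scale1r -[RHS]wcast_id.
apply: (functional_tag (fun s t' (th : wm s t') => wcast t (th \w f s))).
exact: rw_nil.
Qed.

Lemma ract_whole j (y : V j) q (f : forall s, wm q s) t :
  (forall J, (size J < size t)%N -> ev (ltr y) J = 0) ->
  ract y f t = ev (ltr y) t \w f [:: src j t].
Proof.
move=> h; apply: ract_only => t0 J r e n; left; apply: h.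
by rewrite -e !size_cat; case: t0 r n {e} => [|c t0] [|d r] //= _; lia.
Qed.
Lemma ract_col j (y : V j) q (f : forall s, wm q s) t :
  (forall s, size s <> 1 -> f s = 0) ->
  ract y f t = ev (ltr y) t \w f [:: src j t].
Proof.
move=> h; apply: ract_only => t0 J r _ n; right; apply: h.
by rewrite size_cat /=; case: t0 r n => [|c t0] [|d r] //= _; lia.
Qed.
Lemma ract_small j (y : V j) q (f : forall s, wm q s) t :
  (forall J, (size J <= size t)%N -> ev (ltr y) J = 0) -> ract y f t = 0.
Proof.
move=> h; rewrite ract_whole; first by rewrite h // wc0f.
by move=> J hJ; apply/h/ltnW.
Qed.
(** Arity count: a block of two or more letters leaves f or g with fewer letters than t has, where
    they vanish, so only the arity 1 parts of x and y matter. *)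
Lemma ract_lead j (x y : V j) q (f g : forall s, wm q s) t : ev (ltr x) [::] = 0 -> ev (ltr y) [::] = 0 ->
  (forall b, ev (ltr x) [:: b] = ev (ltr y) [:: b]) ->
  (forall s, (size s < size t)%N -> f s = 0) -> (forall s, (size s < size t)%N -> g s = 0) ->
  (forall s, size s = size t -> f s = g s) -> ract x f t = ract y g t.
Proof.
move=> x0 y0 xy f0 g0 fg; apply: ract_size => t0 [|b [|c J]] r e.
- by rewrite x0 y0 !rw0 !LW0 !wc0f.
- by rewrite xy fg // e !size_cat /=.
- by rewrite f0 ?g0 ?wcf0 // e !size_cat /=; lia.
Qed.
(** Without an arity 0 part, an insertion never lowers the arity, so arities above that of t cannot
    contribute. *)
Lemma ract_trunc j (x y : V j) q (f g : forall s, wm q s) t : ev (ltr x) [::] = 0 -> ev (ltr y) [::] = 0 ->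
  (forall J, (size J <= size t)%N -> ev (ltr x) J = ev (ltr y) J) ->
  (forall s, (size s <= size t)%N -> f s = g s) -> ract x f t = ract y g t.
Proof.
move=> x0 y0 xy fg; apply: ract_size => t0 [|b J] r e.
- by rewrite x0 y0 !rw0 !LW0 !wc0f.
- by rewrite xy ?fg // e !size_cat /=; lia.
Qed.

Definition pre i j (x : V i) (y : V j) : V (i + j) := br (ltr x) [:: ltr y] (i + j).
Lemma hat_pre i j (x : V i) (y : V j) a t : (pre x y)`_[a, t] = ract y (hat (ltr x) a) t.
Proof.
have e : i + j = tag (ltr x) + wdeg [:: ltr y] by rewrite wdeg_ltr.
by rewrite /pre e; exact: hat_brl.
Qed.

Lemma ract_ract i j (x : V i) (y : V j) q (f : forall s, wm q s) t :
  ract y (ract x f) t = act [:: ltr x; ltr y] t (fun s t' th => wcast t (th \w f s)) +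
    ract (pre x y) f t + K (j * i) *: act [:: ltr y; ltr x] t (fun s t' th => wcast t (th \w f s)).
Proof.
have hm := act_multilinear t (@ract_functional q f t).
have hl := linear_lift hm.
have e : brl (@br k C) (ltr x) [:: ltr y] = ltr (pre x y) by rewrite /brl /pre wdeg_ltr.
transitivity (lift (fun w => act w t (fun s t' th => wcast t (th \w f s))) (star (@br k C) [:: ltr x] [:: ltr y])).
  rewrite -act_star; last exact: ract_functional.
  apply: act_ext => s th _; rewrite wcast_id /ract (act_linear _ _ _ (wc_linr th)).
  by apply: act_ext => r eta _; rewrite !wcast_id wcc_id wcA.
rewrite (star_single (@br_nil k C)).
rewrite (linfunD hl) (linfunD hl) (linfunZ hl) !(lift_bar _ hm) e.
done.
Qed.

(** For odd m the two orders of insertions into disjoint blocks cancel, and only the nested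
    insertion m{m} is left. *)
Lemma ract_sq (m : V 1) q (f : forall s, wm q s) t : ract m (ract m f) t = ract (pre m m) f t.
Proof.
have e : K (1 * 1) = -1 by rewrite mulr1 /koszul expr1.
rewrite ract_ract e scaleN1r.
set X := act _ _ _; by rewrite addrAC subrr add0r.
Qed.
End Rows.
Arguments row {_} _ _.

(** * The differential of the tensor powers *)

Section Differential.
Variables (k : comPzRingType) (C : word_cat k) (R : resolution_on C).
Local Notation wm := (@wm k C).
Local Notation K := (koszul k).
Local Notation V := (shift (cochains C)).
Local Notation LW := (lwhisks (@lw k C)).
Local Notation rd := (rd R).
Local Notation u := (ru R).
Local Notation lwu := (lwu u).
Implicit Types (L : lmodType k) (s t r : seq int) (a b c i j : int).

Definition Dcoef a : row C a := fun t => if t is [:: b] return wm [:: a] t then rd a b else 0.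
Definition D : V 1 := mk 1 Dcoef.

Lemma src1 b : src 1 [:: b] = b - 1.
Proof. by rewrite /src wt_cons wt_nil; ring. Qed.
Lemma ev_D b : ev (ltr D) [:: b] = rd (src 1 [:: b]) b. Proof. by []. Qed.
Lemma ev_D0 J : size J <> 1 -> ev (ltr D) J = 0. Proof. by case: J => [|b [|c J]]. Qed.
Lemma hat_D a b : D`_[a, [:: b]] = rd a b.
Proof. by rewrite hat_mk_hom // src1 => h; rewrite /= rd_deg //; apply: contra h => /eqP; lia. Qed.
Lemma hat_D0 a t : size t <> 1 -> D`_[a, t] = 0.
Proof. by rewrite hat_mk; case: ifP => // _; case: t => [|b [|c J]]. Qed.

Lemma ract_hatD j (y : V j) a t : ract y (hat (ltr D) a) t = y`_[a + 1, t] \w rd a (a + 1).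
Proof.
rewrite ract_col => [|s hs]; last by rewrite hat_D0.
rewrite hat_D; case: (eqVneq (a + 1) (src j t)) => [->|h]; first by rewrite hat_src.
by rewrite hat_off // rd_deg ?wcf0 ?wc0f // eq_sym.
Qed.

Lemma ract_DD q (f : forall s, wm q s) t : ract D (ract D f) t = 0.
Proof.
rewrite ract_sq (_ : pre D D = 0); first exact: (linfun0 (@ract_lin _ _ _ _ _ _)).
apply: V_ext => a [|b [|c s]]; rewrite hat_pre ract_hatD hat0 ?hat_D ?rdd // hat_D0 ?wc0f //.
Qed.

(** The commutator with D; it is the part of the differential of B that preserves the arity. *)
Definition del_coef j (y : V j) a : row C a := fun t =>
  y`_[a + 1, t] \w rd a (a + 1) - K j *: ract D (hat (ltr y) a) t.
Definition del j (y : V j) : V (j + 1) := mk (j + 1) (del_coef y).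

Lemma ract_hom i j (x : V i) (y : V j) a t : a != src (i + j) t -> ract y (hat (ltr x) a) t = 0.
Proof. by move=> h; rewrite -hat_pre hat_off. Qed.

Lemma hat_del j (y : V j) a t : (del y)`_[a, t] =
  y`_[a + 1, t] \w rd a (a + 1) - K j *: ract D (hat (ltr y) a) t.
Proof.
rewrite hat_mk_hom // => h; rewrite /del_coef ract_hom // scaler0 subr0 hat_off ?wc0f //.
by apply: contra h => /eqP; rewrite /src => e; apply/eqP; lia.
Qed.

Lemma delD j (x y : V j) : del (x + y) = del x + del y.
Proof.
apply: V_ext => a t; rewrite hatD !hat_del hatD (linfunD (wc_linl _)) addrACA -opprD -scalerDr -ractD.
by congr (_ - _ *: _); apply: ract_ext => s _; rewrite hatD.
Qed.
Lemma delZ j e (y : V j) : del (e *: y) = e *: del y.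
Proof.
apply: V_ext => a t; rewrite hatZ !hat_del hatZ (linfunZ (wc_linl _)) scalerBr !scalerA (mulrC e) -scalerA -ractZ.
by congr (_ - _ *: _); apply: ract_ext => s _; rewrite hatZ.
Qed.
Lemma delN j (y : V j) : del (- y) = - del y.
Proof. by rewrite -scaleN1r delZ scaleN1r. Qed.

Lemma hat_del_del j (y : V j) a t : (del (del y))`_[a, t] = 0.
Proof.
rewrite hat_del hat_del (linfunD (wc_linl _)) (linfunN (wc_linl _)) (linfunZ (wc_linl _)).
rewrite -!wcA rdd wcf0 add0r koszulS scaleNr opprK -ract_wc.
rewrite [X in - _ + K j *: X](_ : _ = ract D (fun s => y`_[a + 1, s] \w rd a (a + 1)) t); first exact: addNr.
under ract_ext => s _ do rewrite hat_del.
by rewrite ractD ractN ractZ ract_DD scaler0 subr0.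
Qed.

Lemma actD_nil L (Psi : functional C L) : flinear Psi -> act [:: ltr D] [::] Psi = 0.
Proof. by move=> h; rewrite act1E !cut_nil ev_D0 // rw0 (linfun0 (h _ _)) scaler0. Qed.

Lemma actD_cons L b t (Psi : functional C L) : flinear Psi ->
  act [:: ltr D] (b :: t) Psi =
  act [:: ltr D] t (fun s t th => Psi (b :: s) (b :: t) (lw b th)) +
  K (wt t) *: Psi (b - 1 :: t) (b :: t) (rw t (rd (b - 1) b)).
Proof.
move=> h; rewrite act_cons_cons; congr (_ + _).
have he J r : size J <> 1 -> K (1 * (wt r - wdeg ([::] : word V))) *:
    act [::] r (fun s r' th => Psi (src 1 J :: s) (J ++ r') (rw r' (ev (ltr D) J) \w lw _ th)) = 0.
  by move=> hJ; rewrite act_nil ev_D0 // rw0 wc0f (linfun0 (h _ _)) scaler0.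
rewrite /eats cut_cons he // add0r.
case: t => [|c t].
  rewrite cut_nil wdeg_nil subr0 mul1r act_nil ev_D src1 lw_id.
  by congr (_ *: Psi _ _ _); exact: wcf1.
rewrite cut_cons [X in _ + X]cut_eq0; last by move=> s r _; rewrite he.
rewrite addr0 wdeg_nil subr0 mul1r act_nil ev_D src1 lw_id.
by congr (_ *: Psi _ _ _); exact: wcf1.
Qed.

Lemma actD_ext L t (Psi Psi' : functional C L) : flinear Psi -> flinear Psi' ->
  (forall s (th : wm s t), size s = size t -> Psi s t th = Psi' s t th) ->
  act [:: ltr D] t Psi = act [:: ltr D] t Psi'.
Proof.
elim: t Psi Psi' => [|b t IH] Psi Psi' h h' e; first by rewrite !actD_nil.
rewrite !actD_cons // e //; congr (_ + _); apply: IH.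
- exact: lw_functional.
- exact: lw_functional.
by move=> s th hs; apply: e; rewrite /= hs.
Qed.

(** [act] recurs on the first letter, but liftings are made in the last one. The sign K (b + 1)
    moves D past the last factor. *)
Lemma actD_last L s b (Psi : functional C L) : flinear Psi ->
  act [:: ltr D] (s ++ [:: b]) Psi =
  Psi (s ++ [:: b - 1]) (s ++ [:: b]) (LW s (rd (b - 1) b)) +
  act [:: ltr D] s (fun s' t' th => K (b + 1) *: Psi (s' ++ [:: b]) (t' ++ [:: b]) (rw [:: b] th)).
Proof.
have hl P : flinear P -> flinear (fun s' t' (th : wm s' t') =>
    K (b + 1) *: (P (s' ++ [:: b]) (t' ++ [:: b]) (rw [:: b] th) : L)).
  move=> h s' t'; apply: linear_scale; exact: (linear_comp (h _ _) (@rw_linear _ _ _ _ _)).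
elim: s Psi => [|c s IH] Psi h.
  rewrite -[[::] ++ [:: b]]/[:: b] actD_cons // actD_nil; last exact: lw_functional.
  rewrite actD_nil; last exact: hl.
  rewrite add0r addr0 wt_nil /koszul expr0 scale1r.
  by apply: functional_tag; exact: rw_nil.
rewrite [LHS]actD_cons // IH; last exact: lw_functional.
rewrite actD_cons; last exact: hl.
rewrite -addrA; congr (_ + (_ + _)).
  apply: act_ext => s' th _; rewrite rw_lw //.
rewrite scale_koszul; congr (K _ *: _).
  by rewrite wt_cat wt_cons wt_nil; ring.
by apply: functional_tag; exact: (esym (rw_rw s [:: b] (rd (c - 1) c))).
Qed.

Lemma ract_D_last q (f : forall s, wm q s) s b : ract D f (s ++ [:: b]) =
  LW s (rd (b - 1) b) \w f (s ++ [:: b - 1]) +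
  act [:: ltr D] s (fun s' t' th => K (b + 1) *: wcast (s ++ [:: b]) (rw [:: b] th \w f (s' ++ [:: b]))).
Proof. by rewrite /ract actD_last ?wcast_id //; exact: ract_functional. Qed.

Lemma D_last_functional q (f : forall s, wm q s) s b : flinear (fun s' t' (th : wm s' t') =>
   K (b + 1) *: wcast (s ++ [:: b]) (rw [:: b] th \w f (s' ++ [:: b]))).
Proof.
move=> s' t'; apply: linear_scale; apply: (linear_comp (@wcast_linear _ _ _ _ _)).
exact: (linear_comp (wc_linl _) (@rw_linear _ _ _ _ _)).
Qed.

Lemma ract_D_last_ext q (f g : forall s, wm q s) s b :
  (forall s', size s' = size s -> f (s' ++ [:: b]) = g (s' ++ [:: b])) ->
  f (s ++ [:: b - 1]) = g (s ++ [:: b - 1]) -> ract D f (s ++ [:: b]) = ract D g (s ++ [:: b]).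
Proof.
move=> h e; rewrite !ract_D_last e; congr (_ + _).
apply: actD_ext; try exact: D_last_functional.
by move=> s' th hs; rewrite h.
Qed.
Lemma ract_D_only q (f : forall s, wm q s) s b :
  (forall s', size s' = size s -> f (s' ++ [:: b]) = 0) ->
  ract D f (s ++ [:: b]) = LW s (rd (b - 1) b) \w f (s ++ [:: b - 1]).
Proof.
move=> h; rewrite ract_D_last -[RHS]addr0 -[X in _ = _ + X](act0 _ [:: ltr D] s); congr (_ + _).
apply: actD_ext; first exact: D_last_functional.
  by move=> s' t'; exact: linear_zero.
by move=> s' th hs; rewrite h // wcf0 wcast0 scaler0.
Qed.

Lemma lwu_LW s a : lwu s \w LW s (rd a 0) = 0.
Proof. by elim: s => [|b s IH]; rewrite /= ?rud // -lw_comp IH lw0. Qed.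

(** Interchange of th with the augmentation of the last factor. [G] absorbs the words, which vary
    with the term of the sum. *)
Lemma lwu_actD L t (G : forall s t, wm (s ++ [:: 0]) t -> L) : (forall s t, linear (G s t)) ->
  act [:: ltr D] t (fun s' t' th => G s' t' (lwu t' \w rw [:: 0] th)) =
  act [:: ltr D] t (fun s' t' th => G s' t' (th \w lwu s')).
Proof.
have h1 (G' : forall s t, wm (s ++ [:: 0]) t -> L) : (forall s t, linear (G' s t)) ->
   flinear (fun s' t' (th : wm s' t') => G' s' t' (lwu t' \w rw [:: 0] th)).
  by move=> h s' t'; apply: (linear_comp (h _ _) (linear_comp (wc_linr _) (@rw_linear _ _ _ _ _))).
have h2 (G' : forall s t, wm (s ++ [:: 0]) t -> L) : (forall s t, linear (G' s t)) ->
   flinear (fun s' t' (th : wm s' t') => G' s' t' (th \w lwu s')).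
  by move=> h s' t'; apply: (linear_comp (h _ _) (wc_linl _)).
elim: t G => [|b t IH] G h; first by rewrite !actD_nil; [|exact: h2|exact: h1].
rewrite actD_cons; last exact: h1.
rewrite actD_cons; last exact: h2.
congr (_ + _); last first.
  congr (_ *: G _ _ _).
  have -> : rw [:: 0] (rw t (rd (b - 1) b)) = rw (t ++ [:: 0]) (rd (b - 1) b).
    exact: (tagged_inj (rw_rw t [:: 0] (rd (b - 1) b))).
  exact: (esym (rw_lwhisks (rd (b - 1) b) (lwu t))).
transitivity (act [:: ltr D] t (fun s' t' th => G (b :: s') (b :: t') (lw b (lwu t' \w rw [:: 0] th)))).
  by apply: act_ext => s th _; rewrite rw_lw lw_comp.
rewrite (IH (fun s t x => G (b :: s) (b :: t) (lw b x))); last first.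
  by move=> s t' c x y; rewrite lw_linear; exact: (h (b :: s) (b :: t')).
by apply: act_ext => s th _; rewrite lw_comp.
Qed.

(** The differential of the last factor is killed by the augmentation; the sign comes from D passing
    the last letter 0, of weight 1. *)
Lemma lwu_ract q (f : forall s, wm q s) t :
  lwu t \w ract D f (t ++ [:: 0]) = - ract D (fun s => lwu s \w f (s ++ [:: 0])) t.
Proof.
rewrite ract_D_last (linfunD (wc_linr _)) wcA (_ : 0 - 1 = -1) // lwu_LW wc0f add0r.
rewrite (act_linear _ _ _ (wc_linr _)).
pose G s t' (x : wm (s ++ [:: 0]) t') : wm q t := wcast t (x \w f (s ++ [:: 0])).
have hG s t' : linear (@G s t').
  exact: (linear_comp (@wcast_linear _ _ _ _ _) (wc_linl _)).
transitivity (- act [:: ltr D] t (fun s' t' th => G s' t' (lwu t' \w rw [:: 0] th))).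
  rewrite -scaleN1r -actZ; apply: act_ext => s th _.
  rewrite /G !wcast_id (linfunZ (wc_linr _)) add0r wcA.
  by rewrite (_ : K 1 = -1) // /koszul expr1.
by rewrite lwu_actD //; congr (- _); apply: act_ext => s th _; rewrite /G wcA.
Qed.

(* Postcomposition with the augmentation of the last factor lowers the arity by 1. *)
Definition eps_coef (x : forall a, row C a) a : row C a := fun t => lwu t \w x a (t ++ [:: 0]).
Definition eps i j (y : V j) : V i := mk i (eps_coef (fun a => hat (ltr y) a)).
Lemma hat_eps i j (y : V j) a t : i = j - 1 -> (eps i y)`_[a, t] = lwu t \w y`_[a, t ++ [:: 0]].
Proof.
move=> ->; apply: hat_mk_hom => h; rewrite /eps_coef hat_off ?wcf0 //.
by apply: contra h => /eqP ->; rewrite /src wt_cat wt_cons wt_nil; apply/eqP; ring.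
Qed.
Lemma eps_del i j (y : V j) a t : i = j - 1 ->
  lwu t \w (del y)`_[a, t ++ [:: 0]] = (del (eps i y))`_[a, t].
Proof.
move=> e; rewrite !hat_del (linfunD (wc_linr _)) (linfunN (wc_linr _)) (linfunZ (wc_linr _)).
rewrite lwu_ract wcA hat_eps // scalerN -scaleNr -koszulS.
have -> : K (j + 1) = K i by rewrite e -[in LHS](subrK 1 j) !koszulS opprK.
by congr (_ - _ *: _); apply: ract_ext => s _; rewrite hat_eps.
Qed.
End Differential.

(** * Lifting through augmentations and the construction of m *)

Section Lifting.
Variables (k : comPzRingType) (C : word_cat k) (R : resolution_on C).
Local Notation wm := (@wm k C).
Local Notation K := (koszul k).
Local Notation V := (shift (cochains C)).
Local Notation LW := (lwhisks (@lw k C)).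
Local Notation rd := (rd R).
Local Notation u := (ru R).
Local Notation lwu := (lwu u).
Local Notation D := (D R).
Implicit Types (L : lmodType k) (s t r : seq int) (a b c i j : int).

Lemma koszul_inv j L (x : L) : K j *: (K j *: x) = x.
Proof. by rewrite scale_koszul koszul_sq scale1r. Qed.
Lemma koszul_eq0 j L (x : L) : K j *: x = 0 -> x = 0.
Proof. by move=> h; rewrite -[x](koszul_inv j) h scaler0. Qed.

(* Successive corrections of unbounded rank converge: each component is changed finitely often. *)
Lemma limit j (rank : seq int -> nat) (Q : nat -> V j -> Prop) :
  (exists y, Q 0%N y) ->
  (forall m y, Q m y -> exists y', Q m.+1 y' /\ forall a t, (rank t <= m)%N -> y'`_[a, t] = y`_[a, t]) ->
  exists (y : V j), forall m, exists2 y', Q m y' & forall a t, (rank t <= m)%N -> y`_[a, t] = y'`_[a, t].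
Proof.
move=> h0 hS.
pose F := fix F m : {y | Q m y} := if m is m'.+1 then
    let p := cid (hS m' (sval (F m')) (svalP (F m'))) in exist _ (sval p) (svalP p).1
  else cid h0.
pose ys m := sval (F m).
have step m a t : (rank t <= m)%N -> (ys m.+1)`_[a, t] = (ys m)`_[a, t].
  exact: (svalP (cid (hS m (sval (F m)) (svalP (F m))))).2.
pose y : V j := mk j (fun a t => (ys (rank t))`_[a, t]).
exists y => m; exists (ys m); first exact: (svalP (F m)).
move=> a t hm; rewrite hat_mk_hom; last exact: hat_off.
elim: m hm => [|m IH]; first by rewrite leqn0 => /eqP ->.
rewrite leq_eqVlt => /orP[/eqP -> //|]; rewrite ltnS => h.
by rewrite IH // step.
Qed.

(** An element supported on words that end in b: the prefix is t without its last letter, and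
    [wcast] kills the other words. *)
Definition mk_last j b (g : forall a s, wm [:: a] (s ++ [:: b])) : V j :=
  mk j (fun a t => wcast t (g a (take (size t).-1 t))).
Lemma hat_mk_last j b g a s : a = src j (s ++ [:: b]) -> (mk_last j g)`_[a, s ++ [:: b]] = g a s.
Proof.
move=> e; rewrite hat_mk e eqxx size_cat addn1 /= take_size_cat //; exact: wcast_id.
Qed.
Lemma hat_mk_last_neq j b g a s c : c != b -> (mk_last j (b := b) g)`_[a, s ++ [:: c]] = 0.
Proof.
move=> h; rewrite hat_mk; case: ifP => // _; apply: wcast_neq.
rewrite size_cat addn1 /= take_size_cat //; apply: contra h.
by rewrite eqseq_cat // eqxx /= => /eqP [->].
Qed.

Lemma hat_mk_last_off j b g a t : last 0 t != b -> b != 0 -> (mk_last j (b := b) g)`_[a, t] = 0.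
Proof.
case/lastP: t => [|s c]; last first.
  by rewrite last_rcons -cats1 => h _; exact: hat_mk_last_neq.
by move=> _ h; rewrite hat_mk; case: ifP => // _; apply: wcast_neq.
Qed.

Lemma ract_D_size q (f g : forall s, wm q s) t :
  (forall s, size s = size t -> f s = g s) -> ract D f t = ract D g t.
Proof.
move=> h; apply: actD_ext; try exact: ract_functional.
by move=> s th hs; rewrite h.
Qed.
Lemma del_size j (x y : V j) t : (forall a s, size s = size t -> x`_[a, s] = y`_[a, s]) ->
  forall a, (del R x)`_[a, t] = (del R y)`_[a, t].
Proof.
by move=> h a; rewrite !hat_del h //; congr (_ - _ *: _); apply: ract_D_size => s; exact: h.
Qed.

Lemma del_last j (y : V j) a s b : (forall a s', size s' = size s -> y`_[a, s' ++ [:: b]] = 0) ->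
  (del R y)`_[a, s ++ [:: b]] = - K j *: (LW s (rd (b - 1) b) \w y`_[a, s ++ [:: b - 1]]).
Proof.
move=> h; rewrite hat_del h // wc0f sub0r ract_D_only ?scaleNr // => s'; exact: h.
Qed.

(** One step of the descent on the last letter. In arity n + 1, w vanishes on last letters above -m,
    so closedness makes its component at -m a cycle in the last factor, which lifts by exactness;
    for m = 0 the augmentation replaces the next differential. *)
Lemma lift_last_exists j n (w : V (j + 1)) (m : nat) :
  (forall a s b, size s = n -> - m%:Z < b -> w`_[a, s ++ [:: b]] = 0) ->
  (forall a t, size t = n.+1 -> (del R w)`_[a, t] = 0) ->
  (forall a s, m = 0%N -> size s = n -> lwu s \w w`_[a, s ++ [:: 0]] = 0) ->
  exists c : V j, (forall a t, last 0 t != - m.+1%:Z -> c`_[a, t] = 0) /\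
    (forall a s, size s = n -> (del R c)`_[a, s ++ [:: - m%:Z]] = w`_[a, s ++ [:: - m%:Z]]).
Proof.
move=> w0 dw lw0.
have em : - m%:Z = - m.+1%:Z + 1 by lia.
have ex a s : exists g : wm [:: a] (s ++ [:: - m.+1%:Z]), size s = n ->
    w`_[a, s ++ [:: - m%:Z]] = LW s (rd (- m.+1%:Z) (- m%:Z)) \w g.
  case: (eqVneq (size s) n) => [hs|h]; last by exists 0 => e; rewrite e eqxx in h.
  case: m w0 lw0 em => [|m] w0 lw0 em.
    have [g hg] := r_exact0 (lw0 a s erefl hs).
    by exists g.
  have hneg : - m.+2%:Z + 1 < 0 by lia.
  have h : LW s (rd (- m.+2%:Z + 1) (- m.+2%:Z + 1 + 1)) \w w`_[a, s ++ [:: - m.+2%:Z + 1]] = 0.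
    have := dw a (s ++ [:: - m.+2%:Z + 1 + 1]); rewrite size_cat addn1 hs => /(_ erefl).
    rewrite del_last => [|a' s' hs']; last by apply: w0; [rewrite hs'|lia].
    rewrite addrK scaleNr => /eqP; rewrite oppr_eq0 => /eqP; exact: koszul_eq0.
  have [g hg] := r_exact hneg h.
  by exists g => _; rewrite em.
(* The factor cancels the sign that [del_last] produces. *)
pose g a s := - K j *: projT1 (cid (ex a s)).
have hg a s (hs : size s = n) := projT2 (cid (ex a s)) hs.
exists (mk_last j g); split=> [a t h|a s hs]; first exact: hat_mk_last_off.
rewrite del_last => [|a' s' _]; last by apply: hat_mk_last_neq; lia.
rewrite (_ : - m%:Z - 1 = - m.+1%:Z); last by lia.
case: (eqVneq a (src j (s ++ [:: - m.+1%:Z]))) => e.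
  rewrite hat_mk_last // /g (linfunZ (wc_linr _)) scalerA mulrNN -scalerA koszul_inv.
  exact/esym/hg.
rewrite !hat_off ?wcf0 ?scaler0 //; apply: contra e => /eqP ->.
by rewrite /src !wt_cat !wt_cons; apply/eqP; lia.
Qed.

(** [r_epi] lifts y' through the augmentation of the last factor. The error is then removed at the
    last letters 0, -1, -2, and so on. Step m adds a term on words ending in -m - 1, so each
    component is changed only once and [limit] applies. *)
Lemma lift_last n j (z : V (j + 1)) (y' : V (j - 1)) :
  (forall a t, size t = n.+1 -> (del R z)`_[a, t] = 0) ->
  (forall a s, size s = n -> lwu s \w z`_[a, s ++ [:: 0]] = (del R y')`_[a, s]) ->
  exists y : V j, (forall a t, size t = n.+1 -> (del R y)`_[a, t] = z`_[a, t]) /\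
    (forall a s, size s = n -> lwu s \w y`_[a, s ++ [:: 0]] = y'`_[a, s]).
Proof.
move=> dz ez.
pose Q (m : nat) (y : V j) := (forall a s, size s = n -> lwu s \w y`_[a, s ++ [:: 0]] = y'`_[a, s]) /\
  (forall a s b, size s = n -> - m%:Z < b -> (del R y)`_[a, s ++ [:: b]] = z`_[a, s ++ [:: b]]).
have [||y hy] := @limit j (fun t : seq int => absz (last (0 : int) t)) Q.
- have ex a s := r_epi R (y'`_[a, s]).
  pose g a s := projT1 (cid (ex a s)).
  have hg a s : y'`_[a, s] = lwu s \w g a s := projT2 (cid (ex a s)).
  exists (mk_last j g); split=> [a s hs|a s b hs hb]; last by rewrite [LHS](r_target R) ?[RHS](r_target R).
  case: (eqVneq a (src j (s ++ [:: 0]))) => e; first by rewrite hat_mk_last // hg.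
  rewrite !hat_off ?wcf0 //; apply: contra e => /eqP ->.
  by rewrite /src !wt_cat !wt_cons wt_nil; apply/eqP; lia.
- move=> m y [y1 y2].
  pose w := z - del R y.
  have [|||c [c1 c2]] := @lift_last_exists j n w m.
  + by move=> a s b hs hb; rewrite /w hatD hatN y2 // subrr.
  + move=> a t ht; rewrite /w delD delN hatD hatN dz // hat_del_del subr0 //.
  + move=> a s _ hs; rewrite /w hatD hatN (linfunD (wc_linr _)) (linfunN (wc_linr _)) ez //.
    rewrite (@eps_del _ _ _ (j - 1)) // (@del_size _ _ (eps R (j - 1) y)) ?subrr // => a' s' hs'.
    by rewrite hat_eps // y1 // hs'.
  exists (y + c); split; first split.
  + by move=> a s hs; rewrite hatD c1 ?addr0 ?y1 // last_cat.
  + move=> a s b hs hb; rewrite delD hatD.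
    case: (eqVneq b (- m%:Z)) => [->|hne].
      by rewrite c2 // /w hatD hatN addrC subrK.
    rewrite y2 //; last by lia.
    rewrite del_last => [|a' s' hs']; last by apply: c1; rewrite last_cat /=; lia.
    by rewrite c1 ?wcf0 ?scaler0 ?addr0 // last_cat /=; lia.
  + move=> a t ht; rewrite hatD c1 ?addr0 //; move: ht => /=.
    by move: (last _ t) => x; lia.
exists y; split=> [a t|a s hs]; last first.
  by have [y0 [h _] e] := hy 0%N; rewrite e ?h // last_cat.
case/lastP: t => [//|s b]; rewrite size_rcons => -[hs].
(* The differential at [s ++ [:: b]] reads the last letters b and b - 1, whose ranks are at most |b|
   + 2. *)
have [ym [_ h] e] := hy (`|b| + 2)%N; rewrite -cats1 -h //; last by lia.
rewrite !hat_del !e ?last_cat //=; last by lia.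
congr (_ - _ *: _); apply: ract_D_last_ext => [s' _|]; apply: e; rewrite last_cat /=; lia.
Qed.
Local Notation del := (del R).

(** u extended by 0 to all degrees, so that the iterated augmentation [uw] is defined on every word;
    it is 0 unless all letters are 0. *)
Definition uhat b : wm [:: b] [::] := tcast (F := fun b => wm [:: b] [::]) b u.
Lemma uhat0 : uhat 0 = u.
Proof. exact: (@tcast_id _ _ (fun b => wm [:: b] [::])). Qed.
Fixpoint uw t : wm t [::] := if t is b :: t' then uhat b \w lw b (uw t') else wid [::].

Lemma uw_rcons t : uw (t ++ [:: 0]) = uw t \w lwu t.
Proof.
elim: t => [|b t IH] /=; first by rewrite lw_id wcf1 wc1f uhat0.
by rewrite IH lw_comp wcA.
Qed.
Lemma nseq_rcons n : nseq n (0 : int) ++ [:: 0] = nseq n.+1 0.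
Proof. by elim: n => //= n ->. Qed.
Lemma uw_nseq n (f : forall t, wm [:: n] t) m :
  uw (nseq m.+1 0) \w f (nseq m.+1 0) = uw (nseq m 0) \w (lwu (nseq m 0) \w f (nseq m 0 ++ [:: 0])).
Proof. by rewrite -nseq_rcons uw_rcons wcA. Qed.
Lemma wt_nseq n : wt (nseq n 0) = n%:Z.
Proof. by elim: n => [|n IH]; rewrite ?wt_nil //= wt_cons IH; lia. Qed.

Lemma ract_nil j (y : V j) q (f : forall s, wm q s) : ev (ltr y) [::] = 0 -> ract y f [::] = 0.
Proof. by move=> h; rewrite ractE !cut_nil h !rw0 !LW0 wc0f wcast0 scaler0. Qed.

(* The total complex of maps from P to n tensor factors of P is quasi-isomorphic to
   Hom(P, I) through the n-fold augmentation. *)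
Lemma del_lift n j (z : V (j + 1)) (rho : forall a, wm [:: a] [::]) :
  (forall a t, size t = n -> (del z)`_[a, t] = 0) ->
  (forall a, a + 1 = src j (nseq n 0) ->
     uw (nseq n 0) \w z`_[a, nseq n 0] = rho (a + 1) \w rd a (a + 1)) ->
  exists y : V j, (forall a t, size t = n -> (del y)`_[a, t] = z`_[a, t]) /\
    (forall a, a = src j (nseq n 0) -> uw (nseq n 0) \w y`_[a, nseq n 0] = rho a).
Proof.
elim: n j z => [|n IH] j z dz ez.
  pose y : V j := mk j (fun a t => if t is [::] return wm [:: a] t then rho a else 0).
  have hy a : a = src j [::] -> y`_[a, [::]] = rho a by move=> e; rewrite hat_mk e eqxx.
  exists y; split=> [a t /eqP|a e]; last by rewrite /= wc1f hy.
  rewrite size_eq0 => /eqP ->; rewrite hat_del ract_nil // scaler0 subr0.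
  case: (eqVneq (a + 1) (src j [::])) => [e|h]; first by rewrite hy // -ez // wc1f.
  rewrite !hat_off ?wc0f //; apply: contra h => /eqP ->.
  by rewrite /src; apply/eqP; ring.
have e1 : j - 1 + 1 = j + 1 - 1 by ring.
(* The last factor is augmented away, the equation is solved in arity n, and [lift_last] brings the
   solution back. *)
have [||y' [y1 y2]] := IH (j - 1) (eps R (j - 1 + 1) z).
- move=> a t ht; rewrite -eps_del // dz ?wcf0 // size_cat addn1 ht //.
- move=> a ha; rewrite hat_eps // -uw_nseq ez // ha /src !wt_nseq; lia.
have [||y [y3 y4]] := @lift_last n j z y'.
- exact: dz.
- by move=> a s hs; rewrite y1 // hat_eps.
exists y; split=> // a ha; rewrite uw_nseq y4 ?size_nseq // y2 // ha /src !wt_nseq; lia.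
Qed.

Definition part n j (y : V j) : V j := mk j (fun a t => if size t == n then y`_[a, t] else 0).
Lemma hat_part n j (y : V j) a t : (part n y)`_[a, t] = if size t == n then y`_[a, t] else 0.
Proof. by apply: hat_mk_hom => h; case: ifP => // _; exact: hat_off. Qed.

Lemma ract_D_D a t : ract D (hat (ltr D) a) t = 0.
Proof.
rewrite ract_hatD; case: t => [|b [|c t]]; rewrite ?hat_D ?rdd // hat_D0 ?wc0f //.
Qed.

(* Solutions of the equation m{m} = 0 up to arity n. *)
Record mc_state n (m : V 1) : Prop := {
  mc_nil : forall a, m`_[a, [::]] = 0;
  mc_single : forall a b, m`_[a, [:: b]] = rd a b;
  mc_above : forall a t, (n < size t)%N -> m`_[a, t] = 0;
  mc_eq : forall a t, (size t <= n)%N -> ract m (hat (ltr m) a) t = 0 }.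

Lemma ev_eq j (x y : V j) t : (forall a, x`_[a, t] = y`_[a, t]) -> ev (ltr x) t = ev (ltr y) t.
Proof. by move=> h; have := h (src j t); rewrite !hat_src => e; exact: e. Qed.

(** In arity n + 1 the new part meets m only through the differential, and its insertion into itself
    has arity 2n + 1 > n + 1. *)
Lemma mc_step n (m y : V 1) : (0 < n)%N -> mc_state n m ->
  (forall a t, size t = n.+1 -> (del y)`_[a, t] = - ract m (hat (ltr m) a) t) ->
  mc_state n.+1 (m + part n.+1 y).
Proof.
move=> n0 [m0 m1 m2 m3] hy; have p0 a t : size t <> n.+1 -> (part n.+1 y)`_[a, t] = 0.
  by move=> /eqP h; rewrite hat_part (negbTE h).
have nD a : D`_[a, [::]] = 0 by exact: hat_D0.
split=> [a|a b|a t h|a t h].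
- by rewrite hatD m0 p0 ?addr0.
- rewrite hatD m1 p0 ?addr0 // /=; lia.
- by rewrite hatD m2 ?p0 ?addr0 //; lia.
rewrite ractDl.
have hx (x : V 1) : ract x (hat (ltr (m + part n.+1 y)) a) t =
    ract x (hat (ltr m) a) t + ract x (hat (ltr (part n.+1 y)) a) t.
  by rewrite -ractD; apply: ract_ext => s _; rewrite hatD.
rewrite !hx {hx}.
move: h; rewrite leq_eqVlt => /orP[/eqP h|h]; last first.
  rewrite m3 // add0r [X in X + _](ract_trunc (y := m) (g := fun=> 0)) ?ract0 ?add0r //.
  - rewrite !ract_small ?addr0 // => J hJ; apply: ev0 => c; apply: p0; lia.
  - exact: ev0.
  - exact: ev0.
  - by move=> s hs; apply: p0; lia.
have pw (q : forall a, row C a) : ract (part n.+1 y) (q a) t =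
   ev (ltr (part n.+1 y)) t \w q a [:: src 1 t].
  by apply: ract_whole => J hJ; apply: ev0 => c; apply: p0; lia.
rewrite (pw (fun a => hat (ltr (part n.+1 y)) a)).
rewrite p0 ?wcf0 ?addr0; last by rewrite /=; lia.
have -> : ract (part n.+1 y) (hat (ltr m) a) t = ract (part n.+1 y) (hat (ltr D) a) t.
  by rewrite (pw (fun a => hat (ltr m) a)) (pw (fun a => hat (ltr D) a)) m1 hat_D.
have -> : ract m (hat (ltr (part n.+1 y)) a) t = ract D (hat (ltr (part n.+1 y)) a) t.
  apply: ract_lead => //.
  - exact: ev0.
  - by move=> b; apply: ev_eq => c; rewrite m1 hat_D.
  - by move=> s hs; apply: p0; lia.
  - by move=> s hs; apply: p0; lia.
have hp c : (del (part n.+1 y))`_[c, t] = (del y)`_[c, t].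
  by apply: del_size => c' s hs; rewrite hat_part hs h eqxx.
have := hp a; rewrite hy // hat_del (_ : K 1 = -1) ?scaleN1r ?opprK; last by rewrite /koszul expr1.
by rewrite ract_hatD -addrA [_ + ract D _ _]addrC => ->; rewrite addrN.
Qed.

Lemma del0 j : del (0 : V j) = 0.
Proof. by rewrite -(scale0r (0 : V j)) delZ scale0r. Qed.

Lemma mc_state1 : mc_state 1 D.
Proof.
split=> [a|a b|a t h|a t _]; rewrite ?hat_D ?ract_D_D ?hat_D0 //; lia.
Qed.

(** The comultiplication P -> P ⊗ P, a lift of u along the double augmentation. There is no
    obstruction yet, since D{D} = 0. *)
Lemma mc_state2 : exists m, mc_state 2 m /\ uw [:: 0; 0] \w m`_[0, [:: 0; 0]] = u.
Proof.
have [||y [y1 y2]] := @del_lift 2 1 0 uhat.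
- by move=> a t _; rewrite del0 hat0.
- move=> a ha; rewrite hat0 wcf0 (_ : a + 1 = 0) ?uhat0 ?rud //.
  by rewrite ha /src wt_nseq.
exists (D + part 2 y); split.
  apply: mc_step => //; first exact: mc_state1.
  by move=> a t ht; rewrite y1 // hat0 ract_D_D oppr0.
rewrite hatD hat_D0 // add0r hat_part [size _ == _]/=.
by rewrite -[RHS]uhat0; apply: (y2 0); rewrite /src wt_nseq.
Qed.

(** The Bianchi identity: [ract_sq] says that (m{m}){m} = m{m{m}}. As m{m} vanishes up to arity n,
    only the differential in the outer m counts in arity n + 1. *)
Lemma mc_obstruction_closed n m a t : mc_state n m -> size t = n.+1 ->
  (del (pre m m))`_[a, t] = 0.
Proof.
move=> [m0 m1 m2 m3] ht; rewrite hat_del (_ : K (1 + 1) = 1) ?scale1r; last exact: koszul_sq.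
have o0 c s : (size s <= n)%N -> (pre m m)`_[c, s] = 0 by move=> hs; rewrite hat_pre m3.
rewrite -ract_hatD -(ract_lead (x := m) (f := hat (ltr (pre m m)) a)) //; first last.
- by move=> s hs; apply: o0; lia.
- by move=> s hs; apply: o0; lia.
- by move=> b; apply: ev_eq => c; rewrite m1 hat_D.
- exact: ev0.
have -> : ract m (hat (ltr (pre m m)) a) t = ract m (ract m (hat (ltr m) a)) t.
  by apply: ract_ext => s _; rewrite hat_pre.
have pw (q : forall a, row C a) : ract (pre m m) (q a) t = ev (ltr (pre m m)) t \w q a [:: src (1 + 1) t].
  by apply: ract_whole => J hJ; apply: ev0 => c; apply: o0; lia.
rewrite ract_sq (pw (fun a => hat (ltr m) a)) (pw (fun a => hat (ltr D) a)) m1 hat_D.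
exact: subrr.
Qed.

Lemma tagged_rw_nil a J (x : wm [:: a] J) s (f : forall J, wm [:: a] J -> wm [:: a] s) :
  f _ (rw [::] x) = f _ x.
Proof. exact: (congr1 (fun p : {J & wm [:: a] J} => f (tag p) (tagged p)) (rw_nil x)). Qed.

(* Both iterated comultiplications augment to u (x) u, with opposite signs. *)
Lemma mc_obstruction3 m : mc_state 2 m -> uw [:: 0; 0] \w m`_[0, [:: 0; 0]] = u ->
  uw [:: 0; 0; 0] \w ract m (hat (ltr m) 0) [:: 0; 0; 0] = 0.
Proof.
move=> [m0 m1 m2 m3] hu; set X := m`_[0, [:: 0; 0]] in hu *.
have e : src 1 [:: 0; 0] = 0 by rewrite /src !wt_cons wt_nil.
have E0 : ev (ltr m) [::] = 0 by exact: ev0.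
have E3 (J : seq int) : (2 < size J)%N -> ev (ltr m) J = 0 by move=> hJ; apply: ev0 => c; exact: m2.
have M3 s : (2 < size s)%N -> m`_[0, s] = 0 by exact: m2.
rewrite ractE !cut_cons !cut_nil E0 (E3 [:: 0; 0; 0]) // !rw0 !LW0 !wc0f !wcast0 !scaler0.
cbn [cat]; rewrite !(M3 [:: src 1 [:: 0]; 0; 0], M3 [:: 0; src 1 [:: 0]; 0], M3 [:: 0; 0; src 1 [:: 0]]) // !wcf0 !wcast0 !scaler0 !add0r !addr0 !wcast_id.
rewrite -hat_src e -/X.
rewrite (linfunD (wc_linr _)) !(linfunZ (wc_linr _)) !wcA.
have r0 : rw [::] X = X := tagged_inj (rw_nil X).
have u1 : uw [:: 0] = u by rewrite /= uhat0 lw_id wcf1.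
have u2 : uw [:: 0; 0] = u \w lw 0 u by rewrite -{2}u1 -uhat0.
have u3 : uw [:: 0; 0; 0] = uw [:: 0; 0] \w LW [:: 0; 0] (uw [:: 0]).
  by rewrite u1 u2 /= uhat0 lw_id wcf1 lw_comp wcA.
have -> : uw [:: 0; 0; 0] \w LW [::] (rw [:: 0] X) = u \w lw 0 u.
  rewrite u3 -wcA; apply: etrans (_ : uw [:: 0; 0] \w (rw [::] X \w lw 0 (uw [:: 0])) = _).
    by congr (_ \w _); exact: esym (rw_lwhisks X (uw [:: 0])).
  by rewrite r0 wcA hu u1.
have -> : uw [:: 0; 0; 0] \w LW [:: 0] (rw [::] X) = u \w lw 0 u.
  apply: etrans (_ : uhat 0 \w lw 0 (uw [:: 0; 0]) \w lw 0 X = _).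
    by rewrite -[in RHS]r0.
  by rewrite -wcA -lw_comp hu uhat0.
rewrite -u2 hu wt_nil mulr0 wt_cons wt_nil addr0 mul1r add0r.
by rewrite /koszul expr1 expr0 scaleN1r scale1r addNr.
Qed.

(** Once augmented, the obstruction is a map from P^(n - 2) to I. Its source vanishes for n > 2, and
    n = 2 is [mc_obstruction3]. *)
Lemma mc_next n m : (1 < n)%N -> mc_state n m -> uw [:: 0; 0] \w m`_[0, [:: 0; 0]] = u ->
  exists y : V 1, forall a t, size t = n.+1 -> (del y)`_[a, t] = - ract m (hat (ltr m) a) t.
Proof.
move=> hn hm hu; have [||y [hy _]] := @del_lift n.+1 1 (- pre m m) (fun=> 0).
- by move=> a t ht; rewrite delN hatN (mc_obstruction_closed a hm ht) oppr0.
- move=> a; rewrite wc0f hatN hat_pre /src wt_nseq => ha.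
  case: (ltngtP 2 n) hn => [h _||e _]; first by rewrite [ract _ _ _](r_source R) ?oppr0 ?wcf0 //; lia.
    by case: (n) => [|[|]].
  move: ha; rewrite -e => ha; have -> : a = 0 by lia.
  rewrite -e in hm.
  by rewrite (linfunN (wc_linr _)) [_ \w _](mc_obstruction3 hm hu) oppr0.
by exists y => a t ht; rewrite hy // hatN hat_pre.
Qed.

Lemma mc_exists : exists m : V 1, [/\ forall a, m`_[a, [::]] = 0,
  forall a b, m`_[a, [:: b]] = rd a b, uw [:: 0; 0] \w m`_[0, [:: 0; 0]] = u &
  forall a t, ract m (hat (ltr m) a) t = 0].
Proof.
pose Q n (m : V 1) := mc_state n.+2 m /\ uw [:: 0; 0] \w m`_[0, [:: 0; 0]] = u.
(* Subtraction is truncated: arities up to 2 have rank 0, and step n adds a term of arity n + 3, of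
   rank n + 1. *)
have [||m hm] := @limit 1 (fun t : seq int => (size t - 2)%N) Q.
- exact: mc_state2.
- move=> n m [hm hu]; have [//|y hy] := mc_next _ hm hu.
  exists (m + part n.+3 y); split; first split.
  + exact: mc_step.
  + by rewrite hatD hat_part addr0.
  + move=> a t ht; rewrite hatD hat_part ifF ?addr0 //; apply/negP => /eqP; lia.
exists m; split=> [a|a b||a t].
- by have [m' [[h _ _ _] _] ->] := hm 0%N.
- by have [m' [[_ h _ _] _] ->] := hm 0%N.
- by have [m' [_ h] ->] := hm 0%N.
have [m' [[h0 h1 h2 h3] _] e] := hm (size t).
rewrite -(h3 a t); last by lia.
have e0 : ev (ltr m) [::] = 0 by apply: ev0 => c; rewrite e.
apply: ract_trunc => // [|J hJ|s hs].
- exact: ev0.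
- by apply: ev_eq => c; apply: e; lia.
- by apply: e; lia.
Qed.
End Lifting.

(** * The comparison morphism and the acyclicity of positive arity *)

Section BlockSum.
Variables (L : zmodType) (T : Type).

(** A dg-algebra has only b_1 and b_2, so the morphism relation reduces to one block or two; p is
    the size of the first of two. *)
Lemma sum_blocks (h : seq (seq T) -> L) (w : seq T) : w <> [::] ->
  (forall s, (size s <> 1)%N -> (size s <> 2)%N -> h s = 0) ->
  \sum_(r < (size w).+1)
      \sum_(v : r.-tuple 'I_(size w).+1 | all (fun i : 'I__ => 0 < i)%N v
                                         && (\sum_(i <- v) i == size w)%N)
        h (reshape [seq val i | i <- v] w) =
  h [:: w] + \sum_(1 <= p < size w) h [:: take p w; drop p w].
Proof.
set n := size w => w0 h0; have n0 : (0 < n)%N by rewrite /n; case: (w) w0.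
pose E r := \sum_(v : r.-tuple 'I_n.+1 | all (fun i : 'I__ => 0 < i)%N v
             && (\sum_(i <- v) i == n)%N) h (reshape [seq val i | i <- v] w).
have E0 r : r <> 1%N -> r <> 2%N -> E r = 0.
  move=> h1 h2; apply: big1 => v _; apply: h0; by rewrite size_reshape size_map size_tuple.
have E1 : E 1%N = h [:: w].
  rewrite /E (reindex_onto (fun i : 'I_n.+1 => [tuple i]) (fun v => tnth v ord0)) /=; last first.
    by move=> [[|a [|b s]] i] // _; apply/val_inj; rewrite /= (tnth_nth a).
  rewrite (big_pred1 ord_max) => [|i]; last first.
    rewrite /= big_seq1 andbT; apply/idP/eqP => [/andP[/andP[_ /eqP e] _]|->].
      exact/val_inj.
    by rewrite n0 (tnth_nth ord_max) /=; apply/andP; split; exact: eqxx.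
  by rewrite /= take_size.
have E2 : E 2%N = \sum_(1 <= p < n) h [:: take p w; drop p w].
  (* Two block sizes with sum n are determined by the first one; [inord] makes the complement an
     ordinal. *)
  rewrite /E (reindex_onto (fun i : 'I_n.+1 => [tuple i; inord (n - i)])
     (fun v => tnth v ord0)) /=; last first.
    move=> [[|a [|b [|c s]]] i] //; rewrite /= big_cons big_seq1 => /andP[_ /eqP e].
    apply/val_inj; rewrite /= (tnth_nth a) /=; congr [:: _; _].
    by apply/val_inj; rewrite /= inordK; lia.
  rewrite big_geq_mkord [RHS](big_ord_widen_cond n.+1 (fun p => 1 <= p)%N (fun p => h [:: take p w; drop p w])) //.
  apply: eq_big => [i|i _]; last first.
    rewrite /= inordK; last by rewrite ltnS leq_subr.
    by rewrite [take (n - i) _]take_oversize // size_drop.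
  rewrite /= big_cons big_seq1 /= !andbT inordK; last by rewrite ltnS leq_subr.
  have -> : tnth [tuple i; inord (n - i)] ord0 = i by rewrite (tnth_nth i).
  have := ltn_ord i; rewrite ltnS eqxx andbT => hi.
  by rewrite subnKC // eqxx andbT subn_gt0.
rewrite -[LHS]/(\sum_(r < n.+1) E r) -(big_mkord xpredT E).
rewrite big_ltn // E0 // add0r big_ltn // E1; congr (_ + _); rewrite -E2.
case: (ltnP 1 n) => hn.
  rewrite big_ltn // big_nat big1 ?addr0 // => r /andP[hr _]; apply: E0; lia.
by rewrite big_geq // E2 big_geq.
Qed.
End BlockSum.

Section Comparison.
Variables (k : comPzRingType) (C : word_cat k) (R : resolution_on C).
Local Notation wm := (@wm k C).
Local Notation K := (koszul k).
Local Notation V := (shift (cochains C)).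
Local Notation LW := (lwhisks (@lw k C)).
Local Notation rd := (rd R).
Local Notation u := (ru R).
Local Notation lwu := (lwu u).
Local Notation uw := (uw R).
Local Notation D := (D R).
Local Notation del := (del R).
Local Notation tlift := (@lift k (word V) (@multilinear k V) _).
Implicit Types (L : lmodType k) (s t r : seq int) (a b c i j : int) (w : word V).

Variable m : V 1.
Hypothesis m_nil : forall a, m`_[a, [::]] = 0.
Hypothesis m_single : forall a b, m`_[a, [:: b]] = rd a b.
Hypothesis m_unit : uw [:: 0; 0] \w m`_[0, [:: 0; 0]] = u.
Hypothesis m_mc : forall a t, ract m (hat (ltr m) a) t = 0.

Lemma br_mc j : br (ltr m) [:: ltr m] j = 0.
Proof. by apply: functional_extensionality_dep => t; exact: m_mc. Qed.

Definition comp_functional i b : functional C (wm [:: i] [:: b]) :=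
  fun s t th => wcast [:: b] (lw b th \w m`_[i, b :: s]).
Definition comparison i b w : wm [:: i] [:: b] := act w [::] (comp_functional i b).

Lemma comp_linear i b : flinear (comp_functional i b).
Proof.
move=> s t; apply: (linear_comp (@wcast_linear _ _ _ _ _)).
exact: (linear_comp (wc_linl _) (@lw_linear _ _ _ _ _)).
Qed.
Lemma comparison_multilinear i b : multilinear (comparison i b).
Proof. exact: (act_multilinear [::] (@comp_linear i b)). Qed.
Lemma comparison_nil i b : comparison i b [::] = rd i b.
Proof. by rewrite /comparison act_nil /comp_functional lw_id wcast_id m_single wc1f. Qed.
Lemma comparison_deg i b w : b <> i + 1 + wdeg w -> comparison i b w = 0.
Proof.
move=> h; rewrite -[RHS](act0 _ w [::]); apply: act_ext => s th hs.
rewrite /comp_functional hat_off ?wcf0 ?wcast0 //; apply/eqP => e; apply: h.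
by move: hs; rewrite wt_nil e /src wt_cons => hs; lia.
Qed.

Lemma ev_m0 : ev (ltr m) [::] = 0. Proof. exact: ev0. Qed.

Lemma koszulN d : K (- d) = K d.
Proof. by rewrite /koszul abszN. Qed.

(** m would be applied last, with empty target, and it has no part of arity 0. *)
Lemma comparison_mulr i b w : tlift (comparison i b) (star (@br k C) w [:: ltr m]) = 0.
Proof.
rewrite -act_star; last exact: comp_linear.
rewrite act1E !cut_nil ev_m0 /= rw0.
set P := (X in act w _ X); rewrite -[in RHS](scaler0 _ (K (1 * wt [::]))); congr (_ *: _).
rewrite -[RHS](act0 _ w [:: src 1 [::]]); apply: act_ext => s th _; rewrite /P.
by rewrite /wcc wc0f (linfun0 (@comp_linear i b _ _)).
Qed.

(** The equation m{m} = 0 at [b :: s]: insertions that avoid the head b are minus those whose block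
    contains b. *)
Lemma mc_shift i b s : act [:: ltr m] s (fun r s' th => wcast (b :: s) (lw b th \w m`_[i, b :: r])) =
  - cut (fun s1 s2 => K (wt s2) *:
      wcast (b :: s) (rw s2 (ev (ltr m) (b :: s1)) \w m`_[i, src 1 (b :: s1) :: s2])) s.
Proof.
have := m_mc i (b :: s); rewrite /ract act_cons_cons /eats cut_cons.
rewrite act_nil ev_m0 rw0 !wc0f wcast0 scaler0 add0r => /eqP; rewrite addr_eq0 => /eqP ->.
congr (- _); apply: cut_ext => s1 s2 _.
rewrite act_nil wdeg_nil subr0 lw_id mul1r; congr (_ *: wcast _ (_ \w _)); exact: wcf1.
Qed.

Definition split_functional i b (s1 s2 : seq int) : functional C (wm [:: i] [:: b]) :=
  fun s t th => K (wt s2) *: wcast [:: b] (wcc (lw b th)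
    (rw s2 (ev (ltr m) (b :: s1)) \w m`_[i, src 1 (b :: s1) :: s2])).

(** Interchange of th2 with the second application of m makes everything factor through P^c, c being
    the source of the block of b: the result is a composite of two maps of the comparison type. *)
Lemma tens_step i b s1 s2 (th1 : wm s1 [::]) (th2 : wm s2 [::]) (c := src 1 (b :: s1)) :
  lw b (tens th1 th2) \w (rw s2 (ev (ltr m) (b :: s1)) \w m`_[i, c :: s2]) =
  lw b th1 \w m`_[c, b :: s1] \w (lw c th2 \w m`_[i, c :: s2]).
Proof.
rewrite -tens_lw [LHS]wcA; apply: (etrans _ (esym (wcA _ _ _))); congr (_ \w _); rewrite hat_src.
set X : wm [:: c] (b :: s1) := ev (ltr m) (b :: s1).
rewrite /tens -[LHS]wcA.
transitivity (rw [::] (lw b th1) \w (rw [::] X \w lw c th2)).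
  congr (_ \w _); exact: (esym (rw_lwhisks X th2)).
rewrite [LHS]wcA; congr (_ \w _).
transitivity (rw [::] (lw b th1 \w X)); first by rewrite rw_comp.
exact: (tagged_inj (rw_nil (lw b th1 \w X))).
Qed.

(** [mc_shift] moves the insertion of m to a block that contains b. Cutting s after that block
    splits w by [act_split], and each part of w yields its own comparison map. *)
Lemma comparison_mull i b w : tlift (comparison i b) (star (@br k C) [:: ltr m] w) =
  - cut (fun x1 x2 => K (wdeg x1 * wdeg x2 + wdeg x2) *:
     (comparison (b - 1 - wdeg x1) b x1 \w comparison i (b - 1 - wdeg x1) x2)) w.
Proof.
rewrite -act_star; last exact: comp_linear.
transitivity (- act w [::] (fun s t th => cut (fun s1 s2 => split_functional i b s1 s2 th) s)).
  rewrite -scaleN1r -actZ; apply: act_ext => s th _; rewrite scaleN1r.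
  transitivity (lw b th \w act [:: ltr m] s (fun r s' th => wcast (b :: s) (lw b th \w m`_[i, b :: r]))).
    rewrite (act_linear _ _ _ (wc_linr _)); apply: act_ext => r eta _.
    by rewrite /comp_functional !wcast_id wcc_id lw_comp wcA.
  rewrite mc_shift (linfunN (wc_linr _)) (cut_linear _ _ (wc_linr _)); congr (- _).
  apply: cut_ext => s1 s2 _.
  by rewrite (linfunZ (wc_linr _)) /split_functional wcast_id.
rewrite act_split cut_nil; congr (- _); apply: cut_ext => x1 x2 _.
rewrite wt_nil sub0r mulrN koszulN -[K (_ + _)]mulr1 koszulD mulr1 -[RHS]scalerA; congr (_ *: _).
set c := b - 1 - wdeg x1.
rewrite (act_linear x1 [::] (comp_functional c b) (wc_linl _)) -actZ /act2.
apply: act_ext => s1 th1 h1.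
rewrite (act_linear x2 [::] (comp_functional i c) (wc_linr _)) -actZ.
apply: act_ext => s2 th2 h2; rewrite /split_functional wcc_id wcast_id.
have e1 : src 1 (b :: s1) = c by rewrite /c /src wt_cons; move: h1; rewrite wt_nil => h1; lia.
have -> : K (wt s2) = K (wdeg x2) by rewrite -koszulN; congr (K _); move: h2; rewrite wt_nil => h2; lia.
by congr (_ *: _); rewrite tens_step e1 /comp_functional !wcast_id.
Qed.

Definition binf := binf_of_mc br_mc.
Lemma comparison_diff i b w :
  \sum_(a < size w) \sum_(1 <= c < (size w - a).+1)
    K (wdeg (take a w)) *: comparison i b (insertion (binf_b (binf_str binf)) a c w) =
  - cut (fun x1 x2 => K (wdeg x1 * wdeg x2 + wdeg x2) *:
     (comparison (b - 1 - wdeg x1) b x1 \w comparison i (b - 1 - wdeg x1) x2)) w.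
Proof.
have hm := comparison_multilinear i b; have hl := linear_lift hm.
rewrite -comparison_mull; transitivity (tlift (comparison i b) (xdiff (binf_str binf) (bar w))).
  rewrite xdiff_bar (linfun_sum hl); apply: eq_bigr => a _; rewrite (linfun_sum hl).
  by apply: eq_bigr => c _; rewrite (linfunZ hl) lift_bar.
rewrite [xdiff _ _]diff_bar; last 2 first.
- exact: br_linr.
- exact: br_linl.
by rewrite (linfunD hl) (linfunN hl) (linfunZ hl) comparison_mulr scaler0 subr0.
Qed.

Lemma ev_m1 b : ev (ltr m) [:: b] = rd (src 1 [:: b]) b.
Proof. by rewrite -hat_src m_single. Qed.
Lemma ev_mnil : ev (ltr m) [::] = 0. Proof. exact: ev0. Qed.

Lemma rw_nil_id a J (x : wm [:: a] J) : wcast J (rw [::] x) = x.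
Proof. by rewrite (tagged_rw_nil x (fun J' => @wcast _ _ [:: a] J' J)) wcast_id. Qed.

Lemma lwu_rw a J (x : wm [:: a] J) : lwu J \w rw [:: 0] x = x \w lw a u.
Proof.
have e : wcast J (LW J u) = lwu J.
  elim: J {x} => [|b J IH]; first exact: wcast_id.
  by rewrite [LHS](@wcast_lw _ _ b (J ++ [:: 0]) (J ++ [::])) IH.
have := congr1 (wcast J) (rw_lwhisks x u).
by rewrite !wcast_wc rw_nil_id e => <-.
Qed.

Lemma ev_rd j (v : V j) t a : ev (ltr v) t \w rd a (src j t) = v`_[a + 1, t] \w rd a (a + 1).
Proof.
case: (eqVneq (src j t) (a + 1)) => [<-|h]; first by rewrite hat_src.
by rewrite rd_deg // wcf0 hat_off 1?eq_sym // wc0f.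
Qed.

Lemma mc2 a b c : m`_[a + 1, [:: b; c]] \w rd a (a + 1) +
  lw b (rd (c - 1) c) \w m`_[a, [:: b; c - 1]] +
  K (c + 1) *: (rw [:: c] (rd (b - 1) b) \w m`_[a, [:: b - 1; c]]) = 0.
Proof.
rewrite -[RHS](m_mc a [:: b; c]).
rewrite ractE !cut_cons !cut_nil ev_mnil !rw0 !LW0 !wc0f !wcast0 !scaler0 !add0r !addr0.
rewrite wt_nil mulr0 mul1r wt_cons wt_nil addr0 koszul0 !scale1r !wcast_id !ev_m1.
rewrite !src1 [RHS]addrAC [RHS]addrC [RHS]addrA [in RHS](tagged_inj (rw_nil (ev (ltr m) [:: b; c]))).
by rewrite /= m_single ev_rd [X in _ = X]addrAC [in RHS](tagged_inj (rw_nil (rd (c - 1) c))).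
Qed.

(* Counit constraints of the comultiplication m`_[c, [:: b; c]]. *)
Definition phi c : wm [:: c] [:: c] := rw [:: c] u \w m`_[c, [:: 0; c]].
Definition psi c : wm [:: c] [:: c] := lw c u \w m`_[c, [:: c; 0]].

Lemma rw_u_nat b c (f : wm [:: b] [:: c]) : rw [:: c] u \w lw 0 f = f \w rw [:: b] u.
Proof. exact: (rw_lwhisks u f). Qed.

Lemma unit_lw c (rho : wm [:: c] [::]) : u \w lw 0 rho = rho \w rw [:: c] u.
Proof.
rewrite -[X in X \w lw _ _](tagged_inj (rw_nil u)); exact: (rw_lwhisks u rho).
Qed.

(** In [mc2] the differential of the right factor, which [phi] keeps, has the sign +, whereas that
    of the left factor, kept by [psi], has the sign K 1 = -1. Hence [phi] anticommutes with the
    differential and [psi] commutes. *)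
Lemma phi_chain a : phi (a + 1) \w rd a (a + 1) = - (rd a (a + 1) \w phi a).
Proof.
apply/eqP; rewrite -subr_eq0 opprK; apply/eqP.
have := congr1 (fun x => rw [:: a + 1] u \w x) (mc2 a 0 (a + 1)).
rewrite wcf0 !(linfunD (wc_linr _)) (linfunZ (wc_linr _)) !wcA.
rewrite -rw_comp rud rw0 wc0f scaler0 addr0 rw_u_nat -!wcA (_ : a + 1 - 1 = a) ?[wc (rd _ _) _]wcA //.
by lia.
Qed.

Lemma psi_chain a : psi (a + 1) \w rd a (a + 1) = rd a (a + 1) \w psi a.
Proof.
apply/eqP; rewrite -subr_eq0; apply/eqP.
have := congr1 (fun x => lw (a + 1) u \w x) (mc2 a (a + 1) 0).
rewrite wcf0 !(linfunD (wc_linr _)) (linfunZ (wc_linr _)) !wcA.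
rewrite -lw_comp rud lw0 wc0f addr0 (_ : K (0 + 1) = -1) ?scaleN1r; last exact: expr1.
have -> : lw (a + 1) u \w rw [:: 0] (rd (a + 1 - 1) (a + 1)) = rd (a + 1 - 1) (a + 1) \w lw (a + 1 - 1) u.
  exact: (lwu_rw (rd (a + 1 - 1) (a + 1))).
by rewrite -!wcA (_ : a + 1 - 1 = a) //; lia.
Qed.

Lemma uw1 : uw [:: 0] = u. Proof. by rewrite /= uhat0 lw_id wcf1. Qed.
Lemma uw2 : uw [:: 0; 0] = u \w lw 0 u. Proof. by rewrite -{2}uw1 -uhat0. Qed.
Lemma phi_unit : u \w phi 0 = u.
Proof.
rewrite /phi wcA -[RHS]m_unit uw2; congr (_ \w _); exact: (lwu_rw u).
Qed.
Lemma psi_unit : u \w psi 0 = u.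
Proof. by rewrite /psi wcA -[RHS]m_unit uw2. Qed.

Lemma ract_D1 q (f : forall s, wm q s) b : ract D f [:: b] = rd (b - 1) b \w f [:: b - 1].
Proof.
rewrite -[X in ract D f X]/([::] ++ [:: b]) ract_D_last actD_nil ?addr0 //; exact: D_last_functional.
Qed.

(* A chain endomorphism of the resolution that lifts the identity is homotopic
   to it, hence acts as the identity on classes of functionals. *)
Lemma lift_id_homotopy (f : forall a, wm [:: a] [:: a]) c (rho : wm [:: c] [::]) :
  (forall a, f (a + 1) \w rd a (a + 1) = rd a (a + 1) \w f a) -> u \w f 0 = u ->
  rho \w rd (c - 1) c = 0 ->
  exists sigma : wm [:: c + 1] [::], rho \w f c = rho + sigma \w rd c (c + 1).
Proof.
move=> hf f0 hrho.
pose g : forall a, row C a := fun a t => if t is [:: b] return wm [:: a] t then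
  wcast [:: b] (f a - wid [:: a]) else 0.
have hg a b : (mk 0 g : V (-1 + 1))`_[a, [:: b]] = wcast [:: b] (f a - wid [:: a]).
  rewrite hat_mk_hom // => h; apply: wcast_neq; apply: contra h => /eqP [->].
  by rewrite /src wt_cons wt_nil; apply/eqP; ring.
have [||y [hy _]] := @del_lift k C R 1 (-1) (mk 0 g : V (-1 + 1)) (fun=> 0).
- move=> a [|b [|? ?]] // _; rewrite hat_del hg ract_D1 hg scale1r.
  case: (eqVneq b (a + 1)) => [->|h].
    rewrite (_ : a + 1 - 1 = a) ?wcast_id; last by lia.
    by rewrite (linfunD (wc_linl _)) (linfunN (wc_linl _)) (linfunD (wc_linr _)) (linfunN (wc_linr _)) hf wc1f wcf1 subrr.
  rewrite !wcast_neq ?wc0f ?wcf0 ?subrr //; apply: contra h => /eqP [] e; apply/eqP; rewrite e; lia.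
- move=> a; rewrite /src wt_cons wt_nil => ha; have -> : a = 0 by lia.
  by rewrite hg wcast_id wc0f -[nseq _ _]/[:: 0] uw1 (linfunD (wc_linr _)) (linfunN (wc_linr _)) f0 wcf1 subrr.
have := hy c [:: c] erefl; rewrite hg wcast_id hat_del ract_D1.
move=> /(congr1 (fun x => rho \w x)).
rewrite (linfunD (wc_linr _)) (linfunN (wc_linr _)) (linfunZ (wc_linr _)) !wcA hrho wc0f scaler0 subr0.
rewrite (linfunD (wc_linr _)) (linfunN (wc_linr _)) wcf1 => e.
by exists (rho \w y`_[c + 1, [:: c]]); rewrite e addrC addrNK.
Qed.

Lemma psi_homotopy c (rho : wm [:: c] [::]) : rho \w rd (c - 1) c = 0 ->
  exists sigma : wm [:: c + 1] [::], rho \w psi c = rho + sigma \w rd c (c + 1).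
Proof. exact: lift_id_homotopy psi_chain psi_unit. Qed.
(** The sign K c turns the anticommuting [phi] into a chain map. *)
Lemma phi_homotopy c (rho : wm [:: c] [::]) : rho \w rd (c - 1) c = 0 ->
  exists sigma : wm [:: c + 1] [::], rho \w phi c = K c *: rho + sigma \w rd c (c + 1).
Proof.
move=> h; have [||sigma hs] := @lift_id_homotopy (fun c => K c *: phi c) c rho _ _ h.
- move=> a; rewrite (linfunZ (wc_linl _)) (linfunZ (wc_linr _)) phi_chain koszulS scaleNr scalerN.
  by rewrite opprK.
- by rewrite koszul0 scale1r phi_unit.
exists (K c *: sigma).
by rewrite (linfunZ (wc_linl _)) -scalerDr -hs (linfunZ (wc_linr _)) koszul_inv.
Qed.

(** * The differential b_1 of B and the acyclicity of positive arity *)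

Definition q j (v : V j) : V (j + 1) :=
  mk (j + 1) (fun a t => ract v (hat (ltr m) a) t - K j *: ract m (hat (ltr v) a) t).
Lemma hat_q j (v : V j) a t :
  (q v)`_[a, t] = ract v (hat (ltr m) a) t - K j *: ract m (hat (ltr v) a) t.
Proof.
rewrite hat_mk_hom // => h; rewrite !ract_hom ?scaler0 ?subrr //; by rewrite addrC.
Qed.
Lemma qD j (x y : V j) : q (x + y) = q x + q y.
Proof.
apply: V_ext => a t; rewrite hatD !hat_q ractDl addrACA -opprD -scalerDr -ractD.
by congr (_ - _ *: _); apply: ract_ext => s _; rewrite hatD.
Qed.
Lemma qN j (x : V j) : q (- x) = - q x.
Proof.
apply: V_ext => a t; rewrite hatN !hat_q (linfunN (@ract_lin _ _ _ _ _ _)) opprD; congr (_ + _).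
by congr (- _); rewrite -scalerN -ractN; congr (_ *: _); apply: ract_ext => s _; rewrite hatN.
Qed.
Lemma qB j (x y : V j) : q (x - y) = q x - q y.
Proof. by rewrite qD qN. Qed.

Lemma q_nil j (v : V j) a : (q v)`_[a, [::]] = v`_[a + 1, [::]] \w rd a (a + 1).
Proof.
rewrite hat_q [ract m _ _]ract_nil; last exact: ev_mnil.
by rewrite scaler0 subr0 ract_whole // m_single ev_rd.
Qed.

Lemma q_lead j (v : V j) a t : (forall a s, (size s < size t)%N -> v`_[a, s] = 0) ->
  (q v)`_[a, t] = (del v)`_[a, t].
Proof.
move=> h; rewrite hat_q hat_del ract_whole => [|J hJ]; last by apply: ev0 => c; exact: h.
rewrite m_single ev_rd; congr (_ - _ *: _); apply: ract_lead => // [|b|s|s]; try exact: h.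
- exact: ev_mnil.
- by apply: ev_eq => c; rewrite m_single hat_D.
Qed.

Lemma q_trunc j (x y : V j) n : (forall a, x`_[a, [::]] = 0) -> (forall a, y`_[a, [::]] = 0) ->
  (forall a t, (size t <= n)%N -> x`_[a, t] = y`_[a, t]) ->
  forall a t, (size t <= n)%N -> (q x)`_[a, t] = (q y)`_[a, t].
Proof.
move=> x0 y0 h a t ht; rewrite !hat_q; congr (_ - _ *: _); apply: ract_trunc => //;
  try (by apply: ev0); try exact: ev_mnil.
- by move=> J hJ; apply: ev_eq => c; apply: h; lia.
- by move=> s hs; apply: h; lia.
Qed.

Local Notation Q := (binf_b (binf_str binf)).
Lemma Q1 j (v : V j) : Q [:: ltr v] (j + 1) = q v.
Proof.
have e : j + 1 = tag (ltr m) + wdeg [:: ltr v] by rewrite wdeg_ltr addrC.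
have e' : j + 1 = tag (ltr v) + wdeg [:: ltr m] by rewrite wdeg_ltr.
rewrite [LHS]twist_b1; apply: V_ext => a t; rewrite hatD hatN hatZ !ltr_eq //.
rewrite !hat_brl hat_q; congr (_ - _).
Qed.
Lemma q_sq j (v : V j) : q (q v) = 0.
Proof.
have := binf_b_rel (binf_str binf) [:: ltr v] (j + 1 + 1).
rewrite /ainf_sum big_ord1 big_nat1 /insertion [take _ _]/= [take _ _]/= [drop _ _]/= wdeg_nil scale1r.
by rewrite (value_eq _ _ (wdeg_ltr v)) /= !Q1.
Qed.

(** A block one letter shorter than the word is at its beginning or at its end; in the first case z
    passes the last letter c. *)
Lemma ract_corank1 j (z : V j) p (f : forall s, wm p s) b s s' c : b :: s = s' ++ [:: c] ->
  (forall J, size J <> size s -> ev (ltr z) J = 0) -> (0 < size s)%N ->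
  ract z f (b :: s) =
    K (j * (c + 1)) *: wcast (b :: s) (rw [:: c] (ev (ltr z) s') \w f [:: src j s'; c]) +
    lw b (wcast s (rw [::] (ev (ltr z) s))) \w f [:: b; src j s].
Proof.
move=> e hz s0; have es : size s = size s'.
  by have := congr1 size e; rewrite size_cat /= addn1 => -[].
have hJ J x : size J <> size s -> wcast (b :: s) (rw x (ev (ltr z) J)) = 0.
  by move=> h; rewrite hz // rw0 wcast0.
rewrite ractE cut_cons; congr (_ + _).
  rewrite [X in cut _ X]e cut_rcons hz ?rw0 ?wc0f ?wcast0 ?scaler0 ?addr0; last first.
    by rewrite size_cat addn1 es => h; lia.
  rewrite cut_only_full => [|J r er r0]; last first.
    rewrite hz ?rw0 ?wc0f ?wcast0 ?scaler0 // es -er size_cat.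
    by case: r r0 {er} => // ? ? _ /=; lia.
  by rewrite /= wt_cons wt_nil addr0.
rewrite cut_only_nil => [|t0 r er r0]; last first.
  apply: cut_eq0 => J r' er'; rewrite hz ?rw0 ?LW0 ?wc0f ?wcast0 ?scaler0 // -er -er' !size_cat.
  by case: t0 r0 {er} => // ? ? _ /=; lia.
rewrite cut_only_full => [|J r er r0]; last first.
  rewrite hz ?rw0 ?LW0 ?wc0f ?wcast0 ?scaler0 // -er size_cat.
  by case: r r0 {er} => // ? ? _ /=; lia.
rewrite wt_nil mulr0 koszul0 scale1r wcast_wc /=; congr (_ \w _).
exact: (@wcast_lw _ _ b [:: src j s] (s ++ [::]) s).
Qed.

Lemma uw_wcast t t' p (x : wm p t') : t' = t -> uw t \w wcast t x = uw t' \w x.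
Proof. by move=> e; case: t / e; rewrite wcast_id. Qed.

Lemma uw_m2 t0 r : uw (t0 ++ (0 :: 0 :: r)) \w LW t0 (rw r (m`_[0, [:: 0; 0]])) = uw (t0 ++ 0 :: r).
Proof.
elim: t0 => [|b t0 IH] /=; last by rewrite -wcA -lw_comp IH.
set X := m`_[0, [:: 0; 0]]; rewrite !uhat0.
have -> : u \w lw 0 (u \w lw 0 (uw r)) = uw [:: 0; 0] \w LW [:: 0; 0] (uw r).
  by rewrite uw2 /= lw_comp wcA.
rewrite -wcA; have -> : LW [:: 0; 0] (uw r) \w rw r X = rw [::] X \w lw 0 (uw r).
  exact: esym (rw_lwhisks X (uw r)).
by rewrite (tagged_inj (rw_nil X)) wcA m_unit.
Qed.

(** The N pairs of neighbours in a word of N + 1 letters are counted with alternating signs. *)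
Lemma cut_pairs N : cut (fun t0 r => cut (fun J r' => if size J == 2%N then K (wt r') else 0 : k^o) r)
  (nseq N.+1 (0 : int)) = (odd N)%:R.
Proof.
elim: N => [|N IH]; first by rewrite /= !cut_cons !cut_nil /= !addr0.
rewrite [LHS]cut_cons [X in _ + X]IH [X in X + _]/= !cut_cons !add0r.
rewrite cut_only_nil; last by move=> [|x s] t.
rewrite [LHS]/= wt_nseq /koszul -signr_odd oddS; case: (odd N); rewrite ?expr1 ?addNr ?expr0 ?addr0 //.
Qed.

Lemma cat_nseq (T : Type) (x : T) N (s t : seq T) : s ++ t = nseq N x -> s = nseq (size s) x /\ t = nseq (size t) x.
Proof.
elim: s N => [|y s IH] N; first by move=> /= ->; rewrite size_nseq.
by case: N => // N [-> /IH [e1 e2]]; split; rewrite // [in LHS]e1.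
Qed.

(** f lives in arity n + 1, so only the comultiplication leads to arity n + 2. By [uw_m2] all its
    positions contribute alike, up to the signs counted by [cut_pairs]. *)
Lemma uw_ract_m n p (f : forall s, wm p s) : (forall s, size s <> n.+1 -> f s = 0) ->
  uw (nseq n.+2 0) \w ract m f (nseq n.+2 0) = (odd n.+1)%:R *: (uw (nseq n.+1 0) \w f (nseq n.+1 0)).
Proof.
move=> hf; set rho := uw (nseq n.+1 0) \w _.
have hl : linear (fun c : k^o => c *: rho) by move=> c x y; rewrite scalerDl scalerA.
rewrite -cut_pairs (cut_linear _ _ hl) ractE (cut_linear _ _ (wc_linr _)).
apply: cut_ext => t0 r er; rewrite (cut_linear _ _ hl) (cut_linear _ _ (wc_linr _)).
apply: cut_ext => J r' er'; rewrite (linfunZ (wc_linr _)).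
have es : (size t0 + (size J + size r') = n.+2)%N.
  by rewrite -!size_cat er' er size_nseq.
case: eqP => hJ; last first.
  by rewrite hf ?wcf0 ?wcast0 ?wcf0 ?scaler0 ?scale0r // size_cat /=; lia.
rewrite mul1r; congr (_ *: _); move: er; rewrite -er' => er.
have [e0 e1] := cat_nseq er; have [eJ er0] := cat_nseq e1; rewrite hJ in eJ.
rewrite eJ in er *; rewrite uw_wcast // -hat_src.
have -> : src 1 (nseq 2 0) = 0 by rewrite /src wt_nseq.
rewrite wcA uw_m2; suff -> : t0 ++ 0 :: r' = nseq n.+1 0 by [].
rewrite e0 er0.
rewrite -[0 :: _]/(nseq (size r').+1 0) -nseqD; congr nseq; lia.
Qed.

Lemma uw_ract_D p (f : forall s, wm p s) n : uw (nseq n 0) \w ract D f (nseq n 0) = 0.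
Proof.
elim: n f => [|n IH] f; first by rewrite ract_nil ?wcf0.
by rewrite -nseq_rcons uw_rcons -wcA lwu_ract (linfunN (wc_linr _)) IH oppr0.
Qed.
Lemma uw_del j (z : V j) n a : uw (nseq n 0) \w (del z)`_[a, nseq n 0] =
  uw (nseq n 0) \w z`_[a + 1, nseq n 0] \w rd a (a + 1).
Proof.
rewrite hat_del (linfunD (wc_linr _)) (linfunN (wc_linr _)) (linfunZ (wc_linr _)) uw_ract_D.
by rewrite scaler0 subr0 wcA.
Qed.

(** In m{z} only the comultiplication counts, with z applied to one of its two factors and u to the
    other, which gives [phi] and [psi]. The other half of the commutator, z{m}, is [uw_ract_m]. *)
Lemma uw_q n j (z : V j) (c := src j (nseq n.+1 0)) (rho := uw (nseq n.+1 0) \w z`_[c, nseq n.+1 0]) :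
  (forall a t, size t <> n.+1 -> z`_[a, t] = 0) ->
  uw (nseq n.+2 0) \w (q z)`_[c, nseq n.+2 0] =
  rho \w phi c + K j *: (rho \w psi c) - K j *: ((odd n.+1)%:R *: rho).
Proof.
move=> hz; have e : 0 :: nseq n.+1 0 = nseq n.+1 0 ++ [:: (0 : int)] by rewrite nseq_rcons.
rewrite hat_q (linfunD (wc_linr _)) (linfunN (wc_linr _)) (linfunZ (wc_linr _)).
rewrite uw_ract_m //; last by move=> s; exact: hz.
congr (_ - _); rewrite -[nseq n.+2 0]/(0 :: nseq n.+1 0) (ract_corank1 _ e) ?size_nseq //; last first.
  by move=> J hJ; apply: ev0 => a; exact: hz.
rewrite (linfunD (wc_linr _)) (linfunZ (wc_linr _)) addrC -!hat_src -/c; congr (_ + _).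
  rewrite rw_nil_id; set mc := m`_[c, _].
  transitivity (uhat R 0 \w lw 0 (uw (nseq n.+1 0)) \w (lw 0 z`_[c, nseq n.+1 0] \w mc)); first by [].
  rewrite uhat0 -wcA [lw 0 _ \w (_ \w _)]wcA -lw_comp -/rho /mc.
  have -> : u \w (lw 0 rho \w m`_[c, [:: 0; c]]) = rho \w rw [:: c] u \w m`_[c, [:: 0; c]].
    by rewrite wcA unit_lw.
  by rewrite /phi wcA.
rewrite add0r mulr1; congr (_ *: _); rewrite uw_wcast // uw_rcons -wcA.
by rewrite [lwu _ \w (_ \w _)]wcA lwu_rw /rho /psi !wcA.
Qed.

(* The alternating sum of n + 1 terms, n + 1 odd, leaves a single copy of z. *)
Lemma uw_q_class n j (z : V j) (c := src j (nseq n.+1 0)) : ~~ odd n ->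
  (forall a t, size t <> n.+1 -> z`_[a, t] = 0) ->
  (uw (nseq n.+1 0) \w z`_[c, nseq n.+1 0]) \w rd (c - 1) c = 0 ->
  exists sigma : wm [:: c + 1] [::], uw (nseq n.+2 0) \w (q z)`_[c, nseq n.+2 0] =
    K j *: (uw (nseq n.+1 0) \w z`_[c, nseq n.+1 0]) + sigma \w rd c (c + 1).
Proof.
move=> hn hz hr; rewrite uw_q // -/c; set rho := uw _ \w _ in hr *.
have [s1 ->] := phi_homotopy hr.
have [s2 ->] := psi_homotopy hr.
(* Here c = n - j with n even. *)
have -> : K c = K j.
  rewrite /c /src wt_nseq -(mulr1 (K j)) -(koszul_sq k j) mulrC -!koszulD /koszul -[LHS]signr_odd -[RHS]signr_odd.
  congr (_ ^+ nat_of_bool _); move: hn; lia.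
exists (s1 + K j *: s2).
rewrite oddS hn scale1r (linfunD (wc_linl _)) (linfunZ (wc_linl _)) scalerDr.
by rewrite addrACA addrAC addrK.
Qed.

Definition supp n j (v : V j) := forall a t, (size t < n)%N -> v`_[a, t] = 0.
Lemma suppD n j (x y : V j) : supp n x -> supp n y -> supp n (x + y).
Proof. by move=> hx hy a t h; rewrite hatD hx // hy // addr0. Qed.
Lemma suppN n j (x : V j) : supp n x -> supp n (- x).
Proof. by move=> hx a t h; rewrite hatN hx // oppr0. Qed.
Lemma supp_le n n' j (x : V j) : (n <= n')%N -> supp n' x -> supp n x.
Proof. by move=> h hx a t ht; apply: hx; lia. Qed.
Lemma suppS n j (x : V j) : supp n x -> (forall a t, size t = n -> x`_[a, t] = 0) -> supp n.+1 x.
Proof. by move=> hx h a t; rewrite ltnS leq_eqVlt => /orP [/eqP|]; [exact: h|exact: hx]. Qed.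
Lemma supp_part n j (x : V j) : supp n (part n x).
Proof. by move=> a t h; rewrite hat_part; case: eqP => // e; lia. Qed.
Lemma q_lead_supp n j (v : V j) a t : supp n v -> size t = n -> (q v)`_[a, t] = (del v)`_[a, t].
Proof. by move=> h e; apply: q_lead => c s hs; apply: h; lia. Qed.
Lemma supp_q n j (v : V j) : supp n v -> supp n (q v).
Proof.
move=> h a t ht; rewrite q_lead => [|c s hs]; last by apply: h; lia.
rewrite (@del_size _ _ R _ v 0) ?del0 ?hat0 // => c s hs; rewrite hat0 h //; lia.
Qed.

(** Parts of arity above n + 1 change the class only by a coboundary, by [uw_del]. *)
Lemma uw_q_class_supp n j (w : V j) (c := src j (nseq n.+1 0)) : ~~ odd n -> supp n.+1 w ->
  (forall a t, size t = n.+1 -> (del w)`_[a, t] = 0) ->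
  exists sigma : wm [:: c + 1] [::], uw (nseq n.+2 0) \w (q w)`_[c, nseq n.+2 0] =
    K j *: (uw (nseq n.+1 0) \w w`_[c, nseq n.+1 0]) + sigma \w rd c (c + 1).
Proof.
move=> hn hw hd; pose p := part n.+1 w; pose r := w - p.
have pE a : p`_[a, nseq n.+1 0] = w`_[a, nseq n.+1 0] by rewrite hat_part size_nseq eqxx.
have [||sigma] := uw_q_class (z := p) hn.
- by move=> a t ht; rewrite hat_part; case: eqP.
- rewrite pE; have := uw_del w n.+1 (c - 1); rewrite subrK => <-.
  by rewrite hd ?wcf0 ?size_nseq.
rewrite -/c pE => e; exists (sigma + uw (nseq n.+2 0) \w r`_[c + 1, nseq n.+2 0]).
have hr : supp n.+2 r.
  apply: suppS => [|a t ht]; last by rewrite hatD hatN hat_part ht eqxx subrr.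
  by apply: suppD hw (suppN _); exact: supp_part.
have -> : q w = q p + q r by rewrite -qD [p + r]addrC /r subrK.
rewrite hatD (linfunD (wc_linr _)) e (q_lead_supp _ hr) ?size_nseq //.
by rewrite uw_del (linfunD (wc_linl _)) addrA.
Qed.

(** Injectivity on cohomology of the augmentation to Hom(P, I) in arity n, with a primitive
    supported in arity n. *)
Lemma lift_exact n j (w : V (j + 1)) c (tau : wm [:: c + 1] [::]) : c + 1 = src j (nseq n 0) ->
  (forall a t, size t = n -> (del w)`_[a, t] = 0) ->
  uw (nseq n 0) \w w`_[c, nseq n 0] = tau \w rd c (c + 1) ->
  exists y : V j, supp n y /\ forall a t, size t = n -> (del y)`_[a, t] = w`_[a, t].
Proof.
move=> hc hd ht; pose rho a : wm [:: a] [::] := tcast (F := fun a => wm [:: a] [::]) a tau.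
have [|y [y1 _]] := @del_lift _ _ R n j w rho hd.
  move=> a ha; have e : a = c by apply: (@addIr _ 1); rewrite ha -hc.
  by rewrite e ht /rho (@tcast_id k int (fun a => wm [:: a] [::])).
exists (part n y); split=> [|a t ht']; first exact: supp_part.
by rewrite -y1 //; apply: del_size => b s hs; rewrite hat_part hs ht' eqxx.
Qed.

(** Surjectivity on cohomology of the same augmentation. *)
Lemma lift_cocycle n j c (tau : wm [:: c] [::]) : c = src j (nseq n 0) -> tau \w rd (c - 1) c = 0 ->
  exists y : V j, [/\ forall a t, size t <> n -> y`_[a, t] = 0,
    forall a t, size t = n -> (del y)`_[a, t] = 0 & uw (nseq n 0) \w y`_[c, nseq n 0] = tau].
Proof.
move=> hc ht; pose rho a : wm [:: a] [::] := tcast (F := fun a => wm [:: a] [::]) a tau.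
have rhoE : rho c = tau by exact: (@tcast_id k int (fun a => wm [:: a] [::])).
have [||y [y1 y2]] := @del_lift _ _ R n j 0 rho.
- by move=> a t _; rewrite del0 hat0.
- move=> a ha; rewrite hat0 wcf0; have -> : a = c - 1 by rewrite hc -ha addrK.
  by rewrite subrK rhoE ht.
exists (part n y); split=> [a t h|a t h|].
- by rewrite hat_part; case: eqP.
- transitivity ((0 : V (j + 1))`_[a, t]); last exact: hat0.
  rewrite -y1 //; apply: del_size => b s hs; by rewrite hat_part hs h eqxx.
- by rewrite hat_part size_nseq eqxx y2.
Qed.

(** Up to sign and coboundary, the class of the leading part is the class of the arity n + 2 part of
    q w, which is 0. So the leading part is exact for [del]. *)
Lemma clear_odd_arity n j (w : V (j + 1)) : ~~ odd n -> supp n.+1 w -> q w = 0 ->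
  exists z : V j, supp n.+1 z /\ supp n.+2 (w - q z).
Proof.
move=> hn hw hq; have hd a t : size t = n.+1 -> (del w)`_[a, t] = 0.
  by move=> ht; rewrite -(q_lead_supp _ hw) // hq hat0.
set c := src (j + 1) (nseq n.+1 0).
have [sigma] := uw_q_class_supp hn hw hd; rewrite -/c hq hat0 wcf0 => /esym/eqP.
rewrite addr_eq0 => /eqP e.
have [||z [z1 z2]] := @lift_exact n.+1 j w c (- (K (j + 1) *: sigma)) _ hd.
  - by rewrite /c /src; ring.
  - by rewrite -[LHS](koszul_inv (j + 1)) e (linfunN (wc_linl _)) (linfunZ (wc_linl _)) scalerN.
exists z; split=> //; apply: suppS; first by apply: suppD hw (suppN _); exact: supp_q.
by move=> a t ht; rewrite hatD hatN (q_lead_supp _ z1) // z2 // subrr.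
Qed.

(** The class tau of the leading part is also that of q z, for a z of arity n + 1 closed for [del].
    After q z is subtracted, the leading part is exact and y removes it. *)
Lemma clear_even_arity n j (w : V (j + 1)) : ~~ odd n -> supp n.+2 w -> q w = 0 ->
  exists z : V j, supp n.+1 z /\ supp n.+3 (w - q z).
Proof.
move=> hn hw hq; have hd (w' : V (j + 1)) : supp n.+2 w' -> q w' = 0 ->
    forall a t, size t = n.+2 -> (del w')`_[a, t] = 0.
  by move=> h h' a t ht; rewrite -(q_lead_supp _ h) // h' hat0.
set c := src j (nseq n.+1 0).
set tau := uw (nseq n.+2 0) \w w`_[c, nseq n.+2 0].
have htau : tau \w rd (c - 1) c = 0.
  have := uw_del w n.+2 (c - 1); rewrite subrK -/tau => <-.
  by rewrite hd ?wcf0 ?size_nseq.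
have [|z [z0 z1 z2]] := @lift_cocycle n.+1 j c (K j *: tau) erefl.
  by rewrite (linfunZ (wc_linl _)) htau scaler0.
have z3 : supp n.+1 z by move=> a t ht; apply: z0; lia.
have [sigma] := uw_q_class_supp hn z3 z1; rewrite -/c z2 koszul_inv => e.
have qz : supp n.+2 (q z).
  by apply: suppS; [exact: supp_q|move=> a t ht; rewrite (q_lead_supp _ z3) // z1].
have hw' : supp n.+2 (w - q z) by apply: suppD hw (suppN qz).
have hq' : q (w - q z) = 0 by rewrite qB hq q_sq // subrr.
have [||y [y1 y2]] := @lift_exact n.+2 j (w - q z) c (- sigma) _ (hd _ hw' hq').
- by rewrite /c /src !wt_nseq; lia.
- by rewrite hatD hatN (linfunD (wc_linr _)) (linfunN (wc_linr _)) e -/tau opprD addNKr (linfunN (wc_linl _)).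
exists (z + y); split.
  by apply: suppD z3 _; exact: supp_le y1.
rewrite qD opprD addrA; apply: suppS; first by apply: suppD hw' (suppN (supp_q y1)).
by move=> a t ht; rewrite hatD hatN (q_lead_supp _ y1) // y2 // subrr.
Qed.

Lemma acyclic j (w : V (j + 1)) : supp 1 w -> q w = 0 -> exists z : V j, supp 1 z /\ q z = w.
Proof.
move=> hw hq.
(* Each step clears one odd and one even arity. Step N adds terms of arity at least 2N + 1, that is,
   of rank above N. *)
have step N (y : V j) : supp 1 y /\ supp N.*2.+1 (w - q y) ->
    exists y', (supp 1 y' /\ supp N.+1.*2.+1 (w - q y')) /\
      forall a t, (uphalf (size t) <= N)%N -> y'`_[a, t] = y`_[a, t].
  move=> [y1 yN]; have hN : ~~ odd N.*2 by rewrite odd_double.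
  have h1 : q (w - q y) = 0 by rewrite qB hq q_sq // subrr.
  have [z1 [z1N e1]] := clear_odd_arity hN yN h1.
  have h2 : q (w - q y - q z1) = 0 by rewrite qB h1 q_sq // subrr.
  have [z2 [z2N e2]] := clear_even_arity hN e1 h2.
  exists (y + (z1 + z2)); split; first split.
  - by apply: suppD => //; apply: suppD; [exact: supp_le z1N|exact: supp_le z2N].
  - rewrite doubleS !qD; move: e2; move: (q y) (q z1) (q z2) => x1 x2 x3.
    by rewrite !opprD !addrA.
  - move=> a t ht; rewrite !hatD z1N ?z2N ?addr0 //; lia.
have [|y hy] := limit (ex_intro _ 0 _) step.
  by split=> [a t _|]; [exact: hat0|rewrite (_ : q 0 = 0) ?subr0 // -(subrr 0) qB subrr].
have y1 : supp 1 y.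
  by move=> a t ht; have [y' [h _] ->] := hy 0%N; [exact: h|lia].
exists y; split=> //; apply: V_ext => a t.
have [y' [h1 h2] e] := hy (uphalf (size t)).
transitivity ((q y')`_[a, t]).
  apply: (q_trunc (n := size t)) => //.
  - by move=> b; apply: y1.
  - by move=> b; apply: h1.
  - by move=> b s hs; apply: e; exact: uphalf_leq.
have := h2 a t; rewrite hatD hatN => h; apply/eqP; rewrite eq_sym -subr_eq0; apply/eqP/h.
lia.
Qed.
End Comparison.

(** * The quasi-isomorphism to the endomorphism dg-algebra *)

Section Signs.
Variable k : comPzRingType.
Local Notation K := (koszul k).
(* (-1)^(d(d-1)/2): the sign of the decalage between dg-algebra and bar conventions. *)
Definition bisign (d : int) : k := K ((d * (d - 1)) %/ 2)%Z.
Lemma half_even (d : int) : ((d * (d - 1)) %/ 2)%Z * 2 = d * (d - 1).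
Proof.
apply: divzK; case: (intP d) => [|n|n]; rewrite ?mul0r //.
  rewrite dvdzE abszM; have := odd_double_half n; lia.
have := odd_double_half n; lia.
Qed.
Lemma bisignD d e : bisign (d + e) = bisign d * bisign e * K (d * e).
Proof.
rewrite /bisign -!koszulD; congr (K _).
have := half_even d; have := half_even e; have := half_even (d + e).
have -> : (d + e) * (d + e - 1) = d * (d - 1) + e * (e - 1) + (d * e) * 2 by ring.
lia.
Qed.
Lemma bisign1 : bisign 1 = 1. Proof. by rewrite /bisign subrr mulr0 div0z. Qed.
Lemma bisignS d : bisign (d + 1) = bisign d * K d.
Proof. by rewrite bisignD bisign1 !mulr1. Qed.
End Signs.

Section Morphism.
Variables (k : comPzRingType) (A : klinear_monoidal_category k).
Hypothesis ab : abelian A.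
Hypothesis flat : forall Q : A, projective Q ->
       exact_functor (F := fun X : A => mon_tens Q X)
         (fun (X Y : A) (f : mor X Y) => mon_tensm (idm Q) f).
Variable P : projective_resolution (mon_unit A).
Let C := tword_cat P.
Let R := resolution ab flat P.
Local Notation wm := (@wm k C).
Local Notation K := (koszul k).
Local Notation V := (shift (cochains C)).
Local Notation E := (shift (end_dga P)).
Local Notation rd := (rd R).
Local Notation u := (ru R).
Local Notation bis := (bisign k).
Implicit Types (a b c i j : int) (w : word V).

(** The object of the word [[:: b]] is P^b ⊗ I, so endomorphisms of P correspond to cochains of
    arity 1 through the right unitor. *)
Definition toend i b (x : wm [:: i] [:: b]) : mor (P i) (P b) :=
  mon_runit (P b) \c x \c inv_of (mon_runit_iso (P i)).
Definition fromend i b (y : mor (P i) (P b)) : wm [:: i] [:: b] := mon_tensm y (idm (mon_unit A)).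
Lemma toend_linear i b : linear (@toend i b).
Proof. by move=> a x y; rewrite /toend (comp_linearr _) (comp_linearl _). Qed.
Lemma toend_comp i b c (y : wm [:: b] [:: c]) (x : wm [:: i] [:: b]) :
  toend (y \w x) = toend y \c toend x.
Proof.
have e (X Y Z T U S : A) (r : mor Z T) (g : mor Y Z) (f : mor X Y) (q : mor U X)
    (s : mor Y S) (s' : mor S Y) : s' \c s = idm Y ->
  r \c (g \c f) \c q = r \c g \c s' \c (s \c f \c q).
  by move=> h; rewrite !compA -[_ \c s' \c s]compA h compf1.
exact: e (inv_ofK _).
Qed.
Lemma fromendK i b : cancel (@fromend i b) (@toend i b).
Proof. by move=> y; rewrite /toend /fromend mon_runit_nat -compA inv_ofVK compf1. Qed.
Lemma toendK i b : cancel (@toend i b) (@fromend i b).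
Proof.
move=> x; apply: (iso_monic (mon_runit_iso _)); rewrite /fromend mon_runit_nat /toend.
by rewrite -compA inv_ofK compf1.
Qed.

Definition dmor i b : mor (P i) (P b) :=
  component b (@ltr k (fun j => mor (P i) (P j)) (i + 1) (cpx_d P i)).
Lemma toend_rd i b : toend (rd i b) = dmor i b.
Proof.
rewrite /= /dtot /dmor; case: (eqVneq b (i + 1)) => [->|h].
  rewrite component_ltr wcast_id; exact: (fromendK (cpx_d P i)).
rewrite component_neq 1?eq_sym // wcast_neq ?(linfun0 (@toend_linear _ _)) //.
by apply: contra h => /eqP [->].
Qed.

Lemma end_ext n (f g : end_mod P n) : (forall i, entry f i (i + n) = entry g i (i + n)) -> f = g.
Proof.
move=> h; apply: functional_extensionality_dep => i.
by have := h i; rewrite /entry !component_ltr.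
Qed.

Lemma fromend_linear i b : linear (fun y : mor (P i) (P b) => fromend y).
Proof. exact: mon_tensm_linearl. Qed.
Lemma fromend_comp i b c (g : mor (P b) (P c)) (f : mor (P i) (P b)) :
  fromend (g \c f) = fromend g \w fromend f.
Proof. exact: tensm_compl. Qed.
Lemma fromend_rd i b : fromend (dmor i b) = rd i b.
Proof. by rewrite -toend_rd toendK. Qed.

Lemma entry_off n (z : end_mod P n) i b : b != i + n -> entry z i b = 0.
Proof. by move=> h; rewrite /entry component_neq // eq_sym. Qed.
Lemma entry_dE n (y : end_mod P n) i b : entry (end_d y) i b =
  dmor (b - 1) b \c entry y i (b - 1) - K n *: (entry y (i + 1) b \c dmor i (i + 1)).
Proof.
case: (eqVneq (b - 1) (i + n)) => e; first by rewrite (entry_d _ _ e erefl).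
rewrite !entry_off ?(linfun0 (comp_linearl _)) ?(linfun0 (comp_linearr _)) ?scaler0 ?subrr //.
all: apply: contra e => /eqP e; apply/eqP; lia.
Qed.

(** Postcomposition with the augmentation: the map from End(P) to Hom(P, I) through which End(P) is
    compared with the arity 0 part of B. *)
Definition ustar n (y : end_mod P n) i : wm [:: i] [::] := u \w fromend (entry y i 0).
Lemma ustar_linear n i : linear (fun y : end_mod P n => ustar y i).
Proof.
move=> a x y; rewrite /ustar (@entry_lin _ _ P n i 0) fromend_linear; exact: wc_linr.
Qed.
Lemma ustar_d n (y : end_mod P n) i : ustar (end_d y) i = - K n *: (ustar y (i + 1) \w rd i (i + 1)).
Proof.
have hl := @fromend_linear i 0.
rewrite /ustar entry_dE (linfunD hl) (linfunN hl) (linfunZ hl) !fromend_comp !fromend_rd.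
rewrite (linfunD (wc_linr _)) (linfunN (wc_linr _)) (linfunZ (wc_linr _)).
by rewrite !wcA rud wc0f sub0r scaleNr.
Qed.

(** An endomorphism of degree n as a cochain of arity 1, to which [del_lift] applies. *)
Definition toV n (y : end_mod P n) : V n :=
  mk n (fun a t => if t is [:: b] return wm [:: a] t then fromend (entry y a b) else 0).
Lemma hat_toV n (y : end_mod P n) a b : (toV y)`_[a, [:: b]] = fromend (entry y a b).
Proof.
rewrite hat_mk_hom // => h; rewrite /entry component_neq ?(linfun0 (@fromend_linear _ _)) //.
by apply: contra h => /eqP /= <-; rewrite /src wt_cons wt_nil; apply/eqP; ring.
Qed.
Definition ofV n j (h : V j) : end_mod P n := fun i => toend (h`_[i, [:: i + n]]).
Lemma entry_ofV n j (h : V j) i b : n = j -> entry (ofV n h) i b = toend (h`_[i, [:: b]]).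
Proof.
move=> e; rewrite /entry; case: (eqVneq b (i + n)) => [->|hb]; first by rewrite component_ltr.
rewrite component_neq 1?eq_sym // hat_off ?(linfun0 (@toend_linear _ _)) //.
by apply: contra hb => /eqP ->; rewrite /src wt_cons wt_nil e; apply/eqP; ring.
Qed.

Lemma end_exact n j (y : E n) c (sigma : wm [:: c + 1] [::]) : n = j + 1 -> c = src n [::] ->
  end_d y = 0 -> ustar y c = sigma \w rd c (c + 1) ->
  exists z : E j, y = dga_b [:: @ltr _ E j z] n.
Proof.
move=> en hc hy hs.
have [||h [h1 _]] := @del_lift k C R 1 n (toV y) (fun a => tcast (F := fun a => wm [:: a] [::]) a sigma).
- move=> a [|b [|? ?]] // _; rewrite hat_del ract_D1 !hat_toV.
  rewrite -!fromend_rd -!fromend_comp.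
  have := congr1 (fun z => fromend (entry z a b)) hy.
  rewrite entry_dE (linfun0 (@entry_lin _ _ P _ a b)) (linfun0 (@fromend_linear _ _)).
  rewrite (linfunD (@fromend_linear _ _)) (linfunN (@fromend_linear _ _)) (linfunZ (@fromend_linear _ _)) => e.
  by move/eqP: e; rewrite subr_eq0 => /eqP ->; rewrite koszul_inv subrr.
- move=> a; rewrite /src wt_nseq => ha; have -> : a = c by rewrite hc /src wt_nil; lia.
  rewrite hat_toV -[uw R _]/(uw R [:: 0]) uw1 [LHS]hs.
  by rewrite (@tcast_id k int (fun a => wm [:: a] [::])).
(* [del] is h d - K n d h, and [end_d] is d h - K n h d; the factor K n and the sign of [dga_b] turn
   one into the other. *)
exists (K n *: ofV (j + 1) h).
have e i b : entry (ofV (j + 1) h) i b = toend (h`_[i, [:: b]]) by rewrite entry_ofV.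
rewrite /=; apply: entry_inj => i b; have he n' := @entry_lin _ _ P n' i b.
rewrite (linfunN (he _)) entry_component; last by rewrite en.
rewrite entry_dE !(linfunZ (@entry_lin _ _ P _ _ _)) !e (linfunZ (comp_linearl _)) (linfunZ (comp_linearr _)).
rewrite -en koszul_inv opprB.
have := congr1 (fun x => toend x) (h1 i [:: b] erefl).
rewrite hat_del ract_D1 hat_toV fromendK => <-.
rewrite (linfunD (@toend_linear _ _)) (linfunN (@toend_linear _ _)) (linfunZ (@toend_linear _ _)).
by rewrite !toend_comp !toend_rd.
Qed.

Variable m : V 1.
Hypothesis m_nil : forall a, m`_[a, [::]] = 0.
Hypothesis m_single : forall a b, m`_[a, [:: b]] = rd a b.
Hypothesis m_unit : uw R [:: 0; 0] \w m`_[0, [:: 0; 0]] = u.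
Hypothesis m_mc : forall a t, ract m (hat (ltr m) a) t = 0.
Local Notation cmp := (comparison m).

Definition trans w j : E j :=
  bis (wdeg w) *: ((fun i => toend (cmp i (i + (j + 1)) w)) : end_mod P (j + 1)).
(** By [comparison_nil], [trans [::] 0] is the differential of P. It is not part of the morphism and
    enters the relation through b_1 instead. *)
Definition morph w j : E j := if nilp w then 0 else trans w j.

Lemma trans_multilinear j : multilinear (trans ^~ j).
Proof.
apply: (multilinear_wdeg bis (phi := fun w => (fun i => toend (cmp i (i + (j + 1)) w)) : end_mod P (j + 1))).
move=> u t i a x y; apply: functional_extensionality_dep => l.
have hm := comparison_multilinear m l (l + (j + 1)).
rewrite (hm u t i a x y); exact: (@toend_linear l (l + (j + 1))).
Qed.
Lemma entry_trans w j i b : j = wdeg w -> entry (trans w j) i b = bis (wdeg w) *: toend (cmp i b w).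
Proof.
move=> e; rewrite /trans (linfunZ (@entry_lin _ _ _ _ _ _)); congr (_ *: _).
rewrite /entry; case: (eqVneq b (i + (j + 1))) => [->|h]; first by rewrite component_ltr.
rewrite component_neq 1?eq_sym // comparison_deg ?(linfun0 (@toend_linear _ _)) //.
by move=> hb; move/eqP: h; apply; rewrite hb e; ring.
Qed.
Lemma trans_off w j : j != wdeg w -> trans w j = 0.
Proof.
move=> h; rewrite /trans -[RHS](scaler0 _ (bis (wdeg w))); congr (_ *: _).
apply: functional_extensionality_dep => i.
rewrite comparison_deg ?(linfun0 (@toend_linear _ _)) // => e; move/eqP: h; apply; lia.
Qed.

Lemma morph_map : multimap 0 morph.
Proof.
split=> [j u t i|w j|//]; last by rewrite addr0 /morph; case: nilp => //; exact: trans_off.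
apply: (linear_ext (g := fun x : V i => trans (u ++ ltr x :: t) j)); last exact: trans_multilinear.
by move=> x; rewrite /morph; case: u.
Qed.

Local Notation B := (binf m_mc).
Local Notation Q := (binf_b (binf_str B)).

Lemma wdeg_insertion (p c : nat) w : wdeg (insertion Q p c w) = wdeg w + 1.
Proof.
rewrite /insertion wdeg_cat wdeg_cons -[in RHS](cat_take_drop p w) wdeg_cat.
rewrite -[in RHS](cat_take_drop c (drop p w)) drop_drop [(c + p)%N]addnC wdeg_cat /=; ring.
Qed.

Lemma entry_morph w j i b : w <> [::] -> j = wdeg w ->
  entry (morph w j) i b = bis (wdeg w) *: toend (cmp i b w).
Proof. by case: w => // x w _ h; rewrite entry_trans. Qed.

Lemma entry_ainf_sum w j i b : j = wdeg w + 1 -> entry (ainf_sum morph Q w j) i b =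
  - (bis (wdeg w + 1) *: cut (fun x1 x2 => K (wdeg x1 * wdeg x2 + wdeg x2) *:
     (toend (cmp (b - 1 - wdeg x1) b x1) \c toend (cmp i (b - 1 - wdeg x1) x2))) w).
Proof.
move=> hj; have he := @entry_lin _ _ P (j + 1) i b; have ht := @toend_linear i b.
have e : cut (fun x1 x2 => K (wdeg x1 * wdeg x2 + wdeg x2) *:
     (toend (cmp (b - 1 - wdeg x1) b x1) \c toend (cmp i (b - 1 - wdeg x1) x2))) w =
   toend (cut (fun x1 x2 => K (wdeg x1 * wdeg x2 + wdeg x2) *:
     (cmp (b - 1 - wdeg x1) b x1 \w cmp i (b - 1 - wdeg x1) x2)) w).
  rewrite (cut_linear _ _ ht); apply: cut_ext => x1 x2 _.
  by rewrite (linfunZ ht) toend_comp.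
rewrite e -scalerN -(linfunN ht) -(comparison_diff m_nil m_mc).
rewrite /ainf_sum (linfun_sum he) (linfun_sum ht) scaler_sumr; apply: eq_bigr => p _.
rewrite (linfun_sum he) (linfun_sum ht) scaler_sumr; apply: eq_bigr => c _.
rewrite (linfunZ he) (linfunZ ht) entry_morph ?wdeg_insertion //; last first.
  by rewrite /insertion; case: (take p w).
by rewrite !scalerA mulrC.
Qed.

Lemma value_morph w : value 0 morph w = ltr (morph w (wdeg w)).
Proof. by rewrite /value addr0. Qed.

Local Notation entry_d := (@entry_d _ _ P).
Lemma entry_b1 w j i b : w <> [::] -> j = wdeg w + 1 -> b = i + (j + 1) ->
  entry (dga_b [:: value 0 morph w] j) i b = bis (wdeg w) *:
   (- (dmor (b - 1) b \c toend (cmp i (b - 1) w)) - K (wdeg w) *: (toend (cmp (i + 1) b w) \c dmor i (i + 1))).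
Proof.
move=> w0 hj hb; have he n := @entry_lin _ _ P n i b.
rewrite value_morph /= (linfunN (he _)) entry_component; last by rewrite hj.
rewrite (@entry_d _ _ i b (b - 1) (i + 1)) //; last by rewrite hb hj; ring.
rewrite !entry_morph // koszulS scaleNr opprK.
rewrite (linfunZ (comp_linearl _)) (linfunZ (comp_linearr _)) opprD scalerBr scalerN.
by rewrite [K _ *: (_ *: _)]scalerA mulrC -scalerA.
Qed.

Lemma entry_b2 x1 x2 j i b : x1 <> [::] -> x2 <> [::] -> j = wdeg x1 + wdeg x2 + 1 -> b = i + (j + 1) ->
  entry (dga_b [:: value 0 morph x1; value 0 morph x2] j) i b =
   - ((bis (wdeg x1) * bis (wdeg x2) * K (wdeg x1)) *:
     (toend (cmp (b - 1 - wdeg x1) b x1) \c toend (cmp i (b - 1 - wdeg x1) x2))).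
Proof.
move=> w1 w2 hj hb; have he n := @entry_lin _ _ P n i b.
rewrite !value_morph /= (linfunN (he _)) (linfunZ (he _)) entry_component; last by rewrite hj; ring.
rewrite (@entry_mul _ _ _ _ _ _ _ _ _ (b - 1 - wdeg x1)); last by rewrite hb hj; ring.
rewrite !entry_morph // (linfunZ (comp_linearl _)) (linfunZ (comp_linearr _)) !scalerA.
by congr (- (_ *: _)); ring.
Qed.

(** Both sides become sums over the cuts of w. A cut with an empty piece is a composition with the
    differential of P, hence belongs to b_1; the other cuts are the products in b_2. The signs agree
    by [bisignD]. *)
Lemma morph_rel w j :
    \sum_(r < (size w).+1)
      \sum_(u : r.-tuple 'I_(size w).+1 | all (fun l : 'I__ => 0 < l)%N u
                                         && (\sum_(l <- u) l == size w)%N)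
        dga_b [seq value 0 morph v | v <- reshape [seq val l | l <- u] w] j
    = ainf_sum morph Q w j.
Proof.
have [->|w0] := pselect (w = [::]).
  by rewrite /ainf_sum big_ord1 big_ord0 big1 // => u _; rewrite [u]tuple0.
rewrite (@sum_blocks _ _ (fun s => dga_b [seq value 0 morph v | v <- s] j)) //; last first.
  by move=> [|x1 [|x2 [|x3 s]]].
have [hj|/eqP hj] := pselect (j = wdeg w + 1); last first.
  have [_ hb _] := dga_b_map (end_dga P); have [_ hf _] := morph_map.
  rewrite [X in dga_b X j]/= hb; last by rewrite value_morph wdeg_ltr.
  rewrite add0r big1 => [|p _]; last first.
    apply: hb; rewrite [map _ _]/= !value_morph wdeg_cons wdeg_single.
    by rewrite -[in wdeg w](cat_take_drop p w) wdeg_cat in hj.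
  symmetry; apply: big1 => p _; apply: big1 => c _.
  by rewrite hf ?scaler0 // wdeg_insertion addr0.
apply: end_ext => i; set b := i + (j + 1).
have he := @entry_lin _ _ P (j + 1) i b.
rewrite (linfunD he) (linfun_sum he) entry_ainf_sum // cut_ends // [map _ _]/=.
rewrite (@entry_b1 w j i b) // !scalerDr opprD opprD scaler_sumr.
have e0 d : bis (d + 1) *: (K d *: (dmor (b - 1) b \c toend (cmp i (b - 1) w))) = bis d *: (dmor (b - 1) b \c toend (cmp i (b - 1) w)).
  by rewrite bisignS -scalerA koszul_inv.
rewrite !wdeg_nil !subr0 mul0r mulr0 add0r !(comparison_nil m_single) !toend_rd e0 koszul0 scale1r.
have -> : b - 1 - wdeg w = i + 1 by rewrite /b hj; ring.
have hb : b = i + (j + 1) by []; clearbody b.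
rewrite !scalerN -!addrA; congr (_ + _); rewrite [RHS]addrC; congr (_ + _); first by rewrite bisignS -scalerA.
rewrite big_nat [in RHS]big_nat -sumrN; apply: eq_bigr => p /andP[p1 p2].
have ew : wdeg w = wdeg (take p w) + wdeg (drop p w) by rewrite -wdeg_cat cat_take_drop.
rewrite /= entry_b2 //; last 3 first.
- by move=> h; have := congr1 size h; rewrite size_takel ?(ltnW p2) //=; lia.
- by move=> h; have := congr1 size h; rewrite size_drop /=; lia.
- by rewrite hj ew.
rewrite scalerA; congr (- (_ *: _)); rewrite bisignS ew bisignD !koszulD.
move: (wdeg (take p w)) (wdeg (drop p w)) => d1 d2.
have h d : K d * K d = 1 by rewrite -koszulD koszul_sq.
rewrite [RHS](_ : _ = bis d1 * bis d2 * K d1 * (K d2 * K d2) * (K (d1 * d2) * K (d1 * d2))); last by ring.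
by rewrite !h !mulr1.
Qed.

Definition comparison_morphism : ainf_morphism (ainf_of_binf B) (ainf_of_dga (end_dga P)) :=
  @Build_ainf_morphism k (ainf_of_binf B) (ainf_of_dga (end_dga P)) morph morph_map morph_rel.

Local Notation q := (q m).
Local Notation phi := (phi R m).
Local Notation f := comparison_morphism.

Lemma comparison_single n (v : V n) i b :
  comparison m i b [:: ltr v] = lw b v`_[src n [::], [::]] \w m`_[i, [:: b; src n [::]]].
Proof.
rewrite /comparison act1E !cut_nil wt_nil mulr0 koszul0 scale1r /comp_functional hat_src.
rewrite [X in lw b X](tagged_inj (rw_nil (ev (ltr v) [::]))) wcast_id //.
Qed.

(** After augmentation f_1 is, up to sign, the projection to arity 0 followed by the counit
    constraint [phi], which is the identity on cohomology up to sign by [phi_homotopy]. *)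
Lemma ustar_morph n (v : V n) c : c = src n [::] ->
  ustar (f [:: ltr v] n : end_mod P (n + 1)) c = bis n *: (v`_[c, [::]] \w phi c).
Proof.
move=> hc; rewrite /ustar entry_morph // wdeg_ltr; last by [].
rewrite (linfunZ (@fromend_linear _ _)) (linfunZ (wc_linr _)) toendK comparison_single -hc.
by rewrite wcA unit_lw -[phi c]/(rw [:: c] u \w m`_[c, [:: 0; c]]) !wcA.
Qed.

Lemma end_b1 j (z : E j) : dga_b [:: @ltr _ E j z] (j + 1) = - end_d z.
Proof. by rewrite /= component_ltr. Qed.
Lemma morph_b1 n (v : V n) :
  dga_b [:: @ltr _ E n (f [:: ltr v] n)] (n + 1) = f [:: ltr (Q [:: ltr v] (n + 1))] (n + 1).
Proof.
have := ainf_f_rel f [:: ltr v] (n + 1).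
rewrite (@sum_blocks _ _ (fun s => dga_b [seq value 0 f v | v <- s] (n + 1))) //; last first.
  by move=> [|x1 [|x2 [|x3 s]]].
rewrite big_geq // addr0 [map _ _]/= (value_eq _ _ (wdeg_ltr v)) addr0 => ->.
rewrite /ainf_sum big_ord1 big_nat1 /insertion [take _ _]/= [take _ _]/= [drop _ _]/= wdeg_nil scale1r.
by rewrite (value_eq _ _ (wdeg_ltr v)).
Qed.
Lemma morph_zero n j : f [:: ltr (0 : V n)] j = 0.
Proof. by have [h _ _] := ainf_f_map f; exact: (linfun0 (h j [::] [::] n)). Qed.

Lemma morph_closed n (v : V n) : q v = 0 -> end_d (f [:: ltr v] n : end_mod P (n + 1)) = 0.
Proof.
move=> hv; have := morph_b1 v; rewrite Q1 // hv morph_zero end_b1 => /eqP.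
by rewrite oppr_eq0 => /eqP.
Qed.

Lemma arity0_cocycle n (v : V n) c : q v = 0 -> v`_[c, [::]] \w rd (c - 1) c = 0.
Proof.
move=> hv; have := q_nil m_nil m_single v (c - 1).
by rewrite hv hat0 subrK.
Qed.

Lemma supp1 n (v : V n) : v`_[src n [::], [::]] = 0 -> supp 1 v.
Proof.
move=> h a [|? ?] // _; case: (eqVneq a (src n [::])) => [->//|]; exact: hat_off.
Qed.

Lemma arity0_exists n c (tau : wm [:: c] [::]) : c = src n [::] -> exists v : V n, v`_[c, [::]] = tau.
Proof.
move=> hc.
exists (mk n (fun a t => if t is [::] return wm [:: a] t then tcast (F := fun a => wm [:: a] [::]) a tau else 0)).
by rewrite hat_mk; case: eqP => // _; exact: (@tcast_id k int (fun a => wm [:: a] [::])).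
Qed.

(** By [ustar_morph] and [phi_homotopy] the arity 0 part of x is a coboundary. An element z0 of
    Hom(P, I) removes it, and [acyclic] removes the remainder, of positive arity. *)
Lemma qiso_inj n j (x : V n) : n = j + 1 -> Q [:: ltr x] (n + 1) = 0 ->
  (exists z : E j, f [:: ltr x] n = dga_b [:: @ltr _ E j z] n) -> exists z : V j, x = Q [:: ltr z] n.
Proof.
move=> en; move: x; rewrite {n}en => x; set n := j + 1; rewrite Q1 // => hx [z hz].
set c := src n [::]; have hr := arity0_cocycle c hx.
have [s hs] := phi_homotopy m_nil m_single m_unit m_mc hr.
have hc : c + 1 = src j [::] by rewrite /c /n /src; ring.
have := ustar_morph x (erefl c); rewrite hz end_b1 (linfunN (@ustar_linear _ c)).
rewrite ustar_d scaleNr opprK hs => e.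
(* Obtained by solving the equation e, with hs inserted, for the arity 0 part of x; all signs are
   their own inverses. *)
pose sg : wm [:: c + 1] [::] := K c *: (bis n *: (K (j + 1) *: ustar z (c + 1)) - s).
have es : x`_[c, [::]] = sg \w rd c (c + 1).
  rewrite /sg (linfunZ (wc_linl _)) (linfunD (wc_linl _)) (linfunN (wc_linl _)) !(linfunZ (wc_linl _)) e.
  by rewrite koszul_inv addrK koszul_inv.
have [z0 hz0] := arity0_exists sg hc.
have [|| z1 [_ hz1]] := acyclic m_nil m_single m_unit m_mc (w := x - q z0).
- apply: supp1; rewrite hatD hatN (q_nil m_nil m_single) es hz0; exact: subrr.
- by rewrite qB // hx q_sq // subrr.
exists (z0 + z1); rewrite Q1 // qD hz1 addrC subrK //.
Qed.

(** The class of y in Hom(P, I) prescribes the arity 0 part x0. As q x0 has positive arity,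
    [acyclic] supplies a correction x1 that makes x closed. Then y - f x has an exact augmentation
    and is exact by [end_exact]. *)
Lemma qiso_surj n j (y : E n) : n = j + 1 -> dga_b [:: @ltr _ E n y] (n + 1) = 0 ->
  exists x : V n, Q [:: ltr x] (n + 1) = 0 /\
    exists z : E j, y = f [:: ltr x] n + dga_b [:: @ltr _ E j z] n.
Proof.
move=> en; rewrite end_b1 => /eqP; rewrite oppr_eq0 => /eqP hy.
set c := src n [::].
have hr : ustar y c \w rd (c - 1) c = 0.
  have := ustar_d y (c - 1); rewrite hy (linfun0 (@ustar_linear _ (c - 1))) subrK.
  by rewrite scaleNr => /esym/eqP; rewrite oppr_eq0 => /eqP; exact: koszul_eq0.
(* The two signs cancel those of [ustar_morph] and [phi_homotopy]. *)
have [x0 hx0] := arity0_exists (bis n *: (K c *: ustar y c)) (erefl c).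
have hr0 : x0`_[c, [::]] \w rd (c - 1) c = 0 by rewrite hx0 !(linfunZ (wc_linl _)) hr !scaler0.
have [||x1 [s1 hx1]] := acyclic m_nil m_single m_unit m_mc (w := q x0).
- apply: supp1; rewrite (q_nil m_nil m_single) (_ : src (n + 1) [::] = c - 1) ?subrK //; rewrite /c /src; ring.
- exact: q_sq.
pose x := x0 - x1; have hx : q x = 0 by rewrite qB // hx1 subrr.
have xc : x`_[c, [::]] = x0`_[c, [::]] by rewrite hatD hatN s1 // subr0.
exists x; rewrite Q1 //; split=> //.
have [s hs] := phi_homotopy m_nil m_single m_unit m_mc hr0.
have hl := @ustar_linear (n + 1) c.
have [||z hz] := @end_exact n j (y - f [:: ltr x] n) c (- (bis n *: s)) en erefl.
- have hd := @end_d_linear _ _ P (n + 1).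
  have e (x2 x3 : end_mod P (n + 1)) : end_d x2 = 0 -> end_d x3 = 0 -> end_d (x2 - x3) = 0.
    by move=> h2 h3; rewrite (linfunD hd) (linfunN hd) h2 h3 subr0.
  exact: e hy (morph_closed hx).
- rewrite (linfunD hl) (linfunN hl) (ustar_morph x (erefl c)) xc hs hx0 scalerDr.
  have -> (v : wm [:: c] [::]) : bis n *: (K c *: (bis n *: (K c *: v))) = v.
    by rewrite [K c *: (bis n *: _)]scalerA [K c * _]mulrC -scalerA !koszul_inv.
  by rewrite opprD addrA subrr add0r (linfunN (wc_linl _)) (linfunZ (wc_linl _)).
by exists z; rewrite -hz addrC subrK.
Qed.

Lemma comparison_qiso : ainf_qiso f.
Proof.
move=> n; have en : n = n - 1 + 1 by rewrite subrK.
by split=> [x|y]; [exact: qiso_inj|exact: qiso_surj].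
Qed.
End Morphism.

Theorem theorem1p1 (k : comPzRingType) (A : klinear_monoidal_category k)
    (A_abelian : abelian A)
    (A_enough : enough_projectives A)
    (A_exact : forall P : A, projective P ->
       exact_functor (F := fun X : A => mon_tens P X)
         (fun (X Y : A) (f : mor X Y) => mon_tensm (idm P) f))
    (P : projective_resolution (mon_unit A)) :
  exists (B : binf_algebra k)
         (f : ainf_morphism (ainf_of_binf B) (ainf_of_dga (end_dga P))),
    ainf_qiso f.
Proof.
have [m [m_nil m_single m_unit m_mc]] := mc_exists (resolution A_abelian A_exact P).
by exists (binf m_mc), (comparison_morphism m_nil m_single m_mc); exact: comparison_qiso.
Qed.
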